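(* Let $N\ge 1$, $1<p<N$, let $a,b\in\mathbb{R}$ with $b+1\neq a$, and put $c=\frac{(p-1)a+b+1}{p}$. Then: (i) there do not exist constants $C>0$ and $\alpha>0$ such that $$\left(\frac{\inf_{v\in\mathcal{M}_{p,a,b}}\|u-v\|_{H^p_b}}{\|u\|_{L^p_c}}\right)^{\alpha}\le C\,\delta_{p,a,b}(u)$$ holds for all $u\in H^p_b(\mathbb{R}^N)\cap L^p_a(\mathbb{R}^N)$, $u\ne 0$; (ii) there do not exist constants $C>0$ and $\alpha>0$ such that $$\left(\frac{\inf_{v\in\mathcal{M}_{p,a,b}}\|u-v\|_{L^p_a}}{\|u\|_{L^p_c}}\right)^{\alpha}\le C\,\delta_{p,a,b}(u)$$ holds for all $u\in H^p_b(\mathbb{R}^N)\cap L^p_a(\mathbb{R}^N)$, $u\neq 0$.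
   Context: For $p>1$ and $a,b\in\mathbb{R}$, $H^p_b=H^p_b(\mathbb{R}^N)$ is the closure of $C_c^\infty(\mathbb{R}^N\setminus\{0\})$ under the norm $\|u\|_{H^p_b}=\left(\int_{\mathbb{R}^N}|x|^{-pb}|\nabla u|^p\,dx\right)^{1/p}$, and $L^p_a=L^p_a(\mathbb{R}^N)$ is the closure of $C_c^\infty(\mathbb{R}^N\setminus\{0\})$ under the norm $\|u\|_{L^p_a}=\left(\int_{\mathbb{R}^N}|x|^{-pa}|u|^p\,dx\right)^{1/p}$ (and likewise $L^p_c$). $S_{p,a,b}$ is the best (largest) constant $S$ in the Caffarelli-Kohn-Nirenberg inequality $\|u\|_{H^p_b}\|u\|_{L^p_a}^{p-1}\ge S\|u\|_{L^p_c}^p$. $\mathcal{M}_{p,a,b}$ is the set of minimizers, i.e. of functions $v\in H^p_b\cap L^p_a$ for which equality $\|v\|_{H^p_b}\|v\|_{L^p_a}^{p-1}=S_{p,a,b}\|v\|_{L^p_c}^p$ holds. The deficit of $u\in H^p_b\cap L^p_a$, $u\ne0$, is $$\delta_{p,a,b}(u)=\frac{\|u\|_{H^p_b}\|u\|_{L^p_a}^{p-1}}{\|u\|_{L^p_c}^p}-S_{p,a,b}.$$ *)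

(* Defs.v *)
From HB Require Import structures.
From mathcomp Require Import all_boot all_order all_algebra.
From mathcomp Require Import all_classical all_reals all_analysis.

Set Implicit Arguments.
Unset Strict Implicit.
Unset Printing Implicit Defensive.

Import Order.TTheory GRing.Theory Num.Theory.
Import numFieldNormedType.Exports.

Local Open Scope classical_set_scope.
Local Open Scope ring_scope.

(* The sigma-algebra on R^n generated by the coordinate projections; since R is
   second countable, it is the Borel sigma-algebra. *)
Section measurable_rV.
Context {R : realType} {n : nat}.

Let coord (i : 'I_n) (x : 'rV[R]_n) : measurableTypeR R := x ord0 i.

Let rV_set0 : g_sigma_preimage coord set0.
Proof. exact: sigma_algebra0. Qed.

Let rV_setC A : g_sigma_preimage coord A -> g_sigma_preimage coord (~` A).
Proof. exact: sigma_algebraC. Qed.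

Let rV_bigcup (F : _^nat) : (forall i, g_sigma_preimage coord (F i)) ->
  g_sigma_preimage coord (\bigcup_i (F i)).
Proof. exact: sigma_algebra_bigcup. Qed.

HB.instance Definition _ := @isMeasurable.Build default_measure_display
  'rV[R]_n (g_sigma_preimage coord) rV_set0 rV_setC rV_bigcup.

Lemma measurable_coord (i : 'I_n) :
  measurable_fun [set: 'rV[R]_n]
    (fun x : 'rV[R]_n => x ord0 i : measurableTypeR R).
Proof.
move=> _ Y mY; rewrite setTI; apply: sub_sigma_algebra => /=.
rewrite -bigcup_seq/=; exists i => /=; first by rewrite mem_index_enum.
by exists Y => //; rewrite setTI.
Qed.

Lemma measurable_fun_rVP d (T : measurableType d) (f : T -> 'rV[R]_n) :
  measurable_fun [set: T] f <->
  forall i, measurable_fun [set: T] (fun t => f t ord0 i : measurableTypeR R).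
Proof.
split=> [mf i|mf]; first exact: (measurableT_comp (@measurable_coord i) mf).
apply: (@measurability _ _ _ _ setT f
  (\big[setU/set0]_(j < n)
     preimage_set_system setT (coord j) measurable)) => //.
move=> _ [B + <-].
rewrite -bigcup_seq/= => -[i _ [A mA <-]].
rewrite [X in measurable X]setTI -comp_preimage.
by have := mf i measurableT A mA; rewrite [X in measurable X]setTI.
Qed.

End measurable_rV.

Section lebesgue_rV.
Context {R : realType}.

Definition cons_rV n (p : 'rV[R]_n * measurableTypeR R) : 'rV[R]_n.+1 :=
  \row_i (if unlift ord0 i is Some j then p.1 ord0 j else p.2).

Lemma measurable_cons_rV n :
  measurable_fun [set: 'rV[R]_n * measurableTypeR R] (@cons_rV n).
Proof.
apply/measurable_fun_rVP => i; case: (unliftP ord0 i) => [j ->|->].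
  rewrite (_ : (fun t => _) = (fun x : 'rV[R]_n => x ord0 j) \o fst).
    apply: measurableT_comp; last exact: measurable_fst.
    exact: measurable_coord.
  by apply/funext => t; rewrite mxE liftK.
rewrite (_ : (fun t => _) = snd); first exact: measurable_snd.
by apply/funext => t; rewrite mxE unlift_none.
Qed.

Section lebesgue_succ.
Variables (n : nat) (m : {measure set 'rV[R]_n -> \bar R}).

Definition lebS := pushforward (m \x (@lebesgue_measure R))%E (@cons_rV n).

Let mcons := @measurable_cons_rV n.

Let lebS0 : lebS set0 = 0%E.
Proof. by rewrite /lebS /pushforward preimage_set0 measure0. Qed.

Let lebS_ge0 A : (0 <= lebS A)%E.
Proof. exact: measure_ge0. Qed.

Let lebS_sigma_additive : semi_sigma_additive lebS.
Proof. exact: (@measure_semi_sigma_additive _ _ _ (pushforward _ _)). Qed.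

HB.instance Definition _ := isMeasure.Build _ _ _ lebS
  lebS0 lebS_ge0 lebS_sigma_additive.

End lebesgue_succ.

(* n-dimensional Lebesgue measure, as the iterated product of the measure on R. *)
Fixpoint leb n : {measure set 'rV[R]_n -> \bar R} :=
  match n with
  | 0 => \d_(0 : 'rV[R]_0)
  | m.+1 => lebS (leb m)
  end.

End lebesgue_rV.

Section calculus.
Context {R : realType} {n : nat}.
Implicit Types (f phi u : 'rV[R]_n -> R) (G : 'rV[R]_n -> 'rV[R]_n).

(* The library norm `|x| on 'rV[R]_n is the sup norm. *)
Definition enorm (x : 'rV[R]_n) : R := Num.sqrt (\sum_i x ord0 i ^+ 2).

Definition partiald (i : 'I_n) f (x : 'rV[R]_n) : R :=
  'D_(delta_mx ord0 i) f x.

Fixpoint class_C (k : nat) f : Prop :=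
  match k with
  | 0 => continuous f
  | l.+1 => continuous f /\
      forall i, (forall x, derivable f x (delta_mx ord0 i)) /\
                class_C l (partiald i f)
  end.

Definition smooth f : Prop := forall k, class_C k f.

Definition tsupport f : set 'rV[R]_n := closure [set x | f x != 0].

Definition test_fun phi : Prop :=
  [/\ smooth phi, compact (tsupport phi) & ~ tsupport phi 0].

Definition loc_integrable u : Prop :=
  measurable_fun [set: 'rV[R]_n] u /\
  forall K : set 'rV[R]_n, compact K -> ~ K 0 ->
    (\int[leb n]_(x in K) `|u x|%:E < +oo)%E.

(* Weak gradient on R^n minus the origin: test functions vanish near 0. *)
Definition is_wgrad u G : Prop :=
  (forall i, loc_integrable (fun x => G x ord0 i)) /\
  forall phi i, test_fun phi ->
    (\int[leb n]_x (u x * partiald i phi x)%:E =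
     - \int[leb n]_x (G x ord0 i * phi x)%:E)%E.

Definition wdifferentiable u : Prop :=
  loc_integrable u /\ exists G, is_wgrad u G.

(* Defined up to a null set; the junk value 0 is taken when u has no weak
   gradient. *)
Definition wgrad u : 'rV[R]_n -> 'rV[R]_n := xget (fun=> 0) (is_wgrad u).

End calculus.

Section spaces.
Context {R : realType} {n : nat}.
Implicit Types (p a b s : R) (u v phi : 'rV[R]_n -> R).
Local Open Scope ereal_scope.

Definition wLnorm p s u : \bar R :=
  (\int[leb n]_x (enorm x `^ (- (p * s)) * `|u x| `^ p)%:E) `^ p^-1.

Definition wHnorm p b u : \bar R := wLnorm p b (fun x => enorm (wgrad u x)).

Definition wLspace p a : set ('rV[R]_n -> R) :=
  [set u : 'rV[R]_n -> R | measurable_fun [set: 'rV[R]_n] u /\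
    exists phi : nat -> 'rV[R]_n -> R,
      (forall k, test_fun (phi k)) /\
      wLnorm p a (u \- phi k)%R @[k --> \oo] --> 0].

(* The completion of the test functions under wHnorm p b, realised as a space of
   functions: the limit u of a Cauchy sequence is identified through
   convergence in L^1_loc away from the origin. Closing under wHnorm p b alone
   inside the weakly differentiable functions would be wrong, since constants
   have seminorm 0: any u + const would be added. *)
Definition wHspace p b : set ('rV[R]_n -> R) :=
  [set u : 'rV[R]_n -> R | wdifferentiable u /\
    exists phi : nat -> 'rV[R]_n -> R,
      [/\ forall k, test_fun (phi k),
          forall K : set 'rV[R]_n, compact K -> ~ K 0%R ->
            \int[leb n]_(x in K) `|u x - phi k x|%:E @[k --> \oo] --> 0 &
          wHnorm p b (u \- phi k)%R @[k --> \oo] --> 0]].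

Definition ckn_c p a b : R := (((p - 1) * a + b + 1) / p)%R.

Definition ckn_lhs p a b u : \bar R :=
  wHnorm p b u * wLnorm p a u `^ (p - 1).

Definition ckn_rhs p a b u : \bar R := wLnorm p (ckn_c p a b) u `^ p.

Definition ckn_best p a b : R :=
  sup [set S : R | forall u, wHspace p b u -> wLspace p a u ->
                     S%:E * ckn_rhs p a b u <= ckn_lhs p a b u].

Definition minimizers p a b : set ('rV[R]_n -> R) :=
  [set v : 'rV[R]_n -> R | [/\ wHspace p b v, wLspace p a v &
    ckn_lhs p a b v = (ckn_best p a b)%:E * ckn_rhs p a b v]].

Definition deficit p a b u : \bar R :=
  ckn_lhs p a b u / ckn_rhs p a b u - (ckn_best p a b)%:E.

Definition ae_zero u : Prop := {ae leb n, forall x, u x = 0%R}.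

End spaces.

(* Main.v *)
Require Import Defs.
From HB Require Import structures.
From mathcomp Require Import all_boot all_order all_algebra.
From mathcomp Require Import all_classical all_reals all_analysis.
From mathcomp Require Import measurable_realfun.
From mathcomp Require Import ring lra.

Set Implicit Arguments.
Unset Strict Implicit.
Unset Printing Implicit Defensive.

Import Order.TTheory GRing.Theory Num.Theory.
Import numFieldNormedType.Exports.

Local Open Scope classical_set_scope.
Local Open Scope ring_scope.

Arguments leb {R} n : simpl never.

(* Write [M] for the set of minimizers. If [v] is a minimizer, then for almost
   every [y] the function [x |-> v (|x| y)] is again admissible, with weak
   gradient [(y . grad v (|x| y)) x / |x|]. Applying the inequality to it,
   linearising the product of the norms by Young's inequality with the weights
   for which [v] itself is an equality case, and integrating over
   [1 <= |y| <= 2] (only dilations and Tonelli are involved, no polar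
   coordinates), one finds that the full gradient of [v] has no more energy
   than its radial part. Hence the gradient of [v] is radial almost everywhere,
   and [v] is orthogonal to every [psi = (x_i d_j - x_j d_i) phi], where [phi]
   is a test function and [i <> j]; such [i, j] exist since [1 < p < N].
   For [u = psi (l x)] and [v] in [M] this gives
   [int u^2 = int (u - v) u = int ((x_j d_i - x_i d_j) (u - v)) (phi (l x))],
   which weighted Hoelder inequalities bound by the distance from [u] to [v] in
   [L^p_a] and in [H^p_b] times dual norms of dilated test functions. By scaling,
   the two quotients in the statement are at least a constant times [l^(a - c)]
   and [l^(b + 1 - c)], while the deficit of [u] does not depend on [l]. Both
   exponents are nonzero because [b + 1 <> a]. *)

(** * Borel sets and Lebesgue measure on R^n *)

(** For general [a] and [b] no closed form of the minimizers is at hand, so what is known about them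
    has to come from the inequality itself. A function [v (|x| y)] of [x] has no angular derivative,
    and its gradient contains only the derivative of [v] along the ray of [y]; this is how the
    radial part gets isolated. The product of two norms is not additive in [y]: Young's inequality
    replaces it by a linear combination of integrals, which Tonelli can average, and nothing is lost
    at the minimizer because the weights are tuned to the ratio of its two norms. Both spaces are
    closures of test functions, so admissibility of [v (|x| y)] is a question about limits:
    approximations of [v] with summable errors converge along almost every ray, which is why almost
    every [y], and not every [y], is reached. Frozen test functions are again test functions because
    they vanish near the origin, the only point where [|x|] is not smooth. The final bounds hold for
    each minimizer with the same constants, so that an empty set of minimizers, at infinite distance
    from everything, is covered too. *)

Section borel.
Context {R : realType} {n : nat}.
Implicit Types (a b : 'rV[R]_n) (U : set 'rV[R]_n).

Definition obox a b : set 'rV[R]_n :=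
  [set x | forall i, a ord0 i < x ord0 i < b ord0 i].

Definition oboxes : set (set 'rV[R]_n) := [set obox a b | a in setT & b in setT].

Lemma oboxes_setI : setI_closed oboxes.
Proof.
move=> _ _ [a _ [b _ <-]] [c _ [d _ <-]].
exists (\row_i Num.max (a ord0 i) (c ord0 i)) => //.
exists (\row_i Num.min (b ord0 i) (d ord0 i)) => //.
apply/seteqP; split=> [x h|x [h1 h2]].
  by split=> i; have := h i; rewrite !mxE gt_max lt_min => /andP[/andP[h1 h2] /andP[h3 h4]]; rewrite ?h1 ?h2 ?h3 ?h4.
by move=> i; rewrite !mxE gt_max lt_min; case/andP: (h1 i) => -> ->; case/andP: (h2 i) => -> ->.
Qed.

Lemma measurable_obox a b : measurable (obox a b).
Proof.
rewrite (_ : obox a b = \bigcap_(i in [set: 'I_n]) ((fun x : 'rV[R]_n => x ord0 i) @^-1` `]a ord0 i, b ord0 i[)).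
  apply: fin_bigcap_measurable => // i _.
  by rewrite -[X in measurable X]setTI; apply: (@measurable_coord R n i).
apply/seteqP; split=> x /= h i; last by have := h i I; rewrite /= in_itv.
by move=> _ /=; rewrite in_itv /=; exact: h.
Qed.

(** Rational endpoints keep the union countable, which makes open sets measurable for the coordinate
    sigma-algebra. *)
Lemma open_bigcup_obox U : open U ->
  U = \bigcup_(q in [set q : 'rV[rat]_n * 'rV[rat]_n |
     obox (map_mx ratr q.1) (map_mx ratr q.2) `<=` U]) obox (map_mx ratr q.1) (map_mx ratr q.2).
Proof.
move=> oU; apply/seteqP; split=> [x Ux|x [q qU]]; last exact: qU.
have /nbhs_ballP[e /= e0 eU] : nbhs x U by apply: open_nbhs_nbhs.
have hq i : exists q : rat * rat, (x ord0 i - e < ratr q.1 < x ord0 i) /\ (x ord0 i < ratr q.2 < x ord0 i + e).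
  have /rat_in_itvoo[q1 /itvP h1] : x ord0 i - e < x ord0 i by rewrite ltrBlDr ltrDl.
  have /rat_in_itvoo[q2 /itvP h2] : x ord0 i < x ord0 i + e by rewrite ltrDl.
  by exists (q1, q2); rewrite !h1 !h2.
have [f fP] := choice hq.
exists (\row_i (f i).1, \row_i (f i).2) => /=; last first.
  by move=> i; rewrite !mxE; case: (fP i) => /andP[_ ->] /andP[-> _].
move=> y hy; apply: eU; split => // i j; rewrite (ord1 i) /ball /=.
have := hy j; rewrite !mxE => /andP[h1 h2]; case: (fP j) => /andP[h3 h4] /andP[h5 h6].
rewrite ltr_norml; apply/andP; split; lra.
Qed.

Lemma measurable_rV_open U : open U -> measurable U.
Proof.
move=> /open_bigcup_obox ->; rewrite bigcup_mkcond.
apply: countable_bigcupT_measurable; first exact: countableP.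
by move=> q; case: ifP => // _; exact: measurable_obox.
Qed.

Lemma measurable_rV_closed U : closed U -> measurable U.
Proof.
by move=> cU; rewrite -[U]setCK; apply: measurableC; apply: measurable_rV_open; exact: closed_openC.
Qed.

Lemma measurable_rV_compact U : compact U -> measurable U.
Proof. by move=> cU; apply: measurable_rV_closed; apply: compact_closed. Qed.

Lemma continuous_measurable_rV (f : 'rV[R]_n -> R) :
  continuous f -> measurable_fun [set: 'rV[R]_n] f.
Proof.
move=> cf; apply: (measurability _ (RGenOpens.measurableE R)) => _ [_ [x [y ->] <-]].
rewrite setTI; apply: measurable_rV_open; move/continuousP: cf; apply; exact: interval_open.
Qed.

(** Prepares the Dynkin argument of [annihilates_ae_box]: the boxes are also stable under
    intersection. *)
Lemma measurable_rV_oboxes : measurable = <<s oboxes >>.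
Proof.
apply/seteqP; split=> A; last first.
  apply: smallest_sub; first exact: sigma_algebra_measurable.
  by move=> _ [a _ [b _ <-]]; exact: measurable_obox.
have opG U : open U -> <<s oboxes >> U.
  move=> /open_bigcup_obox ->; rewrite bigcup_mkcond.
  apply: (@countable_bigcupT_measurable _ (g_sigma_algebraType oboxes)); first exact: countableP.
  move=> q; case: ifP => // _.
  apply: sub_sigma_algebra; exists (map_mx ratr q.1) => //; by exists (map_mx ratr q.2).
apply: smallest_sub; first exact: smallest_sigma_algebra.
rewrite -bigcup_seq => B [i _ /= [Y mY <-]]; rewrite setTI.
have mc : measurable_fun [set: g_sigma_algebraType oboxes] (fun x : 'rV[R]_n => x ord0 i : measurableTypeR R).
  apply: (measurability _ (RGenOpens.measurableE R)) => _ [_ [x [y ->] <-]].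
  rewrite setTI; apply: opG; move/continuousP: (@coord_continuous R 1 n ord0 i); apply; exact: interval_open.
by have := mc measurableT Y mY; rewrite setTI.
Qed.

End borel.

Section leb_theory.
Context {R : realType}.
Local Open Scope ereal_scope.

Lemma cons_rV0 n (x : 'rV[R]_n) t : cons_rV (x, t) ord0 ord0 = t.
Proof. by rewrite mxE unlift_none. Qed.

Lemma cons_rVS n (x : 'rV[R]_n) t i : cons_rV (x, t) ord0 (lift ord0 i) = x ord0 i.
Proof. by rewrite mxE liftK. Qed.

Lemma lebSE n (A : set 'rV[R]_n.+1) :
  leb n.+1 A = (leb n \x (@lebesgue_measure R)) (@cons_rV R n @^-1` A).
Proof. by []. Qed.

Definition rbox n (I : 'I_n -> set R) : set 'rV[R]_n :=
  [set x | forall i, I i (x ord0 i)].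

Lemma measurable_rbox n (I : 'I_n -> set R) :
  (forall i, measurable (I i)) -> measurable (rbox I).
Proof.
move=> mI; rewrite (_ : rbox I = \bigcap_(i in [set: 'I_n]) ((fun x : 'rV[R]_n => x ord0 i) @^-1` I i)).
  apply: fin_bigcap_measurable => // i _.
  by rewrite -[X in measurable X]setTI; exact: (@measurable_coord R n i measurableT _ (mI i)).
by apply/seteqP; split=> x /= h i; [move=> _; exact: h|exact: h i Logic.I].
Qed.

Lemma leb_rbox n (I : 'I_n -> set R) : (forall i, measurable (I i)) ->
  leb n (rbox I) = \prod_(i < n) lebesgue_measure (I i).
Proof.
elim: n I => [|n IH] I mI.
  rewrite big_ord0 /= diracE mem_set//.
  by move=> i; case: i.
rewrite lebSE big_ord_recl.
pose J (i : 'I_n) := I (lift ord0 i).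
have mJ : measurable (rbox J) by apply: measurable_rbox => i; exact: mI.
have -> : @cons_rV R n @^-1` rbox I = rbox J `*` I ord0.
  apply/seteqP; split=> [[x t]|[x t] [/= h1 h2]] /=.
    move=> h; split => /=; last by have := h ord0; rewrite cons_rV0.
    by move=> i; have := h (lift ord0 i); rewrite cons_rVS.
  move=> i; case: (unliftP ord0 i) => [j ->|->]; first by rewrite cons_rVS; exact: h1.
  by rewrite cons_rV0.
rewrite product_measure1E//; last exact: mI.
rewrite IH; last by move=> i; exact: mI.
exact: muleC.
Qed.

Definition cube n (k : R) : set 'rV[R]_n := rbox (fun=> `[(- k)%R, k]%classic).

Lemma measurable_cube n k : measurable (@cube n k).
Proof. exact: measurable_rbox. Qed.

Lemma leb_cube_fin n k : leb n (@cube n k) \is a fin_num.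
Proof.
rewrite leb_rbox//; elim/big_ind: _ => [//|x y hx hy|i _]; first exact: fin_numM.
by rewrite lebesgue_measure_itv/=; case: ifP.
Qed.

Lemma leb_cube_lty n k : leb n (@cube n k) < +oo.
Proof. by rewrite ltey_eq leb_cube_fin. Qed.

Lemma cubeP n k (x : 'rV[R]_n) : cube k x <-> forall i, (`|x ord0 i| <= k)%R.
Proof.
split=> h i; have := h i; rewrite /= in_itv /= ler_norml//.
Qed.

Lemma coord_le_norm n (x : 'rV[R]_n) i : (`|x ord0 i| <= `|x|)%R.
Proof.
by rewrite [leRHS]mx_normrE; apply: (le_trans _ (le_bigmax _ _ (ord0, i))).
Qed.

Lemma leb_sigma_finite n : sigma_finite [set: 'rV[R]_n] (leb n).
Proof.
exists (fun k => cube k%:R); last by move=> k; split; [exact: measurable_cube|exact: leb_cube_lty].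
apply/seteqP; split => // x _; exists (Num.trunc `|x|).+1 => //.
apply/cubeP => i; apply: (le_trans (coord_le_norm x i)); apply: ltW; exact: truncnS_gt.
Qed.

(* A copy of [leb n] declared as a plain function, so that it can carry a
   sigma-finite structure; [leb n] itself already has the structure of a measure. *)
Definition lebs n : set 'rV[R]_n -> \bar R := leb n.
Arguments lebs : clear implicits.

HB.instance Definition _ n := isMeasure.Build _ _ _ (lebs n)
  (measure0 (leb n)) (measure_ge0 (leb n)) (@measure_semi_sigma_additive _ _ _ (leb n)).

HB.instance Definition _ n := Measure_isSigmaFinite.Build _ _ _ (lebs n) (@leb_sigma_finite n).

Local Notation mu := (@lebesgue_measure R).

Lemma integral_lebS n (f : 'rV[R]_n.+1 -> \bar R) :
  measurable_fun [set: 'rV[R]_n.+1] f -> (forall x, 0 <= f x) ->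
  \int[leb n.+1]_x f x = \int[(leb n \x mu)]_z f (cons_rV z).
Proof.
move=> mf f0; rewrite -[LHS]/(\int[pushforward (leb n \x mu) (@cons_rV R n)]_x f x).
by rewrite ge0_integral_pushforward//; exact: measurable_cons_rV.
Qed.

Lemma tonelli_lebS n (f : 'rV[R]_n.+1 -> \bar R) :
  measurable_fun [set: 'rV[R]_n.+1] f -> (forall x, 0 <= f x) ->
  \int[leb n.+1]_x f x = \int[leb n]_x \int[mu]_t f (cons_rV (x, t)).
Proof.
move=> mf f0; rewrite integral_lebS//.
apply: (@fubini_tonelli1 _ _ _ _ _ (lebs n) mu (f \o (@cons_rV R n))).
  by apply: measurableT_comp => //; exact: measurable_cons_rV.
by move=> z; exact: f0.
Qed.

Lemma integrable_lebS n (f : 'rV[R]_n.+1 -> \bar R) :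
  (leb n.+1).-integrable [set: 'rV[R]_n.+1] f -> (lebs n \x mu).-integrable setT (f \o (@cons_rV R n)).
Proof.
move=> /integrableP[mf fi]; apply/integrableP; split.
  by apply: measurableT_comp => //; exact: measurable_cons_rV.
by move: fi; rewrite integral_lebS//; exact: measurableT_comp.
Qed.

Lemma integral_lebS_integrable n (f : 'rV[R]_n.+1 -> \bar R) :
  (leb n.+1).-integrable [set: 'rV[R]_n.+1] f ->
  \int[leb n.+1]_x f x = \int[(leb n \x mu)]_z f (cons_rV z).
Proof.
move=> fi; have mf := measurable_int _ fi.
rewrite [LHS]integralE [RHS]integralE; congr (_ - _).
  by rewrite integral_lebS; [apply: eq_integral => z _; rewrite !unlock|exact: measurable_funepos|move=> x; exact: funepos_ge0].
by rewrite integral_lebS; [apply: eq_integral => z _; rewrite !unlock|exact: measurable_funeneg|move=> x; exact: funeneg_ge0].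
Qed.

Lemma fubini_lebS1 n (f : 'rV[R]_n.+1 -> \bar R) :
  (leb n.+1).-integrable [set: 'rV[R]_n.+1] f ->
  \int[leb n.+1]_x f x = \int[leb n]_x \int[mu]_t f (cons_rV (x, t)).
Proof.
move=> fi; rewrite integral_lebS_integrable//.
by apply/esym; apply: (@integral12_prod_meas1 _ _ _ _ _ (lebs n) mu (f \o (@cons_rV R n))); exact: integrable_lebS.
Qed.

Lemma fubini_lebS2 n (f : 'rV[R]_n.+1 -> \bar R) :
  (leb n.+1).-integrable [set: 'rV[R]_n.+1] f ->
  \int[leb n.+1]_x f x = \int[mu]_t \int[leb n]_x f (cons_rV (x, t)).
Proof.
move=> fi; rewrite integral_lebS_integrable//.
by apply/esym; apply: (@integral21_prod_meas1 _ _ _ _ _ (lebs n) mu (f \o (@cons_rV R n))); exact: integrable_lebS.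
Qed.

Lemma tonelli_leb n m (f : 'rV[R]_n -> 'rV[R]_m -> \bar R) :
  measurable_fun [set: 'rV[R]_n * 'rV[R]_m] (fun z : 'rV[R]_n * 'rV[R]_m => f z.1 z.2) -> (forall x y, 0 <= f x y) ->
  \int[leb n]_x \int[leb m]_y f x y = \int[leb m]_y \int[leb n]_x f x y.
Proof.
move=> mf f0; apply: (@fubini_tonelli _ _ _ _ _ (lebs n) (lebs m) (fun z => f z.1 z.2)) => //.
Qed.

Lemma measurable_tonelli_leb n m (f : 'rV[R]_n -> 'rV[R]_m -> \bar R) :
  measurable_fun [set: 'rV[R]_n * 'rV[R]_m] (fun z : 'rV[R]_n * 'rV[R]_m => f z.1 z.2) -> (forall x y, 0 <= f x y) ->
  measurable_fun [set: 'rV[R]_n] (fun x => \int[leb m]_y f x y).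
Proof.
move=> mf f0; apply: (@measurable_fun_fubini_tonelli_F _ _ _ _ _ (lebs m) (fun z => f z.1 z.2)) => //.
Qed.

(** Uniqueness of Lebesgue measure: the right-hand side is a measure with the correct value on
    half-open intervals. *)
Lemma lebesgue_scale (k : R) (A : set R) : (0 < k)%R -> measurable A ->
  mu A = k%:E * pushforward mu (fun x : measurableTypeR R => (k * x)%R : measurableTypeR R) A.
Proof.
move=> k0 mA.
have mk : measurable_fun [set: measurableTypeR R] (fun x : measurableTypeR R => (k * x)%R : measurableTypeR R).
  exact: measurable_funM.
pose f : {mfun measurableTypeR R >-> measurableTypeR R} := HB.pack (fun x : measurableTypeR R => (k * x)%R : measurableTypeR R) (isMeasurableFun.Build _ _ _ _ _ mk).
pose m0 : {measure set (measurableTypeR R) -> \bar R} := mscale (NngNum (ltW k0)) (pushforward mu f).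
pose m := m0 mk.
suff -> : mu A = m A by [].
apply: (@lebesgue_measure_unique R m) => // _ [[a b]] _ <-.
have E : (fun x : R => k * x)%R @^-1` `]a, b]%classic = `](a / k)%R, (b / k)%R]%classic.
  by apply/seteqP; split=> x /=; rewrite !in_itv /= ltr_pdivrMr// ler_pdivlMr// mulrC.
rewrite -[RHS]/(k%:E * mu ((fun x : R => k * x)%R @^-1` `]a, b]%classic)) E.
rewrite !lebesgue_measure_itv /= !lte_fin ltr_pM2r ?invr_gt0//.
case: ifP => _; last by rewrite mule0.
by rewrite -!EFinB -EFinM; congr (_%:E); field; rewrite gt_eqF.
Qed.

Lemma integral_lebesgue_scale (k : R) (f : R -> \bar R) : (0 < k)%R ->
  measurable_fun setT f -> (forall x, 0 <= f x) ->
  \int[mu]_t f t = k%:E * \int[mu]_t f (k * t)%R.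
Proof.
move=> k0 mf f0.
have mk : measurable_fun [set: measurableTypeR R] (fun x : measurableTypeR R => (k * x)%R : measurableTypeR R).
  exact: measurable_funM.
pose g : {mfun measurableTypeR R >-> measurableTypeR R} := HB.pack (fun x : measurableTypeR R => (k * x)%R : measurableTypeR R) (isMeasurableFun.Build _ _ _ _ _ mk).
pose m0 : {measure set (measurableTypeR R) -> \bar R} := mscale (NngNum (ltW k0)) (pushforward mu g).
rewrite (eq_measure_integral (m0 mk)); last first.
  by move=> A mA _; exact: (lebesgue_scale k0 mA).
by rewrite ge0_integral_mscale//= ge0_integral_pushforward.
Qed.

Lemma measurable_scale_rV n (k : R) : measurable_fun [set: 'rV[R]_n] (fun x : 'rV[R]_n => (k *: x)%R).
Proof.
apply/measurable_fun_rVP => i.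
rewrite (_ : (fun t => _) = (fun x : 'rV[R]_n => k * x ord0 i)%R); last first.
  by apply/funext => x; rewrite mxE.
by apply: measurable_funM => //; exact: measurable_coord.
Qed.

Lemma scale_cons_rV n (k : R) (x : 'rV[R]_n) t :
  (k *: cons_rV (x, t))%R = cons_rV (k *: x, k * t)%R.
Proof.
apply/rowP => i; rewrite mxE; case: (unliftP ord0 i) => [j ->|->].
  by rewrite !cons_rVS mxE.
by rewrite !cons_rV0.
Qed.

(** Induction along the iterated product: each coordinate contributes one factor [k], so no Jacobian
    is involved. *)
Lemma integral_leb_scale n (k : R) (f : 'rV[R]_n -> \bar R) : (0 < k)%R ->
  measurable_fun [set: 'rV[R]_n] f -> (forall x, 0 <= f x) ->
  \int[leb n]_x f x = (k ^+ n)%:E * \int[leb n]_x f (k *: x)%R.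
Proof.
move=> k0; elim: n f => [|n IH] f mf f0.
  rewrite expr0 mul1e; apply: eq_integral => x _; congr f.
  by rewrite [LHS]thinmx0 [RHS]thinmx0.
have mfk : measurable_fun [set: 'rV[R]_n.+1] (fun x => f (k *: x)%R).
  by apply: (measurableT_comp mf); exact: measurable_scale_rV.
rewrite tonelli_lebS// tonelli_lebS//.
have mc (x : 'rV[R]_n) : measurable_fun [set: measurableTypeR R] (fun t : measurableTypeR R => f (cons_rV (x, t))).
  apply: (measurableT_comp mf); apply: (measurableT_comp (@measurable_cons_rV R n)).
  exact: measurable_fun_pair.
under eq_integral => x _ do rewrite (integral_lebesgue_scale k0 (mc x))//.
have mkc : measurable_fun [set: 'rV[R]_n * measurableTypeR R] (fun z : 'rV[R]_n * measurableTypeR R => f (cons_rV (z.1, k * z.2)%R)).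
  apply: (measurableT_comp mf); apply: (measurableT_comp (@measurable_cons_rV R n)).
  by apply: measurable_fun_pair => //; exact: measurable_funM.
have mI : measurable_fun [set: 'rV[R]_n] (fun x : 'rV[R]_n => \int[mu]_t f (cons_rV (x, (k * t)%R))).
  exact: (@measurable_fun_fubini_tonelli_F _ _ _ _ _ mu (fun z : 'rV[R]_n * measurableTypeR R => f (cons_rV (z.1, k * z.2)%R))).
rewrite (ge0_integralZl _ measurableT mI); last 2 first.
  by move=> x _; exact: integral_ge0.
  by rewrite lee_fin ltW.
rewrite (IH (fun x => \int[mu]_t f (cons_rV (x, (k * t)%R))))//; last first.
  by move=> x; exact: integral_ge0.
rewrite muleA exprS EFinM; congr (_ * _).
apply: eq_integral => x _; apply: eq_integral => t _.
by rewrite scale_cons_rV.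
Qed.

End leb_theory.
Arguments lebs {R} n.
(** * Calculus and test functions *)

Section slices.
Context {R : realType}.

(** A directional derivative depends on increments only, so it can be transferred between functions
    on different spaces. Lines, slices and rays all get their derivatives this way. *)
Lemma is_derive_incr (V V' W : normedModType R) (f : V -> W) (g : V' -> W) a v b w df :
  (forall h : R, g (h *: w + b) - g b = f (h *: v + a) - f a) ->
  is_derive a v f df -> is_derive b w g df.
Proof.
move=> E [df1 df2].
have Q : (fun h : R => h^-1 *: ((g \o shift b) (h *: w) - g b)) =
         (fun h : R => h^-1 *: ((f \o shift a) (h *: v) - f a)).
  by apply/funext => h /=; rewrite E.
by split; rewrite /derivable /derive Q.
Qed.

Lemma is_derive_line (V W : normedModType R) (f : V -> W) a v (t : R) df :
  is_derive (a + t *: v) v f df -> is_derive t 1 (fun s : R => f (a + s *: v)) df.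
Proof.
apply: is_derive_incr => h.
by rewrite scalerDl addrCA [h *: 1]mulr1.
Qed.

Lemma affine_rVE n (h : R) (u v : 'rV[R]_n) i : (h *: u + v) ord0 i = h * u ord0 i + v ord0 i.
Proof. by rewrite !mxE. Qed.

Lemma continuous_rV (T : topologicalType) n (f : T -> 'rV[R]_n) :
  (forall i, continuous (fun t => f t ord0 i)) -> continuous f.
Proof.
move=> cf t; apply/cvgrPdist_lt => e e0.
have : nbhs t (fun s => forall i, [set s | `|f t ord0 i - f s ord0 i| < e] s).
  apply: (@filter_forall _ _ (fun i => [set s | `|f t ord0 i - f s ord0 i| < e]) (nbhs t)) => i.
  by have /cvgrPdist_lt := cf i t; apply.
apply: filterS => s hs.
suff: ball (f t) e (f s) by rewrite mx_norm_ball.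
by split => // i j; rewrite (ord1 i); exact: hs.
Qed.

Lemma continuous_cons_rVl n t : continuous (fun x : 'rV[R]_n => cons_rV (x, t)).
Proof.
apply: continuous_rV => i; case: (unliftP ord0 i) => [j ->|->].
  rewrite (_ : (fun _ => _) = (fun x : 'rV[R]_n => x ord0 j)); last by apply/funext => x; rewrite cons_rVS.
  exact: coord_continuous.
rewrite (_ : (fun _ => _) = (fun x : 'rV[R]_n => t)); last by apply/funext => x; rewrite cons_rV0.
exact: cst_continuous.
Qed.

Lemma continuous_cons_rVr n (x : 'rV[R]_n) : continuous (fun t : R => cons_rV (x, t)).
Proof.
apply: continuous_rV => i; case: (unliftP ord0 i) => [j ->|->].
  rewrite (_ : (fun _ => _) = (fun t : R => x ord0 j)); last by apply/funext => t; rewrite cons_rVS.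
  exact: cst_continuous.
rewrite (_ : (fun _ => _) = (fun t : R => t)); last by apply/funext => t; rewrite cons_rV0.
by move=> t; exact: cvg_id.
Qed.

Lemma is_derive_cons_rVl n (f : 'rV[R]_n.+1 -> R) (x : 'rV[R]_n) t j df :
  is_derive (cons_rV (x, t)) (delta_mx ord0 (lift ord0 j)) f df ->
  is_derive x (delta_mx ord0 j) (fun x => f (cons_rV (x, t))) df.
Proof.
apply: is_derive_incr => h; congr (f _ - _).
apply/rowP => i; rewrite [RHS]affine_rVE.
case: (unliftP ord0 i) => [k ->|->]; rewrite ?cons_rVS ?cons_rV0 ?affine_rVE mxE /=.
  by rewrite mxE (inj_eq lift_inj).
by rewrite mulr0 add0r.
Qed.

Lemma is_derive_cons_rVr n (f : 'rV[R]_n.+1 -> R) (x : 'rV[R]_n) t df :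
  is_derive (cons_rV (x, t)) (delta_mx ord0 ord0) f df ->
  is_derive t 1 (fun t : R => f (cons_rV (x, t))) df.
Proof.
apply: is_derive_incr => h; congr (f _ - _).
apply/rowP => i; rewrite [RHS]affine_rVE.
case: (unliftP ord0 i) => [k ->|->]; rewrite ?cons_rVS ?cons_rV0 mxE /=.
  by rewrite mulr0 add0r.
by rewrite [h *: 1]mulr1 mulr1.
Qed.

End slices.

(** * Integrals of partial derivatives of functions with bounded support *)

Section box_support.
Context {R : realType}.

(** Bounded support with no condition at the origin: unlike [test_fun], it passes to slices, as the
    induction in [integral_partiald0] requires. *)
Definition bsupp n (f : 'rV[R]_n -> R) := exists M : R, forall x, ~ cube M x -> f x = 0.

Lemma compact_cube n (M : R) : compact (@cube R n M).
Proof. by apply: (@rV_compact _ _ (fun=> `[(- M), M]%classic)) => i; exact: segment_compact. Qed.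

Lemma compact_sub_cube n (K : set 'rV[R]_n) : compact K -> exists M : R, 0 < M /\ K `<=` cube M.
Proof.
move=> /compact_bounded [M [_ hM]].
exists (Num.max M 0 + 1); split; first by rewrite ltr_wpDl// le_max lexx orbT.
move=> x Kx; apply/cubeP => i; apply: (le_trans (coord_le_norm _ _)).
by apply: hM => //; rewrite ltr_pwDr// le_max lexx.
Qed.

Lemma continuous_bsupp_bounded n (g : 'rV[R]_n -> R) : continuous g -> bsupp g ->
  exists B, forall x, `|g x| <= B.
Proof.
move=> cg [M gM].
have cN : {within cube M, continuous (fun x => `|g x|)}.
  apply: continuous_subspaceT => x; apply: continuous_comp; first exact: cg.
  exact: norm_continuous.
have [hE|/set0P ne] := eqVneq (@cube R n M) set0.
  by exists 0 => x; rewrite gM ?normr0// hE.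
have [c cM hc] := EVT_max_rV ne (@compact_cube n M) cN.
exists `|g c| => x; have [hx|hx] := pselect (cube M x); first by apply: hc; rewrite inE.
by rewrite gM// normr0.
Qed.

Lemma integrable_bounded_bsupp n (g : 'rV[R]_n -> R) (B : R) :
  measurable_fun setT g -> (forall x, `|g x| <= B) -> bsupp g ->
  (leb n).-integrable setT (EFin \o g).
Proof.
move=> mg hB [M gM].
have ig : (leb n).-integrable (cube M) (EFin \o g).
  apply: measurable_bounded_integrable; [exact: measurable_cube|exact: leb_cube_lty| |].
    exact: measurable_funTS.
  exists B; split; first exact: num_real.
  by move=> y By x _ /=; rewrite (le_trans (hB x))// ltW.
move/(integrable_mkcond _ (@measurable_cube R n M)): ig.
apply: eq_integrable => // x _; rewrite patchE; case: ifPn => //.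
by rewrite notin_setE => hx /=; rewrite gM.
Qed.

Lemma integrable_continuous_bsupp n (g : 'rV[R]_n -> R) :
  continuous g -> bsupp g -> (leb n).-integrable setT (EFin \o g).
Proof.
move=> cg sg; have [B hB] := continuous_bsupp_bounded cg sg.
by apply: (integrable_bounded_bsupp _ hB) => //; exact: continuous_measurable_rV.
Qed.

Lemma bsupp_partiald n (f : 'rV[R]_n -> R) i : bsupp f -> bsupp (partiald i f).
Proof.
move=> [M fM]; exists M => x hx.
have oC : open (~` (@cube R n M)).
  by apply: closed_openC; apply: compact_closed; [exact: norm_hausdorff|exact: compact_cube].
rewrite /partiald.
have -> : 'D_(delta_mx ord0 i) f x = 'D_(delta_mx ord0 i) (cst (0 : R)) x.
  apply: near_eq_derive.
  have : nbhs x (~` (@cube R n M)) by apply: open_nbhs_nbhs.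
  by apply: filterS => y hy; rewrite fM.
exact: derive_cst.
Qed.

Local Open Scope ereal_scope.

Lemma integral_derive0 (F f : R -> R) (M : R) :
  (forall t : R, is_derive t (1 : R)%R F (f t)) -> continuous f ->
  (forall t, (M < `|t|)%R -> F t = 0%R) -> \int[@lebesgue_measure R]_t (f t)%:E = 0.
Proof.
move=> dF cf FM.
(* Strictly beyond [M], so that [F] vanishes at both ends of [[-L, L]], and positive, so that this
   interval is not degenerate. *)
pose L := (Num.max M 0 + 1)%R.
have ML : (M < L)%R by rewrite ltr_pwDr// le_max lexx.
have L0 : (0 < L)%R by rewrite ltr_wpDl// le_max lexx orbT.
have fM t : (M < `|t|)%R -> f t = 0%R.
  move=> Mt; have [_ <-] := dF t.
  have -> : 'D_1 F t = 'D_1 (cst (0:R)%R) t.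
    apply: near_eq_derive.
    near=> s; apply: FM; near: s.
    by apply: (cvgr_gt _ (@norm_continuous _ _ t)).
  exact: derive_cst.
have -> : \int[@lebesgue_measure R]_t (f t)%:E = \int[@lebesgue_measure R]_(t in `[(- L)%R, L]) (f t)%:E.
  rewrite [RHS]integral_mkcond; apply: eq_integral => t _; rewrite patchE.
  case: ifPn => //; rewrite notin_setE /= in_itv /= -ler_norml => /negP; rewrite -ltNge => hL.
  by rewrite fM// (lt_trans ML).
rewrite (@continuous_FTC2 R f F)//.
- by rewrite FM ?gtr0_norm// FM ?normrN ?gtr0_norm// sube0.
- by rewrite gtrN.
- exact: continuous_subspaceT.
- have cF x : {for x, continuous F}.
    by apply: differentiable_continuous; apply/derivable1_diffP; have [] := dF x.
  split.
  + by move=> x _; have [] := dF x.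
  + by apply: cvg_at_right_filter; exact: cF.
  + by apply: cvg_at_left_filter; exact: cF.
- by move=> x _; rewrite derive1E; have [] := dF x.
Unshelve. all: by end_near. Qed.

(** Fubini in the first coordinate: if [i] is that coordinate, each line integrates to zero;
    otherwise the induction hypothesis applies to each slice. This is the source of integration by
    parts in [is_wgrad_test]. *)
Lemma integral_partiald0 n (f : 'rV[R]_n -> R) i :
  (forall x, derivable f x (delta_mx ord0 i)) -> continuous (partiald i f) -> bsupp f ->
  \int[leb n]_x (partiald i f x)%:E = 0.
Proof.
elim: n f i => [f [] //|n IH] f i df cdf sf.
have idf : (leb n.+1).-integrable setT (EFin \o partiald i f).
  by apply: integrable_continuous_bsupp => //; exact: bsupp_partiald.
have [M fM] := sf.
case: (unliftP ord0 i) => [j|] E; subst i.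
  rewrite fubini_lebS2//; apply: integral0_eq => t _.
  have D x : is_derive x (delta_mx ord0 j) (fun x => f (cons_rV (x, t))) (partiald (lift ord0 j) f (cons_rV (x, t))).
    by apply: is_derive_cons_rVl; exact: derivableP.
  have E : partiald j (fun x => f (cons_rV (x, t))) = (fun x => partiald (lift ord0 j) f (cons_rV (x, t))).
    by apply/funext => x; rewrite {1}/partiald; have [_ ->] := D x.
  transitivity (\int[leb n]_x (partiald (j : 'I_n) (fun x => f (cons_rV (x, t))) x)%:E).
    by apply: eq_integral => x _; rewrite E.
  apply: IH.
  - by move=> x; have [] := D x.
  - rewrite E => x; apply: (@continuous_comp _ _ _ (fun x => cons_rV (x, t)) (partiald (lift ord0 j) f)).
      exact: continuous_cons_rVl.
    exact: cdf.
  - exists M => x hx; apply: fM => /cubeP h; apply: hx; apply/cubeP => k.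
    by have := h (lift ord0 k); rewrite cons_rVS.
rewrite fubini_lebS1//; apply: integral0_eq => x _.
apply: (@integral_derive0 (fun t => f (cons_rV (x, t))) _ M).
- by move=> t; apply: is_derive_cons_rVr; exact: derivableP.
- move=> t; apply: (@continuous_comp _ _ _ (fun t => cons_rV (x, t)) (partiald ord0 f)).
    exact: continuous_cons_rVr.
  exact: cdf.
- move=> t hM; apply: fM => /cubeP /(_ ord0); rewrite cons_rV0 => h.
  by move: hM; rewrite ltNge h.
Qed.

End box_support.

Section derive_extra.
Context {R : realType}.

(** Reduces directional derivatives to one real variable, where the chain rule can be applied. *)
Lemma is_derive_lineP (V W : normedModType R) (f : V -> W) x v df :
  is_derive x v f df <-> is_derive (0 : R) 1 (fun s : R => f (x + s *: v)) df.
Proof.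
split=> h; first by apply: is_derive_line; rewrite scale0r addr0.
move: h; apply: is_derive_incr => h /=.
by rewrite scale0r !addr0 [h *: v + x]addrC [h *: 1]mulr1.
Qed.

Lemma is_derive_comp1 (V : normedModType R) (F : R -> R) (r : V -> R) x v dF dr :
  is_derive (r x) 1 F dF -> is_derive x v r dr ->
  is_derive x v (fun y => F (r y)) (dF * dr).
Proof.
move=> hF /is_derive_lineP hr; apply/is_derive_lineP.
by apply: (@is_derive1_comp R F (fun s : R => r (x + s *: v))); rewrite /= ?scale0r ?addr0.
Qed.

Lemma is_deriveMf (V : normedModType R) (f g : V -> R) x v df dg :
  is_derive x v f df -> is_derive x v g dg ->
  is_derive x v (fun y => f y * g y) (df * g x + f x * dg).
Proof.
move=> hf hg; apply: (is_derive_eq (is_deriveM hf hg)).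
by rewrite addrC [g x *: df]mulrC.

Qed.

Lemma is_deriveDf (V : normedModType R) (f g : V -> R) x v df dg :
  is_derive x v f df -> is_derive x v g dg ->
  is_derive x v (fun y => f y + g y) (df + dg).
Proof. by move=> hf hg; exact: is_deriveD. Qed.

End derive_extra.

Section class_C.
Context {R : realType} {n : nat}.
Implicit Types f g : 'rV[R]_n -> R.

Lemma class_C_continuous k f : class_C k f -> continuous f.
Proof. by case: k => [//|k] []. Qed.

Lemma class_CS k f : class_C k.+1 f -> class_C k f.
Proof.
elim: k f => [|k IH] f; first by case.
move=> [cf df]; split=> // i; have [d1 d2] := df i; split=> //; exact: IH.
Qed.

Lemma class_C_cst k (c : R) : class_C k (fun _ : 'rV[R]_n => c).
Proof.
elim: k c => [|k IH] c; first exact: cst_continuous.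
split; first exact: cst_continuous.
move=> i; split=> [x|]; first exact: derivable_cst.
rewrite (_ : partiald i _ = fun=> 0); first exact: IH.
by apply/funext => x; exact: derive_cst.
Qed.

Lemma class_C_is_derive k f i x : class_C k.+1 f ->
  is_derive x (delta_mx ord0 i) f (partiald i f x).
Proof. by move=> [_ /(_ i)[df _]]; exact: derivableP. Qed.

Lemma class_CSI k f (df : 'I_n -> 'rV[R]_n -> R) : continuous f ->
  (forall i x, is_derive x (delta_mx ord0 i) f (df i x)) ->
  (forall i, class_C k (df i)) -> class_C k.+1 f.
Proof.
move=> cf hd hC; split=> // i; split=> [x|]; first by have [] := hd i x.
rewrite (_ : partiald i f = df i)//; apply/funext => x; by have [_ <-] := hd i x.
Qed.

Lemma class_CD k f g : class_C k f -> class_C k g -> class_C k (fun x => f x + g x).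
Proof.
elim: k f g => [|k IH] f g.
  by move=> cf cg x; apply: continuousD; [exact: cf|exact: cg].
move=> hf hg; apply: (@class_CSI _ _ (fun i x => partiald i f x + partiald i g x)).
- by move=> x; apply: continuousD; [exact: (class_C_continuous hf)|exact: (class_C_continuous hg)].
- by move=> i x; apply: is_deriveDf; [exact: class_C_is_derive hf|exact: class_C_is_derive hg].
- by move=> i; apply: IH; [have [_ /(_ i)[]] := hf|have [_ /(_ i)[]] := hg].
Qed.

Lemma class_CM k f g : class_C k f -> class_C k g -> class_C k (fun x => f x * g x).
Proof.
elim: k f g => [|k IH] f g.
  by move=> cf cg x; apply: continuousM; [exact: cf|exact: cg].
move=> hf hg; apply: (@class_CSI _ _ (fun i x => partiald i f x * g x + f x * partiald i g x)).
- by move=> x; apply: continuousM; [exact: (class_C_continuous hf)|exact: (class_C_continuous hg)].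
- by move=> i x; apply: is_deriveMf; [exact: class_C_is_derive hf|exact: class_C_is_derive hg].
- move=> i; apply: class_CD; apply: IH; [|exact: class_CS|exact: class_CS|].
    by have [_ /(_ i)[]] := hf.
  by have [_ /(_ i)[]] := hg.
Qed.

Lemma class_CZ k (c : R) f : class_C k f -> class_C k (fun x => c * f x).
Proof. by move=> hf; apply: class_CM => //; exact: class_C_cst. Qed.

Lemma class_C_sum k (I : Type) (s : seq I) (F : I -> 'rV[R]_n -> R) :
  (forall i, class_C k (F i)) -> class_C k (fun x => \sum_(i <- s) F i x).
Proof.
move=> hF; elim: s => [|i s IH].
  rewrite (_ : (fun _ => _) = fun=> 0); first exact: class_C_cst.
  by apply/funext => x; rewrite big_nil.
rewrite (_ : (fun _ => _) = fun x => F i x + \sum_(j <- s) F j x); first exact: class_CD.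
by apply/funext => x; rewrite big_cons.
Qed.

Lemma class_C_prod k (I : Type) (s : seq I) (F : I -> 'rV[R]_n -> R) :
  (forall i, class_C k (F i)) -> class_C k (fun x => \prod_(i <- s) F i x).
Proof.
move=> hF; elim: s => [|i s IH].
  rewrite (_ : (fun _ => _) = fun=> 1); first exact: class_C_cst.
  by apply/funext => x; rewrite big_nil.
rewrite (_ : (fun _ => _) = fun x => F i x * \prod_(j <- s) F j x); first exact: class_CM.
by apply/funext => x; rewrite big_cons.
Qed.

Lemma is_derive_coord i j (x : 'rV[R]_n) :
  is_derive x (delta_mx ord0 i) (fun y : 'rV[R]_n => y ord0 j) (j == i)%:R.
Proof.
apply/is_derive_lineP.
rewrite (_ : (fun s => _) = (fun s : R => x ord0 j + s * (j == i)%:R)); last first.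
  by apply/funext => s; rewrite !mxE eqxx.
apply: (is_derive_eq (is_deriveDf (is_derive_cst (x ord0 j) (0 : R) 1)
  (is_deriveMf (is_derive_id (0 : R) 1) (is_derive_cst ((j == i)%:R : R) (0 : R) 1)))).
by rewrite mul1r mulr0 addr0 add0r.
Qed.

Lemma class_C_coord k j : class_C k (fun x : 'rV[R]_n => x ord0 j).
Proof.
case: k => [|k]; first exact: coord_continuous.
apply: (@class_CSI _ _ (fun i _ => (j == i)%:R)).
- exact: coord_continuous.
- by move=> i x; exact: is_derive_coord.
- by move=> i; exact: class_C_cst.
Qed.

Lemma class_C_scale k (c : R) f : class_C k f -> class_C k (fun x => f (c *: x)).
Proof.
have cc : continuous (fun x : 'rV[R]_n => c *: x) by exact: scaler_continuous.
elim: k f => [|k IH] f hf.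
  by move=> x; apply: continuous_comp; [exact: cc|exact: hf].
apply: (@class_CSI _ _ (fun i x => c * partiald i f (c *: x))).
- by move=> x; apply: continuous_comp; [exact: cc|exact: (class_C_continuous hf)].
- move=> i x; apply/is_derive_lineP.
  have /is_derive_lineP h := class_C_is_derive i (c *: x) hf.
  rewrite (_ : (fun s => _) = (fun s : R => f (c *: x + s *: delta_mx ord0 i)) \o (fun s => c * s)).
    rewrite mulrC; apply: is_derive1_comp; first by rewrite mulr0.
    apply: (is_derive_eq (is_deriveMf (is_derive_cst (c : R) (0 : R) 1) (is_derive_id (0 : R) 1))).
    by rewrite mul0r add0r mulr1.
  by apply/funext => s /=; rewrite scalerDr scalerA.
- by move=> i; apply: class_CZ; apply: IH; have [_ /(_ i)[]] := hf.
Qed.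

Lemma partiald_scale (c : R) f i x : class_C 1 f ->
  partiald i (fun x => f (c *: x)) x = c * partiald i f (c *: x).
Proof.
move=> hf; rewrite {1}/partiald.
have /is_derive_lineP h := class_C_is_derive i (c *: x) hf.
suff : is_derive x (delta_mx ord0 i) (fun x => f (c *: x)) (c * partiald i f (c *: x)) by move=> [].
apply/is_derive_lineP.
rewrite (_ : (fun s => _) = (fun s : R => f (c *: x + s *: delta_mx ord0 i)) \o (fun s => c * s)).
  rewrite mulrC; apply: is_derive1_comp; first by rewrite mulr0.
  apply: (is_derive_eq (is_deriveMf (is_derive_cst (c : R) (0 : R) 1) (is_derive_id (0 : R) 1))).
  by rewrite mul0r add0r mulr1.
by apply/funext => s /=; rewrite scalerDr scalerA.
Qed.

End class_C.

(** * Smooth functions that vanish to infinite order, and bumps *)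

Section flat.
Context {R : realType}.

(* The derivative of [flat m] is [- m * flat m.+1 + flat m.+2], so that the span
   of these functions is closed under differentiation. *)
Definition flat (m : nat) (t : R) : R :=
  if t <= 0 then 0 else t^-1 ^+ m * expR (- t^-1).

Lemma flat_ge0 m t : 0 <= flat m t.
Proof.
rewrite /flat; case: (leP t 0) => // t0.
by rewrite mulr_ge0 ?expR_ge0// exprn_ge0// invr_ge0 ltW.
Qed.

Lemma flat_gt0 m t : 0 < t -> 0 < flat m t.
Proof.
by move=> t0; rewrite /flat leNgt t0 /= mulr_gt0 ?expR_gt0// exprn_gt0// invr_gt0.
Qed.

(** Comes from [exp u >= u^(m+1) / (m+1)!] at [u = 1/t]. It yields the derivative of [flat] at the
    origin. *)
Lemma flat_le m t : 0 <= t -> flat m t <= (m.+1)`!%:R * t.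
Proof.
move=> t0; rewrite /flat; case: (leP t 0) => [t0'|{}t0]; first by rewrite mulr_ge0.
have u0 : 0 < t^-1 by rewrite invr_gt0.
have h : t^-1 ^+ m.+1 / (m.+1)`!%:R <= expR t^-1.
  by apply: le_trans (expR_ge1Dxn m (ltW u0)); rewrite lerDr.
rewrite expRN ler_pdivrMr ?expR_gt0//.
move: h; rewrite ler_pdivrMr ?ltr0n ?fact_gt0// => h.
rewrite mulrAC -ler_pdivrMr// -exprSr mulrC.
by [].
Qed.

Lemma is_derive_flat m (t : R) : is_derive t (1 : R) (flat m) (- m%:R * flat m.+1 t + flat m.+2 t).
Proof.
have [t0|t0|->] := ltgtP t 0.
- have E : - m%:R * flat m.+1 t + flat m.+2 t = 0.
    by rewrite /flat ltW// mulr0 addr0.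
  rewrite E; have := is_derive_cst (0 : R) t (1 : R); apply: near_eq_is_derive.
  near=> s; rewrite /flat /cst ifT//; near: s.
  by apply: (cvgr_le _ (@cvg_id _ (nbhs t))).
- apply: (@near_eq_is_derive _ _ _ (fun s : R => s^-1 ^+ m * expR (- s^-1))).
    near=> s; rewrite /flat ifF//; apply/negbTE; rewrite -ltNge; near: s.
    by apply: (cvgr_gt _ (@cvg_id _ (nbhs t))).
  have hi : is_derive t 1 (fun s : R => s^-1) (- t^-1 ^+ 2).
    have := @is_deriveV R id t 1 1 (lt0r_neq0 t0) (is_derive_id _ _).
    by rewrite [_ *: _]mulr1 exprVn.
  have he : is_derive t 1 (fun s : R => expR (- s^-1)) (expR (- t^-1) * t^-1 ^+ 2).
    apply: (@is_derive_comp1 R _ expR (fun s : R => - s^-1)).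
    by rewrite -[t^-1 ^+ 2]opprK; exact: is_deriveN.
  have hm : is_derive t 1 (fun s : R => s^-1 ^+ m) (m%:R * t^-1 ^+ m.-1 * - t^-1 ^+ 2).
    rewrite (_ : (fun s : R => _) = (fun s : R => s^-1) ^+ m); last by apply/funext => s; rewrite exprfctE.
    exact: (is_deriveX m hi).
  apply: (is_derive_eq (is_deriveMf hm he)).
  rewrite /flat leNgt t0 /=; case: m hm => [|m] hm; first by rewrite !expr0 !mul0r oppr0 !mul0r; ring.
  by rewrite /= !exprS expr0; ring.
- have E : - m%:R * flat m.+1 0 + flat m.+2 0 = 0.
    by rewrite /flat lexx mulr0 addr0.
  rewrite E.
  suff h : (fun h : R => h^-1 *: ((flat m \o shift 0) (h *: 1) - flat m 0)) @ 0^' --> (0 : R).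
    by split; [apply/cvg_ex; exists 0|exact/cvg_lim].
  (* At 0 the difference quotient of [flat m] is exactly [flat m.+1], which tends to 0 by
     [flat_le]. *)
  rewrite (_ : (fun h => _) = flat m.+1).
    apply/cvgr0Pnorm_le => e e0; near=> h.
    rewrite ger0_norm ?flat_ge0//.
    have [h0|h0] := leP h 0; first by rewrite /flat h0 ltW.
    apply: (le_trans (flat_le _ (ltW h0))).
    rewrite mulrC -ler_pdivlMr ?ltr0n ?fact_gt0//.
    apply: le_trans (ler_norm h) _; near: h.
    apply: dnbhs0_le; by rewrite divr_gt0// ltr0n fact_gt0.
  apply/funext => h /=; rewrite [_ *: 1]mulr1 addr0 {2}/flat lexx subr0 /flat.
  by case: ifP => _; rewrite ?scaler0// [_ *: _]mulrA -exprS.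
Unshelve. all: by end_near. Qed.

Lemma continuous_flat m : continuous (flat m).
Proof. by move=> t; apply: differentiable_continuous; apply/derivable1_diffP; have [] := is_derive_flat m t. Qed.

Lemma class_C_flat n k m (c d : R) (i : 'I_n) :
  class_C k (fun x : 'rV[R]_n => flat m (c * x ord0 i + d)).
Proof.
have hC l : class_C l (fun x : 'rV[R]_n => c * x ord0 i + d).
  by apply: class_CD; [apply: class_CZ; exact: class_C_coord|exact: class_C_cst].
have cf m' : continuous (fun x : 'rV[R]_n => flat m' (c * x ord0 i + d)).
  move=> x; apply: (@continuous_comp _ _ _ (fun x : 'rV[R]_n => c * x ord0 i + d) (flat m')).
    exact: (hC 0%N).
  exact: continuous_flat.
elim: k m => [|k IH] m; first exact: cf.
apply: (@class_CSI _ _ _ _ (fun j x => (- m%:R * flat m.+1 (c * x ord0 i + d) +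
   flat m.+2 (c * x ord0 i + d)) * partiald j (fun x : 'rV[R]_n => c * x ord0 i + d) x)).
- exact: cf.
- move=> j x; apply: is_derive_comp1; first exact: is_derive_flat.
  exact: (class_C_is_derive _ _ (hC 1%N)).
- move=> j; apply: class_CM; last by have [_ /(_ j)[]] := hC k.+1.
  by apply: class_CD => //; apply: class_CZ.
Qed.

End flat.

Section bump.
Context {R : realType} {n : nat}.
Implicit Types a b : 'rV[R]_n.

Definition cbox a b : set 'rV[R]_n := [set x | forall i, a ord0 i <= x ord0 i <= b ord0 i].

(** Inside the open box every factor is [exp (- 1 / ((k+1) d))] with [d] the distance to a face. As
    [k] grows these tend to 1, so the bumps approximate the indicator of the box from below. *)
Definition bump (k : nat) a b (x : 'rV[R]_n) : R :=
  \prod_i (flat 0 (k.+1%:R * x ord0 i + - (k.+1%:R * a ord0 i)) *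
           flat 0 (- k.+1%:R * x ord0 i + k.+1%:R * b ord0 i)).

Lemma smooth_bump k a b : smooth (bump k a b).
Proof.
move=> l; apply: class_C_prod => i; apply: class_CM; exact: class_C_flat.
Qed.

Lemma flat0E t : flat 0 t = if t <= 0 then 0 else expR (- t^-1) :> R.
Proof. by rewrite /flat expr0 mul1r. Qed.

Lemma bump_ge0 k a b x : 0 <= bump k a b x.
Proof. by apply: prodr_ge0 => i _; rewrite mulr_ge0// flat_ge0. Qed.

Lemma bump_le1 k a b x : bump k a b x <= 1.
Proof.
have h t : flat 0 t <= 1 :> R.
  rewrite flat0E; case: (leP t 0) => // t0.
  by rewrite -expR0 ler_expR oppr_le0 invr_ge0 ltW.
by apply: prodr_ile1 => i _; rewrite mulr_ge0 ?flat_ge0//= mulr_ile1 ?flat_ge0.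
Qed.

Lemma bump_out k a b x : ~ obox a b x -> bump k a b x = 0.
Proof.
move=> hx; have [i hi] : exists i, ~ (a ord0 i < x ord0 i < b ord0 i) by apply/existsNP.
rewrite /bump (bigD1 i)//= [X in X * _](_ : _ = 0) ?mul0r//.
move/negP: hi; rewrite negb_and -!leNgt => /orP[h|h]; rewrite !flat0E.
  by rewrite ifT ?mul0r// -mulrBr pmulr_rle0 ?ltr0n// subr_le0.
by rewrite [X in _ * X]ifT ?mulr0// mulNr addrC -mulrBr pmulr_rle0 ?ltr0n// subr_le0.
Qed.

Lemma bump_gt0 k a b x : obox a b x -> 0 < bump k a b x.
Proof.
move=> hx; apply: prodr_gt0 => i _; have /andP[h1 h2] := hx i.
rewrite mulr_gt0// flat_gt0//.
  by rewrite -mulrBr mulr_gt0 ?ltr0n// subr_gt0.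
by rewrite mulNr addrC -mulrBr mulr_gt0 ?ltr0n// subr_gt0.
Qed.

Lemma cvg_flat0 (t : R) : 0 < t -> flat 0 (k.+1%:R * t) @[k --> \oo] --> (1 : R).
Proof.
move=> t0.
rewrite (_ : (fun k => _) = expR \o (fun k => - (k.+1%:R^-1 * t^-1))); last first.
  by apply/funext => k /=; rewrite flat0E leNgt mulr_gt0 ?ltr0n//= invfM.
rewrite -[X in _ --> X]expR0; apply: continuous_cvg; first exact: continuous_expR.
have h : (fun k : nat => - (k.+1%:R^-1 * t^-1)) @ \oo --> - (0 * t^-1 : R).
  by apply: cvgN; apply: cvgM; [exact: cvg_harmonic|exact: cvg_cst].
by rewrite mul0r oppr0 in h.
Qed.

Lemma cvg_bigprod (I : Type) (s : seq I) (F : I -> nat -> R) (l : I -> R) :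
  (forall i, F i k @[k --> \oo] --> l i) ->
  \prod_(i <- s) F i k @[k --> \oo] --> \prod_(i <- s) l i.
Proof.
move=> hF; elim: s => [|i s IH].
  rewrite big_nil; under eq_fun do rewrite big_nil; exact: cvg_cst.
by rewrite big_cons; under eq_fun do rewrite big_cons; exact: cvgM.
Qed.

Lemma cvg_bump a b x : bump k a b x @[k --> \oo] --> (\1_(obox a b) x : R).
Proof.
rewrite indicE; have [hx|hx] := pselect (obox a b x); last first.
  by rewrite memNset//; under eq_fun do rewrite bump_out//; exact: cvg_cst.
rewrite mem_set// /bump.
rewrite (_ : true%:R = \prod_(i < n) (1 : R)); last by rewrite big1.
apply: cvg_bigprod => i; have /andP[h1 h2] := hx i.
rewrite -[X in _ --> X]mulr1; apply: cvgM.
  under eq_fun do rewrite -mulrBr.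
  by apply: cvg_flat0; rewrite subr_gt0.
under eq_fun do rewrite mulNr addrC -mulrBr.
by apply: cvg_flat0; rewrite subr_gt0.
Qed.

Lemma compact_cbox a b : compact (cbox a b).
Proof.
apply: (@rV_compact _ _ (fun i => `[a ord0 i, b ord0 i]%classic)) => i.
exact: segment_compact.
Qed.

Lemma obox_sub_cbox a b : obox a b `<=` cbox a b.
Proof. by move=> x h i; have /andP[h1 h2] := h i; rewrite !ltW. Qed.

End bump.

Section test_functions.
Context {R : realType} {n : nat}.
Implicit Types (f g h phi : 'rV[R]_n -> R) (K : set 'rV[R]_n).

Lemma tsupport_out f x : ~ tsupport f x -> f x = 0.
Proof.
move=> hx; apply/eqP; apply: contra_notT hx => fx; exact: subset_closure.
Qed.

Lemma partiald_out f i x : ~ tsupport f x -> partiald i f x = 0.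
Proof.
move=> hx; rewrite /partiald.
have -> : 'D_(delta_mx ord0 i) f x = 'D_(delta_mx ord0 i) (cst (0 : R)) x.
  apply: near_eq_derive.
  have : nbhs x (~` tsupport f).
    by apply: open_nbhs_nbhs; split => //; apply: closed_openC; exact: closed_closure.
  by apply: filterS => y hy; exact: tsupport_out.
exact: derive_cst.
Qed.

Lemma test_funI f K : smooth f -> compact K -> ~ K 0 -> (forall x, ~ K x -> f x = 0) -> test_fun f.
Proof.
move=> sf cK K0 fK.
have sub : tsupport f `<=` K.
  have cK' : closed K by apply: compact_closed.
  rewrite /tsupport [X in _ `<=` X]((closure_id K).1 cK'); apply: closureS.
  by move=> x /= fx; apply: contrapT => hx; move: fx; rewrite fK ?eqxx.
split => //; first by apply: (subclosed_compact _ cK) => //; exact: closed_closure.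
by move/sub.
Qed.

Lemma test_fun_class k phi : test_fun phi -> class_C k phi.
Proof. by case=> + _ _; apply. Qed.

Lemma test_fun_continuous phi : test_fun phi -> continuous phi.
Proof. by move/(test_fun_class 0). Qed.

Lemma test_fun_is_derive phi i x : test_fun phi ->
  is_derive x (delta_mx ord0 i) phi (partiald i phi x).
Proof. by move=> h; exact: class_C_is_derive (test_fun_class 1 h). Qed.

Lemma smooth_partiald f i : smooth f -> smooth (partiald i f).
Proof. by move=> sf k; have [_ /(_ i)[]] := sf k.+1. Qed.

Lemma test_fun_partiald phi i : test_fun phi -> test_fun (partiald i phi).
Proof.
move=> [s c n0]; apply: (test_funI _ c n0) => [|x]; first exact: smooth_partiald.
exact: partiald_out.
Qed.

Lemma test_funM phi f : test_fun phi -> smooth f -> test_fun (fun x => f x * phi x).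
Proof.
move=> [s c n0] sf; apply: (test_funI _ c n0) => [k|x hx]; first by apply: class_CM.
by rewrite (tsupport_out hx) mulr0.
Qed.

Lemma test_funD phi psi : test_fun phi -> test_fun psi -> test_fun (fun x => phi x + psi x).
Proof.
move=> [s c n0] [s' c' n0']; apply: (test_funI _ (compactU c c')) => [k||x hx].
- exact: class_CD.
- by case.
- rewrite (@tsupport_out phi x) ?(@tsupport_out psi x) ?addr0//.
    by move=> h; apply: hx; right.
  by move=> h; apply: hx; left.
Qed.

Lemma test_fun_bsupp phi : test_fun phi -> bsupp phi.
Proof.
move=> [_ c _]; have [M [_ hM]] := compact_sub_cube c.
by exists M => x hx; apply: tsupport_out => /hM.
Qed.

Lemma test_fun_bounded phi : test_fun phi -> exists B, forall x, `|phi x| <= B.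
Proof.
by move=> h; apply: continuous_bsupp_bounded; [exact: test_fun_continuous|exact: test_fun_bsupp].
Qed.

Lemma test_fun_measurable phi : test_fun phi -> measurable_fun [set: 'rV[R]_n] phi.
Proof. by move=> h; apply: continuous_measurable_rV; exact: test_fun_continuous. Qed.

Lemma leb_compact_lty K : compact K -> (leb n K < +oo)%E.
Proof.
move=> cK; have [M [_ KM]] := compact_sub_cube cK.
apply: le_lt_trans (leb_cube_lty n M); apply: le_measure => //; rewrite inE.
  exact: measurable_rV_compact.
exact: measurable_cube.
Qed.

Lemma integrable_loc_integrableM g h K (B : R) : loc_integrable g ->
  measurable_fun [set: 'rV[R]_n] h -> (forall x, `|h x| <= B) ->
  compact K -> ~ K 0 -> (forall x, ~ K x -> h x = 0) ->
  (leb n).-integrable [set: 'rV[R]_n] (fun x => (g x * h x)%:E).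
Proof.
move=> [mg ig] mh hB cK K0 hK.
have mK := measurable_rV_compact cK.
have igK : (leb n).-integrable K (EFin \o g).
  apply/integrableP; split; first by apply/measurable_EFinP; exact: measurable_funTS.
  exact: ig.
have : (leb n).-integrable K (fun x => (g x * h x)%:E).
  have i2 := @integrableZl _ _ _ (leb n) K mK B _ igK.
  apply: le_integrable i2 => //.
    by apply/measurable_EFinP/measurable_funTS; exact: measurable_funM.
  move=> x _ /=; rewrite lee_fin !normrM mulrC ler_wpM2r//.
  exact: le_trans (hB x) (ler_norm _).
move/(integrable_mkcond _ mK); apply: eq_integrable => // x _; rewrite patchE.
by case: ifPn => //; rewrite notin_setE => hx; rewrite hK ?mulr0.
Qed.

Lemma integrable_loc_test g phi : loc_integrable g -> test_fun phi ->
  (leb n).-integrable [set: 'rV[R]_n] (fun x => (g x * phi x)%:E).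
Proof.
move=> lg hphi; have [B hB] := test_fun_bounded hphi; have [_ c n0] := hphi.
apply: (integrable_loc_integrableM lg _ hB c n0); first exact: test_fun_measurable.
exact: tsupport_out.
Qed.

Lemma continuous_compact_bounded f K : continuous f -> compact K ->
  exists B : R, 0 <= B /\ forall x, K x -> `|f x| <= B.
Proof.
move=> cf cK.
have cN : {within K, continuous (fun x => `|f x|)}.
  apply: continuous_subspaceT => x; apply: continuous_comp; first exact: cf.
  exact: norm_continuous.
have [->|/set0P ne] := eqVneq K set0; first by exists 0; split.
have [c cM hc] := EVT_max_rV ne cK cN.
by exists `|f c|; split => // x Kx; apply: hc; rewrite inE.
Qed.

Lemma loc_integrableM f g : loc_integrable f -> continuous g -> loc_integrable (fun x => g x * f x).
Proof.
move=> [mf hf] cg; have mg := continuous_measurable_rV cg.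
split; first exact: measurable_funM.
move=> K cK K0; have mK := measurable_rV_compact cK.
have [B [B0 hB]] := continuous_compact_bounded cg cK.
apply: (@le_lt_trans _ _ (\int[leb n]_(x in K) (B%:E * `|f x|%:E))%E).
  apply: ge0_le_integral => //.
  - by apply/measurable_EFinP/measurable_funTS; apply: measurableT_comp => //; exact: measurable_funM.
  - by apply: measurable_funeM; apply/measurable_EFinP/measurable_funTS; exact: measurableT_comp.
  - by move=> x Kx; rewrite -EFinM lee_fin normrM ler_wpM2r// hB.
have mF : measurable_fun K (fun x => `|f x|%:E).
  by apply/measurable_EFinP/measurable_funTS; exact: measurableT_comp.
rewrite (ge0_integralZl _ mK mF)// ?lee_fin//.
by rewrite lte_mul_pinfty// hf.
Qed.

Lemma loc_integrable_cst (c : R) : loc_integrable (fun _ : 'rV[R]_n => c).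
Proof.
split => // K cK K0; rewrite integral_cst; last exact: measurable_rV_compact.
by rewrite lte_mul_pinfty// leb_compact_lty.
Qed.

Lemma loc_integrable_continuous f : continuous f -> loc_integrable f.
Proof.
move=> cf; have := loc_integrableM (loc_integrable_cst 1) cf.
by under eq_fun do rewrite mulr1.
Qed.

Lemma loc_integrableD f g : loc_integrable f -> loc_integrable g -> loc_integrable (fun x => f x + g x).
Proof.
move=> [mf hf] [mg hg]; split; first exact: measurable_funD.
move=> K cK K0; have mK := measurable_rV_compact cK.
apply: (@le_lt_trans _ _ (\int[leb n]_(x in K) (`|f x|%:E + `|g x|%:E))%E).
  apply: ge0_le_integral => //.
  - by apply/measurable_EFinP/measurable_funTS; apply: measurableT_comp => //; exact: measurable_funD.
  - by apply: emeasurable_funD; apply/measurable_EFinP/measurable_funTS; exact: measurableT_comp.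
  - by move=> x _; rewrite -EFinD lee_fin ler_normD.
rewrite ge0_integralD//; [|by apply/measurable_EFinP/measurable_funTS; exact: measurableT_comp..].
by apply: lte_add_pinfty; [exact: hf|exact: hg].
Qed.

Lemma loc_integrableN f : loc_integrable f -> loc_integrable (fun x => - f x).
Proof.
move=> [mf hf]; split; first exact: measurableT_comp.
by move=> K cK K0; under eq_integral do rewrite normrN; exact: hf.
Qed.

End test_functions.

(** * Weak gradients and weighted norms *)

Section fundamental_lemma.
Context {R : realType} {n : nat}.
Local Open Scope ereal_scope.
Implicit Types (g : 'rV[R]_n.+1 -> R) (a b : 'rV[R]_n.+1).

Lemma test_fun_bump m k (a b : 'rV[R]_m) : ~ cbox a b 0%R -> test_fun (bump k a b).
Proof.
move=> h; apply: (@test_funI _ _ _ (cbox a b)) => //.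
- exact: smooth_bump.
- exact: compact_cbox.
by move=> y hy; apply: bump_out => /obox_sub_cbox.
Qed.

Definition annihilates g := forall phi, test_fun phi -> \int[leb n.+1]_x (g x * phi x)%:E = 0.

(** Dominated convergence along the bumps of the box, which are test functions because the closed
    box misses the origin. The dominating function is [|g|] on the closed box. *)
Lemma integral_obox0 g a b : loc_integrable g -> annihilates g -> ~ cbox a b 0%R ->
  \int[leb n.+1]_(x in obox a b) (g x)%:E = 0.
Proof.
move=> lg hg h0; have [mg _] := lg.
have mo := measurable_obox a b.
have mi : measurable_fun [set: 'rV[R]_n.+1] (\1_(obox a b) : _ -> R) by exact: measurable_indic.
have cK := @compact_cbox R n.+1 a b.
have hk k := test_fun_bump k h0.
have [_ _ h] : [/\ (leb n.+1).-integrable setT (fun x => (g x * \1_(obox a b) x)%:E),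
  [sequence \int[leb n.+1]_x `|(g x * bump k a b x)%:E - (g x * \1_(obox a b) x)%:E|]_k @ \oo --> 0 &
  [sequence \int[leb n.+1]_x (g x * bump k a b x)%:E]_k @ \oo --> \int[leb n.+1]_x (g x * \1_(obox a b) x)%:E].
  apply: (@dominated_convergence _ _ _ (leb n.+1) setT measurableT
    (fun k x => (g x * bump k a b x)%:E) _ (fun x => `|(g x * \1_(cbox a b) x)%:E|)).
  - by move=> k; apply/measurable_EFinP/measurable_funM => //; exact: test_fun_measurable.
  - by apply/measurable_EFinP/measurable_funM.
  - apply: aeW => x _; apply: cvg_EFin; first exact: nearW.
    by apply: cvgM; [exact: cvg_cst|exact: cvg_bump].
  - apply: integrable_abse; apply: (integrable_loc_integrableM lg (B := 1%R) _ _ cK h0).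
    + by apply: measurable_indic; exact: measurable_rV_compact.
    + by move=> x; rewrite indicE; case: (_ \in _); rewrite ?normr1 ?normr0.
    + by move=> x hx; rewrite indicE memNset.
  - apply: aeW => x k _; rewrite /= !normrM lee_fin ler_wpM2l//.
    rewrite indicE; have [hx|hx] := pselect (cbox a b x).
      by rewrite mem_set// normr1 ger0_norm ?bump_ge0// bump_le1.
    by rewrite bump_out ?normr0// => /obox_sub_cbox.
have E : \int[leb n.+1]_x (g x * \1_(obox a b) x)%:E = 0.
  move: h; rewrite (_ : (fun k => _) = cst 0); last by apply/funext => k /=; exact: hg.
  by move=> h; apply/esym; apply: (cvg_unique _ (cvg_cst _) h).
rewrite integral_mkcond -[RHS]E; apply: eq_integral => x _.
by rewrite patchE indicE; case: ifP => _; rewrite ?mulr1 ?mulr0.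
Qed.

(** The integral vanishes on all smaller open boxes, hence by the pi-lambda theorem on all
    measurable parts of the box, which forces [g] to vanish almost everywhere there. *)
Lemma annihilates_ae_box g a b : loc_integrable g -> annihilates g -> ~ cbox a b 0%R ->
  {ae leb n.+1, forall x, obox a b x -> g x = 0%R}.
Proof.
move=> lg hg h0; have [mg ig] := lg.
have mo := measurable_obox a b.
have ib : (leb n.+1).-integrable (obox a b) (EFin \o g).
  apply: (@integrableS _ _ _ (leb n.+1) (cbox a b)) => //.
  - by apply: measurable_rV_compact; exact: compact_cbox.
  - exact: obox_sub_cbox.
  - apply/integrableP; split; first by apply/measurable_EFinP; exact: measurable_funTS.
    by apply: ig => //; exact: compact_cbox.
pose P (S : set 'rV[R]_n.+1) := \int[leb n.+1]_(x in S `&` obox a b) (g x)%:E = 0.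
have hP S : measurable S -> P S.
  rewrite measurable_rV_oboxes; apply: (dynkin_induction measurable_rV_oboxes oboxes_setI).
  - by rewrite /P setTI; exact: integral_obox0.
  - move=> _ [c _ [d _ <-]]; rewrite /P.
    pose c' := (\row_i Num.max (c ord0 i) (a ord0 i))%R.
    pose d' := (\row_i Num.min (d ord0 i) (b ord0 i))%R.
    have -> : obox c d `&` obox a b = obox c' d'.
      apply/seteqP; split=> [x [h1 h2] i|x h].
        by rewrite !mxE gt_max lt_min; case/andP: (h1 i) => -> ->; case/andP: (h2 i) => -> ->.
      by split=> i; have := h i; rewrite !mxE gt_max lt_min => /andP[/andP[k1 k2] /andP[k3 k4]]; rewrite ?k1 ?k2 ?k3 ?k4.
    apply: integral_obox0 => // h; apply: h0 => i; have := h i.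
    by rewrite !mxE ge_max le_min => /andP[/andP[_ ->] /andP[_ ->]].
  - move=> {}S mS hS; rewrite /P.
    have E : (S `&` obox a b) `|` (~` S `&` obox a b) = obox a b.
      by rewrite -setIUl setUv setTI.
    have mS1 : measurable (S `&` obox a b) by exact: measurableI.
    have mS2 : measurable (~` S `&` obox a b) by apply: measurableI => //; exact: measurableC.
    have := @integral_setU _ _ _ (leb n.+1) _ _ (EFin \o g) mS1 mS2.
    rewrite E => /(_ (measurable_int _ ib)) h.
    have dis : [disjoint S `&` obox a b & ~` S `&` obox a b].
      by apply/disj_setPS => x [[h1 _] [h2 _]].
    rewrite -[LHS]add0e -[X in X + _]hS -(h dis); exact: integral_obox0.
  - move=> F mF tF hF; rewrite /P setI_bigcupl integral_bigcup//.
    + by rewrite eseries0// => i _ _; exact: hF.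
    + exact: trivIset_setIr.
    + by move=> k; exact: measurableI.
    + by rewrite -setI_bigcupl; apply: integrableS ib => //; apply: measurableI => //; exact: bigcupT_measurable.
have := @integral_ae_eq _ _ _ (leb n.+1) (obox a b) mo (cst 0) (EFin \o g) ib.
have : forall E, E `<=` obox a b -> measurable E ->
  \int[leb n.+1]_(x in E) (EFin \o g) x = \int[leb n.+1]_(x in E) cst 0 x.
  by move=> E Eb mE; rewrite integral0 -[RHS](hP E mE) setIidl.
move=> h /(_ (measurable_cst _) h); apply: filterS => x h1 /h1 /= [] //.
Qed.

Lemma leb_origin0 : leb n.+1 [set (0 : 'rV[R]_n.+1)%R] = 0.
Proof.
rewrite (_ : [set (0 : 'rV[R]_n.+1)%R] = rbox (fun=> [set (0 : R)%R])).
  by rewrite leb_rbox// big_ord_recl lebesgue_measure_set1 mul0e.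
apply/seteqP; split=> x /=; first by move=> -> i; rewrite mxE.
by move=> h; apply/rowP => i; rewrite h mxE.
Qed.

Lemma ae_neq_origin : {ae leb n.+1, forall x : 'rV[R]_n.+1, x != 0%R}.
Proof.
exists [set (0 : 'rV[R]_n.+1)%R]; split; [|exact: leb_origin0|by move=> x /= /negP; rewrite negbK => /eqP].
by apply: measurable_rV_closed; apply: accessible_closed_set1; apply: hausdorff_accessible; exact: norm_hausdorff.
Qed.

Lemma annihilates_ae g : loc_integrable g -> annihilates g ->
  {ae leb n.+1, forall x, g x = 0%R}.
Proof.
move=> lg hg.
(* For [z = (i, sign)] the box between [A k z] and [B k z] keeps all coordinates below [k+1] in
   absolute value and pushes [x_i] beyond [1/(k+1)] on the side given by the sign. These countably
   many boxes cover everything but the origin, and their closures miss it. *)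
pose A (k : nat) (z : 'I_n.+1 * bool) : 'rV[R]_n.+1 :=
  (\row_j (if (j == z.1) && z.2 then k.+1%:R^-1 else - k.+1%:R))%R.
pose B (k : nat) (z : 'I_n.+1 * bool) : 'rV[R]_n.+1 :=
  (\row_j (if (j == z.1) && ~~ z.2 then - k.+1%:R^-1 else k.+1%:R))%R.
have k0 k : (0 < k.+1%:R^-1 :> R)%R by rewrite invr_gt0 ltr0n.
have h0 k z : ~ cbox (A k z) (B k z) 0%R.
  move=> /(_ z.1); rewrite !mxE eqxx /=; case: z.2 => /=.
    by rewrite leNgt k0.
  by rewrite oppr_ge0 [X in _ && X]leNgt k0 andbF.
have : {ae leb n.+1, forall x, forall k, forall z, obox (A k z) (B k z) x -> g x = 0%R}.
  apply/ae_foralln => k; apply: filter_forall => z; exact: annihilates_ae_box.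
move=> h; near=> x.
have x0 : x != 0%R by near: x; exact: ae_neq_origin.
have hx : forall k, forall z, obox (A k z) (B k z) x -> g x = 0%R by near: x.
have [i xi] : exists i, x ord0 i != 0%R.
  apply/existsP; apply: contraNT x0; rewrite negb_exists => /forallP h'.
  by apply/eqP/rowP => i; rewrite mxE; apply/eqP; have := h' i; rewrite negbK.
pose k := Num.trunc (`|x| + `|x ord0 i|^-1)%R.
have k1 : (`|x| < k.+1%:R)%R.
  by apply: le_lt_trans (truncnS_gt _); rewrite lerDl invr_ge0.
have k2 : (k.+1%:R^-1 < `|x ord0 i|)%R.
  rewrite -[ltRHS]invrK ltf_pV2 ?posrE ?invr_gt0 ?normr_gt0//.
  by apply: le_lt_trans (truncnS_gt _); rewrite lerDr.
apply: (hx k (i, 0 < x ord0 i)%R) => j; rewrite !mxE /=.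
have /andP[j1 j2] : (- k.+1%:R < x ord0 j < k.+1%:R)%R.
  by rewrite -ltr_norml; exact: le_lt_trans (coord_le_norm _ _) k1.
have [ji|ji] /= := eqVneq j i; last by rewrite j1 j2.
move: j1 j2; rewrite ji; have [xp|xn] /= := ltP 0%R (x ord0 i) => j1 j2.
  by move: k2; rewrite gtr0_norm// => ->.
by move: k2; rewrite ler0_norm// ltrNr => ->; rewrite j1.
Unshelve. all: by end_near. Qed.

End fundamental_lemma.

(** * The Euclidean norm and the equality case of Cauchy-Schwarz *)

Section euclid.
Context {R : realType} {n : nat}.
Implicit Types x y : 'rV[R]_n.

Definition dotp x y : R := \sum_i x ord0 i * y ord0 i.

Lemma enorm_ge0 x : 0 <= enorm x.
Proof. exact: sqrtr_ge0. Qed.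

Lemma sumsq_ge0 x : 0 <= \sum_i x ord0 i ^+ 2.
Proof. by apply: sumr_ge0 => i _; exact: sqr_ge0. Qed.

Lemma enorm_sqr x : enorm x ^+ 2 = \sum_i x ord0 i ^+ 2.
Proof. by rewrite sqr_sqrtr// sumsq_ge0. Qed.

Lemma coord_le_enorm x i : `|x ord0 i| <= enorm x.
Proof.
rewrite -sqrtr_sqr ler_sqrt ?sumsq_ge0// (bigD1 i)//= lerDl.
by apply: sumr_ge0 => j _; exact: sqr_ge0.
Qed.

Lemma enormZ (c : R) x : enorm (c *: x) = `|c| * enorm x.
Proof.
rewrite /enorm -sqrtr_sqr -sqrtrM ?sqr_ge0// mulr_sumr; congr Num.sqrt.
by apply: eq_bigr => i _; rewrite mxE exprMn.
Qed.

Lemma enorm0 : enorm (0 : 'rV[R]_n) = 0.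
Proof. by have := enormZ 0 0; rewrite scale0r normr0 mul0r. Qed.

Lemma enorm_eq0 x : (enorm x == 0) = (x == 0).
Proof.
apply/idP/eqP => [/eqP h|->]; last by rewrite enorm0.
apply/rowP => i; rewrite mxE; apply/eqP; rewrite -normr_le0.
by rewrite -h coord_le_enorm.
Qed.

Lemma enorm_gt0 x : (0 < enorm x) = (x != 0).
Proof. by rewrite lt_def enorm_ge0 andbT enorm_eq0. Qed.

Lemma continuous_enorm : continuous (@enorm R n).
Proof.
move=> x; apply: (@continuous_comp _ _ _ (fun x : 'rV[R]_n => \sum_i x ord0 i ^+ 2) Num.sqrt); last exact: sqrt_continuous.
have : @class_C R n 0 (fun x => \sum_(i <- index_enum 'I_n) x ord0 i * x ord0 i).
  by apply: class_C_sum => i; apply: class_CM; exact: class_C_coord.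
by move=> /(_ x); under eq_fun do under eq_bigr do rewrite -expr2.
Qed.

Lemma measurable_enorm : measurable_fun [set: 'rV[R]_n] (@enorm R n).
Proof. by apply: continuous_measurable_rV; exact: continuous_enorm. Qed.

Lemma dotpE x y (c d : R) :
  enorm (c *: x + d *: y) ^+ 2 = c ^+ 2 * enorm x ^+ 2 + 2 * c * d * dotp x y + d ^+ 2 * enorm y ^+ 2.
Proof.
rewrite !enorm_sqr !mulr_sumr -!big_split/=; apply: eq_bigr => i _.
by rewrite !mxE; ring.
Qed.

(** The vector on the left is, up to a factor, the part of [y] orthogonal to [x]. The identity gives
    both the Cauchy-Schwarz inequality and its equality case. *)
Lemma cauchy_eqE x y : enorm (enorm x ^+ 2 *: y - dotp x y *: x) ^+ 2 =
  enorm x ^+ 2 * (enorm x ^+ 2 * enorm y ^+ 2 - dotp x y ^+ 2).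
Proof.
rewrite -scaleNr dotpE (_ : dotp y x = dotp x y); first by ring.
by apply: eq_bigr => i _; rewrite mulrC.
Qed.

Lemma dotp_le x y : `|dotp x y| <= enorm x * enorm y.
Proof.
have [->|x0] := eqVneq x 0.
  rewrite enorm0 mul0r /dotp big1 ?normr0// => i _; by rewrite mxE mul0r.
have h := sqr_ge0 (enorm (enorm x ^+ 2 *: y - dotp x y *: x)).
rewrite cauchy_eqE pmulr_rge0 ?exprn_gt0 ?enorm_gt0// in h.
rewrite -(@ler_pXn2r _ 2) ?nnegrE ?mulr_ge0 ?enorm_ge0//.
by rewrite exprMn real_normK ?num_real// -subr_ge0.
Qed.

Lemma cauchy_eq x y : dotp x y ^+ 2 = enorm x ^+ 2 * enorm y ^+ 2 ->
  enorm x ^+ 2 *: y = dotp x y *: x.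
Proof.
move=> h; apply/eqP; rewrite -subr_eq0 -enorm_eq0 -sqrf_eq0 cauchy_eqE h subrr mulr0.
by [].
Qed.

Lemma enormD x y : enorm (x + y) <= enorm x + enorm y.
Proof.
rewrite -(@ler_pXn2r _ 2) ?nnegrE ?addr_ge0 ?enorm_ge0//.
rewrite -[x]scale1r -[y]scale1r dotpE !scale1r.
have := le_trans (ler_norm _) (dotp_le x y); nra.
Qed.

Lemma compact_enorm_bounds (K : set 'rV[R]_n) : compact K -> ~ K 0 ->
  exists r s : R, [/\ 0 < r, 0 < s & forall x, K x -> r <= enorm x <= s].
Proof.
move=> cK K0.
have [->|/set0P ne] := eqVneq K set0; first by exists 1, 1; split.
have cN : {within K, continuous (@enorm R n)}.
  by apply: continuous_subspaceT; exact: continuous_enorm.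
have [c cM hc] := EVT_max_rV ne cK cN.
have [d dM hd] := EVT_min_rV ne cK cN.
have pos x : K x -> 0 < enorm x.
  by move=> Kx; rewrite enorm_gt0; apply: contra_notN K0 => /eqP <-.
exists (enorm d), (enorm c); split.
- by apply: pos; rewrite inE in dM.
- by apply: pos; rewrite inE in cM.
- by move=> x Kx; rewrite hd ?inE//= hc ?inE.
Qed.

(** The power is monotone in a direction depending on the sign of [t]; the sum of both end values
    covers the two cases. *)
Lemma powR_bound (t r s x : R) : 0 < r -> r <= x <= s -> x `^ t <= r `^ t + s `^ t.
Proof.
move=> r0 /andP[rx xs]; have x0 := lt_le_trans r0 rx; have s0 := lt_le_trans x0 xs.
have [t0|t0] := leP 0 t.
  by apply: (@le_trans _ _ (s `^ t)); rewrite ?lerDr ?powR_ge0// ge0_ler_powR// nnegrE ltW.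
apply: (@le_trans _ _ (r `^ t)); rewrite ?lerDl ?powR_ge0//.
rewrite -[t]opprK powRN [leRHS]powRN lef_pV2 ?posrE ?powR_gt0//.
by apply: ge0_ler_powR; rewrite ?nnegrE ?oppr_ge0 //; exact: ltW.
Qed.

Definition annulus (r s : R) : set 'rV[R]_n := [set x | r <= enorm x <= s].

Lemma norm_le_enorm x : `|x| <= enorm x.
Proof.
rewrite [leLHS]mx_normrE; apply: bigmax_le; first exact: enorm_ge0.
by move=> [i0 i] _ /=; rewrite (ord1 i0) coord_le_enorm.
Qed.

Lemma compact_annulus r s : compact (annulus r s).
Proof.
apply: bounded_closed_compact.
  exists s; split; first exact: num_real.
  move=> M sM x /= /andP[_ xs].
  by apply: (le_trans (norm_le_enorm x)); apply: (le_trans xs); exact: ltW.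
rewrite (_ : annulus r s = @enorm R n @^-1` `[r, s]%classic).
  apply: closed_comp; first by move=> x _; exact: continuous_enorm.
  exact: interval_closed.
by apply/seteqP; split=> x /=; rewrite in_itv.
Qed.

End euclid.

(** * Weighted norms: comparison, scaling, finiteness, duality *)

Section weighted_norms.
Context {R : realType} {n : nat}.
Local Open Scope ereal_scope.
Implicit Types (u v : 'rV[R]_n -> R) (p q s : R).

(* [wLnorm p s u] is convertible to [wint p s u `^ p^-1]. *)
Definition wint p s u : \bar R :=
  \int[leb n]_x (enorm x `^ (- (p * s)) * `|u x| `^ p)%:E.

Lemma measurable_wint p s u : measurable_fun [set: 'rV[R]_n] u ->
  measurable_fun [set: 'rV[R]_n] (fun x => enorm x `^ (- (p * s)) * `|u x| `^ p)%R.
Proof.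
move=> mu; apply: measurable_funM.
  by apply: (measurableT_comp (@measurable_powR R _)); exact: measurable_enorm.
by apply: (measurableT_comp (@measurable_powR R _)); exact: measurableT_comp.
Qed.

Lemma measurable_wintE p s u : measurable_fun [set: 'rV[R]_n] u ->
  measurable_fun [set: 'rV[R]_n] (fun x => (enorm x `^ (- (p * s)) * `|u x| `^ p)%:E).
Proof. by move=> mu; apply/measurable_EFinP; exact: measurable_wint. Qed.

Lemma wint_ge0 p s u : 0 <= wint p s u.
Proof. by apply: integral_ge0 => x _; rewrite lee_fin mulr_ge0// powR_ge0. Qed.

Lemma wLnorm_ge0 p s u : 0 <= wLnorm p s u.
Proof. exact: poweR_ge0. Qed.

Lemma wLnorm_pow p s u : (0 < p)%R -> wLnorm p s u `^ p = wint p s u.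
Proof.
move=> p0; rewrite /wLnorm -poweRrM mulVf ?gt_eqF// poweRe1//.
exact: wint_ge0.
Qed.

Lemma wLnorm_lty p s u : wint p s u < +oo -> wLnorm p s u < +oo.
Proof. exact: poweR_lty. Qed.

Lemma wint_eq0 p s u : wLnorm p s u = 0 -> wint p s u = 0.
Proof. by move/poweR_eq0_eq0; apply; exact: wint_ge0. Qed.

Lemma wint_le p s u v : measurable_fun [set: 'rV[R]_n] u -> measurable_fun [set: 'rV[R]_n] v ->
  (0 < p)%R -> {ae leb n, forall x, (`|u x| <= `|v x|)%R} -> wint p s u <= wint p s v.
Proof.
move=> mu mv p0 h; apply: ae_ge0_le_integral => //.
- by move=> x _; rewrite lee_fin mulr_ge0// powR_ge0.
- exact: measurable_wintE.
- by move=> x _; rewrite lee_fin mulr_ge0// powR_ge0.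
- exact: measurable_wintE.
- apply: filterS h => x hx _; rewrite lee_fin ler_wpM2l ?powR_ge0//.
  by rewrite ge0_ler_powR ?nnegrE// ltW.
Qed.

Lemma wint_ae p s u v : measurable_fun [set: 'rV[R]_n] u -> measurable_fun [set: 'rV[R]_n] v ->
  (0 < p)%R -> {ae leb n, forall x, (`|u x| = `|v x|)%R} -> wint p s u = wint p s v.
Proof.
move=> mu mv p0 h; apply/eqP; rewrite eq_le; apply/andP; split.
  by apply: (wint_le _ mu mv p0); apply: filterS h => x ->.
by apply: (wint_le _ mv mu p0); apply: filterS h => x ->.
Qed.

Lemma wLnorm_ae p s u v : measurable_fun [set: 'rV[R]_n] u -> measurable_fun [set: 'rV[R]_n] v ->
  (0 < p)%R -> {ae leb n, forall x, (`|u x| = `|v x|)%R} -> wLnorm p s u = wLnorm p s v.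
Proof. by move=> *; rewrite /wLnorm -/(wint p s u) (@wint_ae p s u v). Qed.

(** From [|x + y| <= 2 max (|x|, |y|)]. The constant is crude, as it only serves to show that
    integrals are finite. *)
Lemma powRD_le p (x y : R) : (0 < p)%R -> (`|x + y| `^ p <= 2 `^ p * (`|x| `^ p + `|y| `^ p))%R.
Proof.
move=> p0; apply: (@le_trans _ _ ((2 * Num.max `|x| `|y|) `^ p)%R).
  have m0 : (0 <= Num.max `|x| `|y|)%R by rewrite le_max normr_ge0.
  apply: ge0_ler_powR; rewrite ?nnegrE ?mulr_ge0//; first exact: ltW.
  rewrite (le_trans (ler_normD _ _))// mulr2n mulrDl mul1r lerD// le_max lexx ?orbT//.
rewrite powRM// ?le_max ?normr_ge0// ler_wpM2l ?powR_ge0//.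
by case: (leP `|x| `|y|)%R => _; rewrite ?lerDr ?lerDl ?powR_ge0.
Qed.

Lemma wintD_le p s u v : measurable_fun [set: 'rV[R]_n] u -> measurable_fun [set: 'rV[R]_n] v ->
  (0 < p)%R -> wint p s (fun x => u x + v x)%R <= (2 `^ p)%:E * (wint p s u + wint p s v).
Proof.
move=> mu mv p0.
have mU := measurable_wintE p s mu; have mV := measurable_wintE p s mv.
have U0 (w : 'rV[R]_n -> R) (x : 'rV[R]_n) : (0 <= enorm x `^ (- (p * s)) * `|w x| `^ p)%R by rewrite mulr_ge0// powR_ge0.
pose F (w : 'rV[R]_n -> R) (x : 'rV[R]_n) := (enorm x `^ (- (p * s)) * `|w x| `^ p)%:E.
have F0 w x : 0 <= F w x by rewrite lee_fin U0.
have mF : measurable_fun [set: 'rV[R]_n] (fun x => F u x + F v x) by exact: emeasurable_funD.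
have -> : wint p s u + wint p s v = \int[leb n]_x (F u x + F v x).
  by rewrite ge0_integralD//.
rewrite -(ge0_integralZl _ measurableT mF); last 2 first.
- by move=> x _; rewrite adde_ge0.
- by rewrite lee_fin powR_ge0.
apply: ge0_le_integral => //.
- by move=> x _; rewrite lee_fin mulr_ge0 ?powR_ge0.
- by apply: measurable_wintE; exact: measurable_funD.
- exact: measurable_funeM.
- move=> x _; rewrite /F -EFinD -EFinM lee_fin -mulrDr mulrCA ler_wpM2l ?powR_ge0//.
  exact: powRD_le.
Qed.

Lemma wint_scale p s u (l : R) : (0 < l)%R -> measurable_fun [set: 'rV[R]_n] u ->
  wint p s (fun x => u (l *: x)%R) = (l `^ (p * s - n%:R))%:E * wint p s u.
Proof.
move=> l0 mu.
have mul : measurable_fun [set: 'rV[R]_n] (fun x => u (l *: x)%R).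
  by apply: measurableT_comp => //; exact: measurable_scale_rV.
rewrite /wint [in RHS](integral_leb_scale l0)//; last 2 first.
- exact: measurable_wintE.
- by move=> x; rewrite lee_fin mulr_ge0 ?powR_ge0.
under [in RHS]eq_integral => x _.
  rewrite enormZ gtr0_norm// powRM ?enorm_ge0 ?ltW// -mulrA EFinM.
  over.
rewrite ge0_integralZl//; last 3 first.
- exact: measurable_wintE.
- by move=> x _; rewrite lee_fin mulr_ge0 ?powR_ge0.
- by rewrite lee_fin powR_ge0.
have ln0 : (l != 0)%R by rewrite gt_eqF.
rewrite !muleA -!EFinM -powR_mulrn ?ltW// -!powRD ?ln0 ?implybT//.
by rewrite [X in (l `^ X)%:E](_ : _ = 0%R) ?powRr0 ?mul1e//; ring.
Qed.

Lemma wLnorm_scale p s u (l : R) : (0 < p)%R -> (0 < l)%R -> measurable_fun [set: 'rV[R]_n] u ->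
  wLnorm p s (fun x => u (l *: x)%R) = (l `^ (s - n%:R / p))%:E * wLnorm p s u.
Proof.
move=> p0 l0 mu; rewrite /wLnorm -/(wint p s (fun x => u (l *: x)%R)) wint_scale//.
rewrite poweRM ?lee_fin ?powR_ge0 ?wint_ge0// poweR_EFin -powRrM; congr ((_ `^ _)%:E * _).
by field; rewrite gt_eqF.
Qed.

(** On a compact set that misses the origin the weight is bounded, whatever the sign of its
    exponent. *)
Lemma wint_bounded_lty p s u (K : set 'rV[R]_n) (B : R) : (0 < p)%R ->
  measurable_fun [set: 'rV[R]_n] u -> (forall x, `|u x| <= B)%R -> compact K -> ~ K 0%R ->
  (forall x, ~ K x -> u x = 0)%R -> wint p s u < +oo.
Proof.
move=> p0 mu uB cK K0 uK; have mK := measurable_rV_compact cK.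
have [r [t [r0 t0 hK]]] := compact_enorm_bounds cK K0.
have B0 : (0 <= B)%R by apply: le_trans (uB 0%R).
pose C := ((r `^ (- (p * s)) + t `^ (- (p * s))) * B `^ p)%R.
have -> : wint p s u = \int[leb n]_(x in K) (enorm x `^ (- (p * s)) * `|u x| `^ p)%:E.
  rewrite [RHS]integral_mkcond; apply: eq_integral => x _; rewrite patchE.
  case: ifPn => //; rewrite notin_setE => hx.
  by rewrite uK// normr0 powR0 ?gt_eqF// mulr0.
apply: (@le_lt_trans _ _ (\int[leb n]_(x in K) C%:E)).
  apply: ge0_le_integral => //.
  - by move=> x _; rewrite lee_fin mulr_ge0 ?powR_ge0.
  - by apply: measurable_funTS; exact: measurable_wintE.
  - move=> x Kx; rewrite lee_fin ler_pM ?powR_ge0//.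
      by apply: powR_bound => //; exact: hK.
    by rewrite ge0_ler_powR ?nnegrE// ltW.
by rewrite integral_cst// lte_mul_pinfty ?leb_compact_lty// lee_fin mulr_ge0 ?addr_ge0 ?powR_ge0.
Qed.

Lemma wint_test_lty p s u : (0 < p)%R -> test_fun u -> wint p s u < +oo.
Proof.
move=> p0 tu; have [B uB] := test_fun_bounded tu; have [_ c c0] := tu.
apply: (wint_bounded_lty s p0 _ uB c c0); first exact: test_fun_measurable.
exact: tsupport_out.
Qed.

End weighted_norms.

Section weighted_hoelder.
Context {R : realType} {n : nat}.
Local Open Scope ereal_scope.
Implicit Types (u v : 'rV[R]_n.+1 -> R) (p q s : R).

Lemma ae_origin (P : 'rV[R]_n.+1 -> Prop) : (forall x, x != 0%R -> P x) ->
  {ae leb n.+1, forall x, P x}.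
Proof. by move=> h; apply: filterS ae_neq_origin. Qed.

Lemma wint_eq0_ae p s u : (0 < p)%R -> measurable_fun [set: 'rV[R]_n.+1] u ->
  wint p s u = 0 -> ae_zero u.
Proof.
move=> p0 mu h.
have mU := measurable_wintE p s mu.
have : \int[leb n.+1]_x `|(enorm x `^ (- (p * s)) * `|u x| `^ p)%:E| = 0.
  rewrite -[RHS]h; apply: eq_integral => x _.
  by rewrite gee0_abs// lee_fin mulr_ge0// powR_ge0.
move/(ae_eq_integral_abs _ measurableT mU) => H.
have h0 := @ae_neq_origin R n.
rewrite /ae_zero; near=> x.
have x0 : x != 0%R by near: x.
have hx : (enorm x `^ (- (p * s)) * `|u x| `^ p)%:E = 0.
  have : setT x -> (enorm x `^ (- (p * s)) * `|u x| `^ p)%:E = cst 0 x by near: x.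
  by apply.
move: hx => /eqP; rewrite eqe mulf_eq0 => /orP[/eqP h1|].
  by have := powR_gt0 (- (p * s)) (_ : 0 < enorm x)%R; rewrite h1 ltxx enorm_gt0 x0 => /(_ isT).
by rewrite powR_eq0 => /andP[/eqP/normr0P/eqP].
Unshelve. all: by end_near. Qed.

(** Insert [|x|^(-s) |x|^s = 1], valid off the origin: the dual of the weight [s] is the weight
    [-s]. *)
Lemma weighted_hoelder p q s u v : measurable_fun [set: 'rV[R]_n.+1] u ->
  measurable_fun [set: 'rV[R]_n.+1] v -> (0 < p)%R -> (0 < q)%R -> (p^-1 + q^-1 = 1)%R ->
  \int[leb n.+1]_x `|u x * v x|%:E <= wLnorm p s u * wLnorm q (- s) v.
Proof.
move=> mu mv p0 q0 pq.
have me t : measurable_fun [set: 'rV[R]_n.+1] (fun x => enorm x `^ t)%R.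
  by apply: (measurableT_comp (@measurable_powR R _)); exact: measurable_enorm.
have mf : measurable_fun [set: 'rV[R]_n.+1] (fun x => enorm x `^ (- s) * u x)%R.
  exact: measurable_funM.
have mg : measurable_fun [set: 'rV[R]_n.+1] (fun x => enorm x `^ s * v x)%R.
  exact: measurable_funM.
have := @hoelder _ _ _ (leb n.+1) _ _ _ _ mf mg p0 q0 pq.
rewrite Lnorm1 !Lnorm.unlock /=.
rewrite (_ : \int[leb n.+1]_x `|u x * v x|%:E = \int[leb n.+1]_x `|(EFin \o ((fun x => enorm x `^ (- s) * u x) \* (fun x => enorm x `^ s * v x))%R) x|); last first.
  apply: ae_eq_integral => //.
  - by apply/measurable_EFinP; apply: measurableT_comp => //; exact: measurable_funM.
  - by apply: measurableT_comp => //; apply/measurable_EFinP; exact: measurable_funM.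
  - apply: ae_origin => x x0 _ /=; congr (`|_|)%:E.
    rewrite mulrACA -powRD ?enorm_eq0 ?x0 ?implybT//.
    by rewrite addNr powRr0 mul1r.
move/le_trans; apply.
rewrite /wLnorm le_eqVlt; apply/orP; left; apply/eqP; congr (_ `^ _ * _ `^ _).
  apply: eq_integral => x _ /=; rewrite normrM powRM// ger0_norm ?powR_ge0//.
  by rewrite -powRrM mulNr [(s * p)%R]mulrC.
apply: eq_integral => x _ /=; rewrite normrM powRM// ger0_norm ?powR_ge0//.
by rewrite -powRrM mulrN opprK [(s * q)%R]mulrC.
Qed.

End weighted_hoelder.

Section cvg_extra.
Context {R : realType}.
Local Open Scope ereal_scope.

Lemma cvge0_leP (u : nat -> \bar R) : (forall k, 0 <= u k) ->
  (u @ \oo --> 0) <-> (forall e : R, (0 < e)%R -> \forall k \near \oo, u k <= e%:E).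
Proof.
move=> u0; split=> [/fine_cvgP[fu cu] e e0|h].
  have /cvgr0Pnorm_le/(_ e e0) ce := cu.
  near=> k; have fk : u k \is a fin_num by near: k.
  rewrite -(fineK fk) lee_fin; apply: (le_trans (ler_norm _)).
  by near: k.
apply/fine_cvgP; split.
  by apply: filterS (h 1%R ltr01) => k uk; rewrite ge0_fin_numE//; exact: le_lt_trans uk (ltry _).
apply/cvgr0Pnorm_le => e e0; apply: filterS (h e e0) => k uk.
have fk : u k \is a fin_num by rewrite ge0_fin_numE//; exact: le_lt_trans uk (ltry _).
by rewrite /= ger0_norm ?fine_ge0// -lee_fin fineK.
Unshelve. all: by end_near. Qed.

Lemma cvge0_squeeze (u v : nat -> \bar R) : (forall k, 0 <= u k) ->
  (forall k, u k <= v k) -> v @ \oo --> 0 -> u @ \oo --> 0.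
Proof.
move=> u0 uv v0; apply: (@squeeze_cvge _ _ _ _ (cst 0) u v) => //.
- by apply: nearW => k; rewrite u0 uv.
- exact: cvg_cst.
Qed.

Lemma cvge0_poweR (u : nat -> \bar R) (r : R) : (0 < r)%R -> (forall k, 0 <= u k) ->
  u @ \oo --> 0 -> (fun k => u k `^ r) @ \oo --> 0.
Proof.
move=> r0 u0 /(cvge0_leP u0) h; apply/cvge0_leP => [k|e e0]; first exact: poweR_ge0.
have e1 : (0 < e `^ r^-1)%R by rewrite powR_gt0.
apply: filterS (h _ e1) => k uk.
rewrite -[e](_ : ((e `^ r^-1) `^ r)%R = e); last by rewrite -powRrM mulVf ?gt_eqF// powRr1// ltW.
rewrite -poweR_EFin; apply: gt0_ler_poweR => //; first exact: ltW.
  by rewrite in_itv /= u0 leey.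
by rewrite in_itv /= lee_fin ltW//= leey.
Qed.

Lemma cvge0_Ml (u : nat -> \bar R) (c : \bar R) : 0 <= c -> c < +oo ->
  u @ \oo --> 0 -> (fun k => u k * c) @ \oo --> 0.
Proof.
move=> c0 cy cu; have fc : c \is a fin_num by rewrite ge0_fin_numE.
rewrite -(mul0e c) -(fineK fc); apply: cvgeM => //; last exact: cvg_cst.
Qed.

Lemma cvg_integral_dist d (T : measurableType d) (mu : {measure set T -> \bar R})
    (f : T -> R) (g : nat -> T -> R) (c : nat -> \bar R) :
  mu.-integrable [set: T] (fun x => (f x)%:E) ->
  (forall k, mu.-integrable [set: T] (fun x => (g k x)%:E)) ->
  (forall k, \int[mu]_x `|f x - g k x|%:E <= c k) -> c @ \oo --> 0 ->
  (fun k => \int[mu]_x (g k x)%:E) @ \oo --> \int[mu]_x (f x)%:E.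
Proof.
move=> fi gi fg c0.
suff : (fun k => `|\int[mu]_x (g k x)%:E - \int[mu]_x (f x)%:E|) @ \oo --> 0.
  by move/cvg_abse0P/sube_cvg0; apply; exact: integrable_fin_num.
apply: (cvge0_squeeze _ _ c0) => k; first exact: abse_ge0.
rewrite -integralB//; apply: le_trans (fg k).
under [leRHS]eq_integral do rewrite distrC.
apply: (le_abse_integral mu measurableT).
exact: (measurable_int _ (integrableB measurableT (gi k) fi)).
Qed.

End cvg_extra.

(** * Weak gradients: uniqueness, test functions, limits *)

Section weak_gradient.
Context {R : realType} {n : nat}.
Local Notation E := 'rV[R]_n.+1.
Implicit Types (u v phi : E -> R) (G : E -> E).

Definition grad phi : E -> E := fun x => \row_i partiald i phi x.

Lemma gradE phi x i : grad phi x ord0 i = partiald i phi x.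
Proof. by rewrite mxE. Qed.

Lemma measurable_loc_row G : (forall i, loc_integrable (fun x => G x ord0 i)) ->
  measurable_fun [set: E] G.
Proof. by move=> h; apply/measurable_fun_rVP => i; have [] := h i. Qed.

Lemma measurable_wgradG u G : is_wgrad u G -> measurable_fun [set: E] G.
Proof. by move=> [h _]; exact: measurable_loc_row. Qed.

Lemma measurable_enormG u G : is_wgrad u G -> measurable_fun [set: E] (fun x => enorm (G x)).
Proof.
by move=> h; apply: (measurableT_comp (@measurable_enorm R n.+1)); exact: measurable_wgradG h.
Qed.

Lemma is_wgradD u v G G' (c : R) : loc_integrable u -> loc_integrable v ->
  is_wgrad u G -> is_wgrad v G' ->
  is_wgrad (fun x => u x + c * v x) (fun x => G x + c *: G' x).
Proof.
move=> lu lv [lG hG] [lG' hG']; split=> [i|phi i tphi].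
  under eq_fun do rewrite !mxE.
  by apply: loc_integrableD => //; apply: (loc_integrableM (lG' i)); exact: cst_continuous.
have tp := test_fun_partiald i tphi.
have iu := integrable_loc_test lu tp; have iv := integrable_loc_test lv tp.
have iG := integrable_loc_test (lG i) tphi; have iG' := integrable_loc_test (lG' i) tphi.
transitivity (\int[leb n.+1]_x ((u x * partiald i phi x)%:E + c%:E * (v x * partiald i phi x)%:E))%E.
  by apply: eq_integral => x _; rewrite mulrDl EFinD -EFinM mulrA.
rewrite integralD//; last exact: integrableZl.
rewrite integralZl// hG// hG'//.
transitivity (- \int[leb n.+1]_x ((G x ord0 i * phi x)%:E + c%:E * (G' x ord0 i * phi x)%:E))%E; last first.
  by congr (- _)%E; apply: eq_integral => x _; rewrite !mxE mulrDl EFinD -EFinM mulrA.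
rewrite integralD//; last exact: integrableZl.
rewrite integralZl// oppeD ?muleN//.
by apply: fin_num_adde_defr; exact: integrable_fin_num.
Qed.

Lemma is_wgradB u v G G' : loc_integrable u -> loc_integrable v ->
  is_wgrad u G -> is_wgrad v G' -> is_wgrad (u \- v) (fun x => G x - G' x).
Proof.
move=> lu lv hu hv; have := is_wgradD (-1) lu lv hu hv.
by under eq_fun do rewrite mulN1r; under [X in is_wgrad _ X]eq_fun do rewrite scaleN1r.
Qed.

Lemma is_wgrad_unique u G G' : is_wgrad u G -> is_wgrad u G' ->
  {ae leb n.+1, forall x, G x = G' x}.
Proof.
move=> [lG hG] [lG' hG'].
have h i : {ae leb n.+1, forall x, G x ord0 i - G' x ord0 i = 0}.
  apply: annihilates_ae.
    by apply: loc_integrableD => //; exact: loc_integrableN.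
  move=> phi tphi.
  have iG := integrable_loc_test (lG i) tphi; have iG' := integrable_loc_test (lG' i) tphi.
  transitivity (\int[leb n.+1]_x ((G x ord0 i * phi x)%:E - (G' x ord0 i * phi x)%:E))%E.
    by apply: eq_integral => x _; rewrite mulrBl.
  rewrite integralB// -[X in (X - _)%E]oppeK -hG// -[X in (_ - X)%E]oppeK -hG'// subee//.
  by rewrite hG' ?fin_numN; [exact: integrable_fin_num|].
have hh : {ae leb n.+1, forall x, forall i, G x ord0 i - G' x ord0 i = 0}.
  by apply: filter_forall => i; exact: h.
apply: filterS hh => x hx; apply/rowP => i; apply/eqP; rewrite -subr_eq0; apply/eqP; exact: hx.
Qed.

Lemma wgradP u G : is_wgrad u G -> is_wgrad u (wgrad u).
Proof. by move=> h; apply: (xgetPex (fun=> 0)); exists G. Qed.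

Lemma wgrad_ae u G : is_wgrad u G -> {ae leb n.+1, forall x, wgrad u x = G x}.
Proof. by move=> h; apply: (@is_wgrad_unique u) => //; exact: wgradP h. Qed.

(** The gradient picked by [xget] agrees with [G] almost everywhere, so the norm may be computed
    from an explicit weak gradient. *)
Lemma wHnormE p b u G : 0 < p -> is_wgrad u G ->
  wHnorm p b u = wLnorm p b (fun x => enorm (G x)).
Proof.
move=> p0 h; apply: wLnorm_ae => //.
- exact: measurable_enormG (wgradP h).
- exact: measurable_enormG h.
- by apply: filterS (wgrad_ae h) => x ->.
Qed.

Lemma is_wgrad_test phi : test_fun phi -> is_wgrad phi (grad phi).
Proof.
move=> tphi; split=> [i|eta i teta].
  under eq_fun do rewrite mxE.
  by apply: loc_integrable_continuous; apply: test_fun_continuous; exact: test_fun_partiald.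
have lphi := loc_integrable_continuous (test_fun_continuous tphi).
have ldphi := loc_integrable_continuous (test_fun_continuous (test_fun_partiald i tphi)).
have i1 := integrable_loc_test lphi (test_fun_partiald i teta).
have i2 := integrable_loc_test ldphi teta.
have D x : is_derive x (delta_mx ord0 i) (fun x => phi x * eta x)
    (partiald i phi x * eta x + phi x * partiald i eta x).
  by apply: is_deriveMf; exact: test_fun_is_derive.
have sm : smooth phi by case: tphi.
have tM : test_fun (fun x => phi x * eta x) by exact: test_funM.
have E x : partiald i (fun x => phi x * eta x) x = partiald i phi x * eta x + phi x * partiald i eta x.
  by rewrite {1}/partiald; have [_ ->] := D x.
(* Integration by parts is the product rule for [phi * eta], whose partial derivative has integral
   zero. *)
have h0 : (\int[leb n.+1]_x (partiald i (fun x => phi x * eta x) x)%:E = 0)%E.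
  apply: integral_partiald0; last exact: test_fun_bsupp.
    by move=> x; have [] := D x.
  by apply: test_fun_continuous; exact: test_fun_partiald.
have h1 : (\int[leb n.+1]_x (partiald i phi x * eta x)%:E + \int[leb n.+1]_x (phi x * partiald i eta x)%:E = 0)%E.
  by rewrite -integralD// -[RHS]h0; apply: eq_integral => x _; rewrite E EFinD.
under [in RHS]eq_integral do rewrite gradE.
have f1 : (\int[leb n.+1]_x (partiald i phi x * eta x)%:E)%E \is a fin_num by exact: integrable_fin_num.
have f2 : (\int[leb n.+1]_x (phi x * partiald i eta x)%:E)%E \is a fin_num by exact: integrable_fin_num.
move: h1; rewrite -(fineK f1) -(fineK f2) -EFinD => -[h1].
by rewrite -EFinN; congr EFin; lra.
Qed.

Lemma wHnorm_test p b phi : 0 < p -> test_fun phi ->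
  wHnorm p b phi = wLnorm p b (fun x => enorm (grad phi x)).
Proof. by move=> p0 tphi; apply: wHnormE => //; exact: is_wgrad_test. Qed.

Local Open Scope ereal_scope.

(** Both sides of the integration by parts formula pass to the limit: the left one by convergence in
    L^1 on the support of the test function, the right one by the weighted Hoelder inequality. In
    this way the weak gradient of [freeze v y] is found from those of frozen test functions. *)
Lemma is_wgrad_limit p q s u G (phi : nat -> E -> R) (Gk : nat -> E -> E) :
  (0 < p)%R -> (0 < q)%R -> (p^-1 + q^-1 = 1)%R ->
  loc_integrable u -> (forall i, loc_integrable (fun x => G x ord0 i)) ->
  (forall k, loc_integrable (phi k)) -> (forall k, is_wgrad (phi k) (Gk k)) ->
  (forall K : set E, compact K -> ~ K 0%R ->
     \int[leb n.+1]_(x in K) `|u x - phi k x|%:E @[k --> \oo] --> 0) ->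
  wLnorm p s (fun x => enorm (G x - Gk k x)) @[k --> \oo] --> 0 ->
  is_wgrad u G.
Proof.
move=> p0 q0 pq lu lG lphi hG cphi cG; split=> // eta i teta.
have tp := test_fun_partiald i teta.
have [B hB] := test_fun_bounded tp.
have [_ cK K0] := tp; set K := tsupport _ in cK K0.
have mK := measurable_rV_compact cK.
have B0 : (0 <= B)%R by apply: le_trans (hB 0%R).
have mp := test_fun_measurable tp; have me := test_fun_measurable teta.
have c1 : (fun k => \int[leb n.+1]_x (phi k x * partiald i eta x)%:E) @ \oo -->
    \int[leb n.+1]_x (u x * partiald i eta x)%:E.
  apply: (@cvg_integral_dist _ _ _ _ _ _ (fun k => (\int[leb n.+1]_(x in K) `|u x - phi k x|%:E) * B%:E)).
  - exact: integrable_loc_test.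
  - by move=> k; exact: integrable_loc_test.
  - move=> k.
    have [md _] : loc_integrable (fun x => u x + - phi k x)%R by apply: loc_integrableD => //; exact: loc_integrableN.
    have mdn : measurable_fun K (fun x => `|u x - phi k x|%:E).
      by apply/measurable_EFinP/measurable_funTS; exact: measurableT_comp.
    rewrite -(ge0_integralZr _ mK mdn)//.
    rewrite [leRHS]integral_mkcond; apply: ge0_le_integral => //.
    + apply/measurable_EFinP; apply: measurableT_comp => //.
      by apply: measurable_funB; apply: measurable_funM => //; [have [] := lu|have [] := lphi k].
    + apply/(measurable_restrictT _ _).1 => //; apply: emeasurable_funM => //.
    + move=> x _; rewrite patchE -mulrBl normrM.
      case: ifPn => [_|]; first by rewrite -EFinM lee_fin ler_wpM2l.
      by rewrite notin_setE => hx; rewrite (tsupport_out hx) normr0 mulr0.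
  - by apply: cvge0_Ml => //; [rewrite ltry|exact: cphi].
have c2 : (fun k => \int[leb n.+1]_x (Gk k x ord0 i * eta x)%:E) @ \oo -->
    \int[leb n.+1]_x (G x ord0 i * eta x)%:E.
  apply: (@cvg_integral_dist _ _ _ _ _ _ (fun k => wLnorm p s (fun x => enorm (G x - Gk k x)%R) * wLnorm q (- s) eta)).
  - exact: integrable_loc_test.
  - by move=> k; apply: integrable_loc_test => //; have [] := hG k.
  - move=> k.
    have mG := measurable_loc_row lG; have mGk := measurable_wgradG (hG k).
    have md : measurable_fun [set: E] (fun x => enorm (G x - Gk k x)).
      apply: (measurableT_comp (@measurable_enorm R n.+1)); apply/measurable_fun_rVP => j.
      under eq_fun do rewrite !mxE.
      by apply: measurable_funB; [have [] := lG j|have [/(_ j)[]] := hG k].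
    apply: le_trans (weighted_hoelder s md me p0 q0 pq).
    apply: ge0_le_integral => //.
    + apply/measurable_EFinP; apply: measurableT_comp => //.
      by apply: measurable_funB; apply: measurable_funM => //; [have [] := lG i|have [/(_ i)[]] := hG k].
    + by apply/measurable_EFinP; apply: measurableT_comp => //; exact: measurable_funM.
    + move=> x _; rewrite -mulrBl lee_fin !normrM ler_wpM2r//.
      rewrite [leRHS]ger0_norm ?enorm_ge0//.
      by have := coord_le_enorm (G x - Gk k x) i; rewrite !mxE.
  - apply: cvge0_Ml => //; first exact: wLnorm_ge0.
    by apply: wLnorm_lty; exact: wint_test_lty.
have c3 : (fun k => \int[leb n.+1]_x (phi k x * partiald i eta x)%:E) @ \oo -->
    - \int[leb n.+1]_x (G x ord0 i * eta x)%:E.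
  rewrite (_ : (fun k => _) = (fun k => - \int[leb n.+1]_x (Gk k x ord0 i * eta x)%:E)); last first.
    by apply/funext => k; have [_ ->] := hG k.
  exact: cvgeN.
exact: (cvg_unique _ c1 c3).
Qed.

End weak_gradient.

(** * Freezing a function along a ray *)

Section chain_rule.
Context {R : realType}.

Lemma sub_rVE n (u v : 'rV[R]_n) i : (u - v) ord0 i = u ord0 i - v ord0 i.
Proof. by rewrite !mxE. Qed.

Lemma MVT_between (F f : R -> R) (a b : R) : (forall t : R, is_derive t (1 : R) F (f t)) ->
  exists c, `|c - a| <= `|b - a| /\ F b - F a = f c * (b - a).
Proof.
move=> dF.
have cF : continuous F.
  by move=> t; apply: differentiable_continuous; apply/derivable1_diffP; have [] := dF t.
have [ab|ba] := leP a b.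
  have [c cab E] := @MVT_segment R F f a b ab (fun x _ => dF x) (continuous_subspaceT cF).
  exists c; split => //; move: cab; rewrite in_itv /= => /andP[h1 h2].
  by rewrite !ger0_norm ?subr_ge0// lerB.
have [c cab E] := @MVT_segment R F f b a (ltW ba) (fun x _ => dF x) (continuous_subspaceT cF).
exists c; split; last by rewrite -opprB E -mulrN opprB.
move: cab; rewrite in_itv /= => /andP[h1 h2].
rewrite !ler0_norm ?subr_le0 ?(ltW ba)//; lra.
Qed.

(* One coordinate at a time: the increment in the first coordinate is handled by
   the mean value theorem, the remaining ones by induction on the slice. *)
Lemma is_derive_dir n (f : 'rV[R]_n -> R) (df : 'I_n -> 'rV[R]_n -> R) x v :
  (forall i y, is_derive y (delta_mx ord0 i) f (df i y)) ->
  (forall i, continuous (df i)) ->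
  is_derive x v f (\sum_i v ord0 i * df i x).
Proof.
elim: n f df x v => [|n IH] f df x v hd hc.
  rewrite big_ord0 (_ : v = 0); last by apply/rowP; case.
  exact: is_derive0.
pose x' : 'rV[R]_n := \row_j x ord0 (lift ord0 j); pose t := x ord0 ord0.
pose v' : 'rV[R]_n := \row_j v ord0 (lift ord0 j); pose s := v ord0 ord0.
have cE (y : 'rV[R]_n.+1) : y = cons_rV (\row_j y ord0 (lift ord0 j), y ord0 ord0).
  apply/rowP => i; case: (unliftP ord0 i) => [j ->|->]; first by rewrite cons_rVS mxE.
  by rewrite cons_rV0.
have xE : x = cons_rV (x', t) := cE x.
have lE (h : R) : h *: v + x = cons_rV (h *: v' + x', h * s + t).
  by rewrite [LHS]cE !mxE; congr cons_rV; congr pair; apply/rowP => j; rewrite !mxE.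
have sl : is_derive x' v' (fun y => f (cons_rV (y, t))) (\sum_j v' ord0 j * df (lift ord0 j) (cons_rV (x', t))).
  apply: (IH (fun y => f (cons_rV (y, t))) (fun j y => df (lift ord0 j) (cons_rV (y, t)))).
    by move=> i y; apply: is_derive_cons_rVl; exact: hd.
  move=> i y; apply: (@continuous_comp _ _ _ (fun x => cons_rV (x, t)) (df (lift ord0 i))).
    exact: continuous_cons_rVl.
  exact: hc.
have [dsl Dsl] := sl.
have sE : \sum_i v ord0 i * df i x = s * df ord0 x + \sum_j v' ord0 j * df (lift ord0 j) (cons_rV (x', t)).
  by rewrite big_ord_recl -xE; congr (_ + _); apply: eq_bigr => j _; rewrite mxE.
suff : (fun h : R => h^-1 *: ((f \o shift x) (h *: v) - f x)) @ 0^' --> \sum_i v ord0 i * df i x.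
  by move=> h; split; [apply/cvg_ex; eexists; exact: h|exact/cvg_lim].
rewrite sE.
pose A (h : R) := h^-1 * (f (cons_rV (h *: v' + x', h * s + t)) - f (cons_rV (h *: v' + x', t))).
pose B (h : R) := h^-1 *: (f (cons_rV (h *: v' + x', t)) - f (cons_rV (x', t))).
rewrite (_ : (fun h => _) = (fun h => A h + B h)); last first.
  apply/funext => h; rewrite /A /B /= lE -xE -mulrDr; congr (_ * _).
  by rewrite addrA subrK.
apply: cvgD; last by rewrite -Dsl; exact: dsl.
apply/cvgrPdist_le => e e0.
have e1 : 0 < e / (`|s| + 1) by rewrite divr_gt0// ltr_wpDl.
have /cvgrPdist_le /(_ _ e1) := hc ord0 x.
move=> /nbhs_ballP[d /= d0 hd'].
(* For [|h| < D] the intermediate point of the mean value theorem lies within [d] of [x]; the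
   summand 1 keeps the denominator positive. *)
pose D := d / (`|v| + `|s| + 1).
have vs0 : 0 < `|v| + `|s| + 1 by rewrite ltr_wpDl// addr_ge0.
have D0 : 0 < D by rewrite divr_gt0.
near=> h.
have h0 : h != 0 by near: h; exact: nbhs_dnbhs_neq.
have hD : `|h| < D by near: h; exact: dnbhs0_lt.
have [c [c1 c2]] := @MVT_between (fun r => f (cons_rV (h *: v' + x', r)))
  (fun r => df ord0 (cons_rV (h *: v' + x', r))) t (h * s + t)
  (fun r => is_derive_cons_rVr (hd ord0 _)).
have -> : A h = s * df ord0 (cons_rV (h *: v' + x', c)).
  by rewrite /A c2 addrK; field.
rewrite -mulrBr normrM.
have hb : `|df ord0 x - df ord0 (cons_rV (h *: v' + x', c))| <= e / (`|s| + 1).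
  apply: hd'; rewrite mx_norm_ball /ball_ /=.
  have k1 : `|h| * (`|v| + `|s| + 1) < d by rewrite -ltr_pdivlMr.
  have k2 : `|h| * `|v| + `|h| * `|s| < d.
    by apply: le_lt_trans k1; rewrite -mulrDr ler_wpM2l// lerDl.
  rewrite [ltLHS]mx_normrE; apply: bigmax_lt => // -[i0 i] _ /=.
  rewrite (ord1 i0) sub_rVE; case: (unliftP ord0 i) => [j ->|->].
    rewrite cons_rVS !mxE opprD addrCA subrr addr0 normrN normrM.
    apply: le_lt_trans k2; rewrite -[leLHS]addr0 lerD ?mulr_ge0// ler_wpM2l//.
    exact: coord_le_norm.
  rewrite cons_rV0 distrC; apply: (le_lt_trans c1); rewrite addrK normrM.
  by apply: le_lt_trans k2; rewrite lerDr mulr_ge0.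
apply: (le_trans (ler_wpM2l (normr_ge0 _) hb)).
by rewrite mulrA ler_pdivrMr ?ltr_wpDl// mulrDr mulr1 mulrC lerDl ltW.
Unshelve. all: by end_near. Qed.

Lemma class_C1_dir n (f : 'rV[R]_n -> R) x v : class_C 1 f ->
  is_derive x v f (\sum_i v ord0 i * partiald i f x).
Proof.
move=> [cf hf]; apply: (@is_derive_dir n f (fun i => partiald i f)).
  by move=> i y; apply: derivableP; have [] := hf i.
by move=> i; have [] := hf i.
Qed.

End chain_rule.

(** * Smoothness away from the origin *)

Section off_origin.
Context {R : realType} {n : nat}.
Local Notation E := 'rV[R]_n.
Implicit Types f g : E -> R.

(* [class_C k] on the complement of the origin. *)
Fixpoint class_C0 (k : nat) f : Prop :=
  match k with
  | 0 => forall x, x != 0 -> {for x, continuous f}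
  | l.+1 => (forall x, x != 0 -> {for x, continuous f}) /\
      forall i, exists df, (forall x, x != 0 -> is_derive x (delta_mx ord0 i) f (df x)) /\
        class_C0 l df
  end.

Lemma class_C0_continuous k f : class_C0 k f -> forall x, x != 0 -> {for x, continuous f}.
Proof. by case: k => [//|k] []. Qed.

Lemma class_C0W k f : class_C k f -> class_C0 k f.
Proof.
elim: k f => [|k IH] f; first by move=> cf x _; exact: cf.
move=> hf; split; first by move=> x _; exact: (class_C_continuous hf).
move=> i; exists (partiald i f); split; first by move=> x _; exact: class_C_is_derive hf.
by apply: IH; have [_ /(_ i)[]] := hf.
Qed.

Lemma class_C0S k f : class_C0 k.+1 f -> class_C0 k f.
Proof.
elim: k f => [|k IH] f; first by case.
move=> [cf df]; split=> // i; have [g [dg hg]] := df i; exists g; split=> //; exact: IH.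
Qed.

Lemma near_neq0 (x : E) : x != 0 -> \forall y \near x, y != 0.
Proof.
move=> x0; have e0 : 0 < enorm x by rewrite enorm_gt0.
have : \forall y \near x, 0 < enorm y by apply: (cvgr_gt _ (@continuous_enorm R n x)).
by apply: filterS => y; rewrite enorm_gt0.
Qed.

Lemma class_C0_ext k f g : (forall x, x != 0 -> f x = g x) -> class_C0 k f -> class_C0 k g.
Proof.
move=> fg; have nfg (x : E) : x != 0 -> \forall y \near x, f y = g y.
  by move=> x0; apply: filterS (near_neq0 x0) => y /fg.
have cfg (x : E) : x != 0 -> {for x, continuous f} -> {for x, continuous g}.
  move=> x0 cf; have h : g @ x --> f x.
    move=> A nA; have hA : nbhs x (f @^-1` A) := cf A nA.
    by apply: filterS2 (nfg x x0) hA => y /= ->.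
  by rewrite fg in h.
case: k => [|k] hf.
  by move=> x x0; apply: cfg => //; exact: hf.
have [cf df] := hf; split; first by move=> x x0; apply: cfg => //; exact: cf.
move=> i; have [d [d1 d2]] := df i; exists d; split=> // x x0.
exact: (near_eq_is_derive (nfg x x0) (d1 x x0)).
Qed.

Lemma class_C0D k f g : class_C0 k f -> class_C0 k g -> class_C0 k (fun x => f x + g x).
Proof.
elim: k f g => [|k IH] f g hf hg.
  by move=> x x0; apply: continuousD; [exact: hf|exact: hg].
split; first by move=> x x0; apply: continuousD; [exact: (class_C0_continuous hf)|exact: (class_C0_continuous hg)].
move=> i; have [_ /(_ i)[df [df1 df2]]] := hf; have [_ /(_ i)[dg [dg1 dg2]]] := hg.
exists (fun x => df x + dg x); split; last exact: IH.
by move=> x x0; apply: is_deriveDf; [exact: df1|exact: dg1].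
Qed.

Lemma class_C0M k f g : class_C0 k f -> class_C0 k g -> class_C0 k (fun x => f x * g x).
Proof.
elim: k f g => [|k IH] f g hf hg.
  by move=> x x0; apply: continuousM; [exact: hf|exact: hg].
split; first by move=> x x0; apply: continuousM; [exact: (class_C0_continuous hf)|exact: (class_C0_continuous hg)].
move=> i; have [_ /(_ i)[df [df1 df2]]] := hf; have [_ /(_ i)[dg [dg1 dg2]]] := hg.
exists (fun x => df x * g x + f x * dg x); split.
  by move=> x x0; apply: is_deriveMf; [exact: df1|exact: dg1].
by apply: class_C0D; apply: IH => //; exact: class_C0S.
Qed.

Lemma class_C0_sum k (I : Type) (s : seq I) (F : I -> E -> R) :
  (forall i, class_C0 k (F i)) -> class_C0 k (fun x => \sum_(i <- s) F i x).
Proof.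
move=> hF; elim: s => [|i s IH].
  rewrite (_ : (fun _ => _) = fun=> 0); last by apply/funext => x; rewrite big_nil.
  by apply: class_C0W; exact: class_C_cst.
rewrite (_ : (fun _ => _) = fun x => F i x + \sum_(j <- s) F j x); first exact: class_C0D.
by apply/funext => x; rewrite big_cons.
Qed.

Lemma is_derive_enorm x i : x != 0 ->
  is_derive x (delta_mx ord0 i) (@enorm R n) (x ord0 i * (enorm x)^-1).
Proof.
move=> x0; have e0 : 0 < enorm x by rewrite enorm_gt0.
have s0 : 0 < \sum_j x ord0 j ^+ 2 by rewrite -enorm_sqr exprn_gt0.
have hS : is_derive x (delta_mx ord0 i) (fun y : E => \sum_j y ord0 j ^+ 2) (2 * x ord0 i).
  rewrite (_ : (fun y => _) = (fun y : E => \sum_j y ord0 j * y ord0 j)); last first.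
    by apply/funext => y; apply: eq_bigr => j _; rewrite expr2.
  have hc := @class_C_sum R n 1 _ (index_enum 'I_n) (fun j (y : E) => y ord0 j * y ord0 j)
    (fun j => class_CM (class_C_coord _ j) (class_C_coord _ j)).
  have h1 : is_derive x (delta_mx ord0 i) (\sum_(j < n) (fun y : E => y ord0 j * y ord0 j))
     (\sum_(j < n) ((j == i)%:R * x ord0 j + x ord0 j * (j == i)%:R)).
    by apply: is_derive_sum => j; apply: is_deriveMf; exact: is_derive_coord.
  move: h1; rewrite (_ : \sum_(j < n) (fun y : E => _) = (fun y : E => \sum_j y ord0 j * y ord0 j)); last first.
    by apply/funext => y; rewrite fct_sumE.
  move=> h1; apply: (is_derive_eq h1).
  rewrite (bigD1 i)//= big1 ?eqxx; last by move=> j /negbTE ->; rewrite mul0r mulr0 addr0.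
  by rewrite mul1r mulr1 addr0 mulr2n mulrDl mul1r.
have := is_derive_comp1 (is_derive1_sqrt s0) hS.
move=> h; apply: (is_derive_eq h); rewrite -/(enorm x).
by field; rewrite gt_eqF.
Qed.

Lemma is_derive_invenorm x i : x != 0 ->
  is_derive x (delta_mx ord0 i) (fun y : E => (enorm y)^-1)
    (- x ord0 i * ((enorm x)^-1 * ((enorm x)^-1 * (enorm x)^-1))).
Proof.
move=> x0; have e0 : enorm x != 0 by rewrite enorm_eq0.
have h1 : is_derive (enorm x) (1 : R) (fun t : R => t^-1) (- (enorm x)^-1 ^+ 2).
  have := @is_deriveV R id (enorm x) 1 1 e0 (is_derive_id _ _).
  by rewrite [_ *: _]mulr1 exprVn.
apply: (is_derive_eq (is_derive_comp1 h1 (is_derive_enorm i x0))).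
by field.
Qed.

Lemma class_C0_invenorm k : class_C0 k (fun y : E => (enorm y)^-1).
Proof.
have c (x : E) : x != 0 -> {for x, continuous (fun y : E => (enorm y)^-1)}.
  move=> x0; apply: (@continuous_comp _ _ _ (@enorm R n) (fun t : R => t^-1)).
    exact: continuous_enorm.
  by apply: inv_continuous; rewrite enorm_eq0.
elim: k => [|k IH]; first exact: c.
split=> // i; exists (fun x : E => - x ord0 i * ((enorm x)^-1 * ((enorm x)^-1 * (enorm x)^-1))); split.
  by move=> x x0; exact: is_derive_invenorm.
apply: class_C0M; last by do 2 apply: class_C0M => //.
apply: class_C0W; under eq_fun do rewrite -mulN1r.
by apply: class_CZ; exact: class_C_coord.
Qed.

(** The radial function whose profile is the restriction of [f] to the ray through [y]. *)
Definition freeze (T : Type) (f : E -> T) (y : E) : E -> T := fun x => f (enorm x *: y).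

Lemma is_derive_freeze f y x i : class_C 1 f -> x != 0 ->
  is_derive x (delta_mx ord0 i) (freeze f y)
    ((\sum_j y ord0 j * partiald j f (enorm x *: y)) * (x ord0 i * (enorm x)^-1)).
Proof.
move=> hf x0; apply: (@is_derive_comp1 R _ (fun t : R => f (t *: y)) (@enorm R n)).
  have h := class_C1_dir (enorm x *: y) y hf.
  move: h; apply: is_derive_incr => h.
  by rewrite [h *: 1]mulr1 scalerDl.
exact: is_derive_enorm.
Qed.

Lemma continuous_freeze f y : continuous f -> continuous (freeze f y).
Proof.
move=> cf x; apply: (@continuous_comp _ _ _ (fun x : E => enorm x *: y) f); last exact: cf.
by apply: continuousZl; exact: continuous_enorm.
Qed.

(** The partial derivatives are combinations of frozen partial derivatives with the coefficients
    [x_i / |x|], so the induction on [k] closes. *)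
Lemma class_C0_freeze k f y : class_C k f -> class_C0 k (freeze f y).
Proof.
elim: k f => [|k IH] f hf; first by move=> x _; exact: continuous_freeze.
split; first by move=> x _; apply: continuous_freeze; exact: class_C_continuous hf.
have hf1 : class_C 1 f.
  have [cf h] := hf; split=> // i; have [h1 h2] := h i; split=> //; exact: class_C_continuous h2.
move=> i; eexists; split; first by move=> x x0; exact: is_derive_freeze.
apply: class_C0M; last first.
  by apply: class_C0M; [apply: class_C0W; exact: class_C_coord|exact: class_C0_invenorm].
apply: class_C0_sum => j; apply: class_C0M; first by apply: class_C0W; exact: class_C_cst.
by apply: (IH (partiald j f)); have [_ /(_ j)[]] := hf.
Qed.

(** Near the origin the function is locally zero, elsewhere [class_C0] applies. Hence freezing a
    test function does no harm, although [|x|] is singular at 0. *)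
Lemma class_C0_vanishing k f (e : R) : 0 < e -> (forall x, enorm x < e -> f x = 0) ->
  class_C0 k f -> class_C k f.
Proof.
move=> e0.
have nb (x : E) : enorm x < e -> \forall y \near x, enorm y < e.
  by move=> xe; apply: (cvgr_lt _ (@continuous_enorm R n x)).
have cz g : (forall x, enorm x < e -> g x = 0) -> (forall x, x != 0 -> {for x, continuous g}) -> continuous g.
  move=> g0 cg x; have [x0|] := eqVneq x 0; last exact: cg.
  have xe : enorm x < e by rewrite x0 enorm0.
  have h : g @ x --> g x.
    move=> A nA; apply: filterS (nb x xe) => y /g0 /= ->.
    by rewrite -(g0 x xe); exact: nbhs_singleton nA.
  exact: h.
elim: k f => [|k IH] f f0 hf; first by apply: cz.
apply: (@class_CSI _ _ _ _ (fun i => partiald i f)).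
- by apply: cz => //; exact: class_C0_continuous hf.
- move=> i x; have [x0|x0] := eqVneq x 0; last first.
    by have [_ /(_ i)[df [h _]]] := hf; have [h1 _] := h x x0; exact: derivableP.
  have xe : enorm x < e by rewrite x0 enorm0.
  apply: derivableP; apply: (near_eq_derivable _ (@derivable_cst _ _ _ (0 : R) x _)).
  by apply: filterS (nb x xe) => y /f0.
- move=> i; have [_ /(_ i)[df [h hdf]]] := hf.
  have p0 (x : E) : enorm x < e -> partiald i f x = 0.
    move=> xe; rewrite /partiald (@near_eq_derive _ _ _ f (cst 0)); first exact: derive_cst.
    by apply: filterS (nb x xe) => y /f0.
  (* The value of [df] at the origin is arbitrary and has to be corrected to the true derivative
     0. *)
  pose df' (x : E) := if x == 0 then 0 else df x.
  have E' : partiald i f = df'.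
    apply/funext => x; rewrite /df'; case: eqVneq => [->|x0]; first by rewrite p0// enorm0.
    by rewrite /partiald; have [_ ->] := h x x0.
  rewrite E'; apply: IH; first by move=> x xe; rewrite -E' p0.
  by apply: class_C0_ext hdf => x x0; rewrite /df' (negbTE x0).
Qed.

End off_origin.

Section freeze_test.
Context {R : realType} {n : nat}.
Local Notation E := 'rV[R]_n.+1.
Implicit Types (phi : E -> R) (y : E).

Lemma test_fun_freeze phi y : y != 0 -> test_fun phi -> test_fun (freeze phi y).
Proof.
move=> y0 tphi; have [sphi c c0] := tphi.
have [r [s [r0 s0 hK]]] := compact_enorm_bounds c c0.
have ey : 0 < enorm y by rewrite enorm_gt0.
have out (x : E) : ~ annulus (r / enorm y) (s / enorm y) x -> freeze phi y x = 0.
  move=> hx; apply: (@tsupport_out _ _ phi) => kx; have := hK _ kx.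
  rewrite enormZ (ger0_norm (enorm_ge0 x)) => h; apply: hx.
  by rewrite /annulus /= (ler_pdivrMr _ _ ey) (ler_pdivlMr _ _ ey); exact: h.
apply: (@test_funI _ _ _ (annulus (r / enorm y) (s / enorm y))) => //.
- move=> k; apply: (@class_C0_vanishing _ _ _ _ (r / enorm y)); first by rewrite divr_gt0.
    by move=> x hx; apply: out => /andP[h _]; move: hx; rewrite ltNge h.
  exact: class_C0_freeze.
- exact: compact_annulus.
- by rewrite /annulus /= enorm0 leNgt divr_gt0.
Qed.

Lemma grad_freeze phi y x : test_fun phi -> x != 0 ->
  grad (freeze phi y) x = (dotp y (grad phi (enorm x *: y)) / enorm x) *: x.
Proof.
move=> tphi x0; apply/rowP => i; rewrite gradE [RHS]mxE /partiald.
have [_ ->] := is_derive_freeze y i (test_fun_class 1 tphi) x0.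
rewrite mulrAC -mulrA; congr (_ * _).
by apply: eq_bigr => j _; rewrite gradE.
Qed.

End freeze_test.

(** * Integrals along rays and their average *)

Section rays.
Context {R : realType} {n : nat}.
Local Notation E := 'rV[R]_n.+1.
Local Open Scope ereal_scope.
Implicit Types (f : E -> R) (y : E).

(** In polar coordinates this is the area of the unit sphere times the integral of [f (t y) t^n]
    over [t > 0]. As an integral over the whole space it can be handled by dilations alone. *)
Definition ray_int f y : \bar R := \int[leb n.+1]_x (f (enorm x *: y)%R)%:E.

(** The window for [|y|] in the average: with no cut-off the constant in [ray_int_fubini] would be
    the divergent integral of [|x|^(-N)]. *)
Definition ring_weight (t : R) : R := (if (1 <= t <= 2) then 1 else 0)%R.

(* By scaling, [int |x|^-n ring_weight (|z| / |x|) dx] is the same for all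
   [z <> 0]; this is its value at [|z| = 1]. *)
Definition ray_const : \bar R :=
  \int[leb n.+1]_x (enorm (x : E) `^ (- n.+1%:R) * ring_weight (enorm x)^-1)%:E.

Lemma ring_weight_ge0 t : (0 <= ring_weight t)%R.
Proof. by rewrite /ring_weight; case: ifP. Qed.

Lemma measurable_ring_weight : measurable_fun [set: R] ring_weight.
Proof.
rewrite (_ : ring_weight = \1_(`[1%R, 2%R]%classic)); first exact: measurable_indic.
apply/funext => t; rewrite indicE /ring_weight; case: ifPn => h.
  by rewrite mem_set//= in_itv.
by rewrite memNset//= in_itv; move/negP: h.
Qed.

Lemma measurable_ray : measurable_fun [set: E * E] (fun z : E * E => (enorm z.1 *: z.2)%R).
Proof.
apply/measurable_fun_rVP => i.
rewrite (_ : (fun t => _) = (fun z : E * E => enorm z.1 * z.2 ord0 i)%R); last first.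
  by apply/funext => z; rewrite mxE.
apply: measurable_funM.
  by apply: (measurableT_comp (@measurable_enorm R n.+1)).
by apply: (measurableT_comp (@measurable_coord R n.+1 i)).
Qed.

Lemma measurable_freeze d (T : measurableType d) (f : E -> T) y : measurable_fun [set: E] f -> measurable_fun [set: E] (freeze f y).
Proof.
move=> mf; apply: (measurableT_comp mf).
have h : measurable_fun [set: E] ((fun z : E * E => (enorm z.1 *: z.2)%R) \o (fun x : E => (x, y))).
  by apply: (measurableT_comp measurable_ray); exact: measurable_fun_pair.
exact: h.
Qed.

Lemma measurable_ray_int f : measurable_fun [set: E] f -> (forall x, 0 <= f x)%R ->
  measurable_fun [set: E] (ray_int f).
Proof.
move=> mf f0; apply: (@measurable_tonelli_leb _ _ _ (fun y x => (f (enorm x *: y)%R)%:E)) => /=.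
  apply/measurable_EFinP; apply: (measurableT_comp mf).
  have h : measurable_fun [set: E * E] ((fun z : E * E => (enorm z.1 *: z.2)%R) \o (fun z : E * E => (z.2, z.1))).
    by apply: (measurableT_comp measurable_ray); exact: measurable_fun_pair.
  exact: h.
by move=> x y; rewrite lee_fin.
Qed.

Lemma ray_int_ge0 f y : (forall x, 0 <= f x)%R -> 0 <= ray_int f y.
Proof. by move=> f0; apply: integral_ge0 => x _; rewrite lee_fin. Qed.

Lemma measurable_invenorm : measurable_fun [set: E] (fun x : E => (enorm x)^-1)%R.
Proof.
rewrite (_ : (fun x => _) = (fun x : E => enorm x `^ (-1))%R); last first.
  by apply/funext => x; rewrite powR_inv1 ?enorm_ge0.
by apply: (measurableT_comp (@measurable_powR R _)); exact: measurable_enorm.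
Qed.

(** Exchange the integrals, put [z = |x| y] for fixed [x], exchange again, and dilate [x] by [|z|]
    for fixed [z]: what remains in [x] no longer depends on [z]. So averaging ray integrals recovers
    the integral over space. *)
Lemma ray_int_fubini f : measurable_fun [set: E] f -> (forall x, 0 <= f x)%R ->
  \int[leb n.+1]_y ((ring_weight (enorm y))%:E * ray_int f y) =
  ray_const * \int[leb n.+1]_z (f z)%:E.
Proof.
move=> mf f0.
have me := @measurable_enorm R n.+1.
have mw : measurable_fun [set: E] (fun y => ring_weight (enorm y)).
  exact: (measurableT_comp measurable_ring_weight).
have m1 : measurable_fun [set: E * E] (fun z : E * E => (ring_weight (enorm z.2) * f (enorm z.1 *: z.2))%R).
  apply: measurable_funM; first by apply: (measurableT_comp mw).
  by apply: (measurableT_comp mf); exact: measurable_ray.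
have mquot : measurable_fun [set: E * E] (fun z : E * E => ring_weight (enorm z.2 / enorm z.1)%R).
  apply: (measurableT_comp measurable_ring_weight); apply: measurable_funM.
    exact: (measurableT_comp me).
  exact: (measurableT_comp measurable_invenorm).
have mpow t : measurable_fun [set: E] (fun x => enorm x `^ t)%R.
  exact: (measurableT_comp (@measurable_powR R _)).
have m2 : measurable_fun [set: E * E] (fun z : E * E =>
    (enorm z.1 `^ (- n.+1%:R) * (ring_weight (enorm z.2 / enorm z.1) * f z.2))%R).
  apply: measurable_funM; first by apply: (measurableT_comp (mpow _)).
  by apply: measurable_funM => //; exact: (measurableT_comp mf).
transitivity (\int[leb n.+1]_y \int[leb n.+1]_x (ring_weight (enorm y) * f (enorm x *: y)%R)%:E).
  apply: eq_integral => y _; rewrite /ray_int -ge0_integralZl//.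
  - by apply/measurable_EFinP; exact: (@measurable_freeze _ _ f y mf).
  - by move=> x _; rewrite lee_fin.
  - by rewrite lee_fin ring_weight_ge0.
rewrite -(@tonelli_leb _ _ _ (fun x y => (ring_weight (enorm y) * f (enorm x *: y)%R)%:E)); last 2 first.
- exact/measurable_EFinP.
- by move=> x y; rewrite lee_fin mulr_ge0 ?ring_weight_ge0.
transitivity (\int[leb n.+1]_x \int[leb n.+1]_z
   (enorm x `^ (- n.+1%:R) * (ring_weight (enorm z / enorm x) * f z))%:E).
  apply: ge0_ae_eq_integral => //.
  - apply: (@measurable_tonelli_leb _ _ _ (fun x y => (ring_weight (enorm y) * f (enorm x *: y)%R)%:E)).
      exact/measurable_EFinP.
    by move=> x y; rewrite lee_fin mulr_ge0 ?ring_weight_ge0.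
  - apply: (@measurable_tonelli_leb _ _ _ (fun x z => (enorm x `^ (- n.+1%:R) * (ring_weight (enorm z / enorm x) * f z))%:E)).
      exact/measurable_EFinP.
    by move=> x y; rewrite lee_fin !mulr_ge0 ?ring_weight_ge0 ?powR_ge0.
  - by move=> x _; apply: integral_ge0 => y _; rewrite lee_fin mulr_ge0 ?ring_weight_ge0.
  - by move=> x _; apply: integral_ge0 => y _; rewrite lee_fin !mulr_ge0 ?ring_weight_ge0 ?powR_ge0.
  (* The dilation [z = |x| y]; its factor [|x|^N] cancels the power in the integrand. *)
  - apply: ae_origin => x x0 _.
    have e0 : (0 < enorm x)%R by rewrite enorm_gt0.
    have mF : measurable_fun [set: E] (fun z => (ring_weight (enorm z / enorm x) * f z)%:E).
      apply/measurable_EFinP; apply: measurable_funM => //.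
      by apply: (measurableT_comp measurable_ring_weight); exact: measurable_funM.
    have F0 (z : E) : 0 <= (ring_weight (enorm z / enorm x) * f z)%:E.
      by rewrite lee_fin mulr_ge0 ?ring_weight_ge0.
    under [RHS]eq_integral => z _ do rewrite EFinM.
    rewrite (ge0_integralZl _ measurableT mF)//; last by rewrite lee_fin powR_ge0.
    rewrite (integral_leb_scale e0 mF F0) muleA -EFinM powRN powR_mulrn ?enorm_ge0//.
    rewrite mulVf ?mul1e ?expf_neq0 ?gt_eqF//.
    apply: eq_integral => z _; rewrite enormZ ger0_norm ?enorm_ge0// mulrAC divff ?mul1r//.
    by rewrite gt_eqF.
rewrite (@tonelli_leb _ _ _ (fun x z => (enorm x `^ (- n.+1%:R) * (ring_weight (enorm z / enorm x) * f z))%:E)); last 2 first.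
- exact/measurable_EFinP.
- by move=> x y; rewrite lee_fin !mulr_ge0 ?ring_weight_ge0 ?powR_ge0.
have c0 : 0 <= ray_const.
  by apply: integral_ge0 => x _; rewrite lee_fin mulr_ge0 ?powR_ge0 ?ring_weight_ge0.
have mfE : measurable_fun [set: E] (fun z => (f z)%:E) by exact/measurable_EFinP.
rewrite -(ge0_integralZl _ measurableT mfE)//; last by move=> z _; rewrite lee_fin.
apply: ge0_ae_eq_integral => //.
- apply: (@measurable_tonelli_leb _ _ _ (fun z x => (enorm x `^ (- n.+1%:R) * (ring_weight (enorm z / enorm x) * f z))%:E)).
    apply/measurable_EFinP.
    exact: (measurableT_comp m2 (measurable_fun_pair (@measurable_snd _ _ E E) (@measurable_fst _ _ E E))).
  by move=> x y; rewrite lee_fin !mulr_ge0 ?ring_weight_ge0 ?powR_ge0.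
- exact: measurable_funeM.
- by move=> x _; apply: integral_ge0 => y _; rewrite lee_fin !mulr_ge0 ?ring_weight_ge0 ?powR_ge0.
- by move=> z _; rewrite mule_ge0 ?lee_fin.
(* Dilating [x] by [|z|] turns the argument [|z| / |x|] of the window into [1 / |x|], and the powers
   of [|z|] cancel. *)
apply: ae_origin => z z0 _.
have e0 : (0 < enorm z)%R by rewrite enorm_gt0.
have mH : measurable_fun [set: E] (fun x : E => (enorm x `^ (- n.+1%:R) * ring_weight (enorm z / enorm x))%:E).
  apply/measurable_EFinP; apply: measurable_funM => //.
  apply: (measurableT_comp measurable_ring_weight); apply: measurable_funM => //.
  exact: measurable_invenorm.
have H0 (x : E) : 0 <= (enorm x `^ (- n.+1%:R) * ring_weight (enorm z / enorm x))%:E.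
  by rewrite lee_fin mulr_ge0 ?powR_ge0 ?ring_weight_ge0.
under [LHS]eq_integral => x _ do rewrite mulrA EFinM.
rewrite (ge0_integralZr _ measurableT mH)// ?lee_fin//.
congr (_ * _); rewrite (integral_leb_scale e0 mH H0) /ray_const.
have mH' := measurableT_comp mH (@measurable_scale_rV R n.+1 (enorm z)).
rewrite -(ge0_integralZl _ measurableT mH'); last 2 first.
- by move=> x _; exact: H0.
- by rewrite lee_fin exprn_ge0// enorm_ge0.
apply: eq_integral => x _; rewrite /= enormZ ger0_norm ?enorm_ge0// powRM ?enorm_ge0//.
rewrite -EFinM !mulrA powRN powR_mulrn ?enorm_ge0// mulfV ?mul1r ?expf_neq0 ?gt_eqF//.
congr (_ * ring_weight _)%:E; rewrite invfM mulrA divff ?mul1r// gt_eqF//.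
Qed.

Lemma ray_const_ge0 : 0 <= ray_const.
Proof. by apply: integral_ge0 => x _; rewrite lee_fin mulr_ge0 ?powR_ge0 ?ring_weight_ge0. Qed.

(** Brings the constant into the reach of the finiteness and vanishing criteria for [wint]. *)
Lemma ray_constE : ray_const = wint 1 n.+1%:R (fun x : E => ring_weight (enorm x)^-1)%R.
Proof.
apply: eq_integral => x _.
by rewrite mul1r powRr1// ger0_norm ?ring_weight_ge0.
Qed.

Lemma measurable_ring_inv : measurable_fun [set: E] (fun x : E => ring_weight (enorm x)^-1)%R.
Proof. exact: (measurableT_comp measurable_ring_weight measurable_invenorm). Qed.

Lemma ray_const_lty : ray_const < +oo.
Proof.
rewrite ray_constE; apply: (@wint_bounded_lty _ _ _ _ _ (annulus 2^-1 1) 1%R) => //.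
- exact: measurable_ring_inv.
- by move=> x; rewrite /ring_weight; case: ifP; rewrite ?normr1 ?normr0.
- exact: compact_annulus.
- by rewrite /annulus /= enorm0 leNgt invr_gt0 ltr0n.
- move=> x hx; rewrite /ring_weight; case: ifPn => // /andP[h1 h2]; exfalso; apply: hx.
  have e0 : (0 < enorm x)%R.
    rewrite lt_def enorm_ge0 andbT; apply: contraTN h1 => /eqP ->.
    by rewrite invr0 -ltNge.
  rewrite /annulus /=; apply/andP; split.
    by rewrite -[leRHS]invrK lef_pV2 ?posrE ?invr_gt0.
  by rewrite -[leLHS]invrK invf_le1// invr_gt0.
Qed.

Lemma ray_const_gt0 : 0 < ray_const.
Proof.
rewrite lt0e ray_const_ge0 andbT; apply/eqP => h0.
have := @wint_eq0_ae R n 1 n.+1%:R _ ltr01 measurable_ring_inv.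
rewrite -ray_constE => /(_ h0) h.
(* With the first coordinate in [[1/2, 3/4]] and the [n] others at most [e] in absolute value,
   [|x|^2 <= 9/16 + n e^2 <= 9/16 + 1/4]. Hence [1/2 <= |x| <= 1] and the weight is 1 on a box of
   positive measure. *)
pose e : R := (2 * n.+1%:R)^-1%R.
have e0 : (0 < e)%R by rewrite invr_gt0 mulr_gt0.
pose I (i : 'I_n.+1) : set R := if i == ord0 then `[2^-1%R, (3 / 4)%R]%classic else `[(- e)%R, e]%classic.
have mI i : measurable (I i) by rewrite /I; case: ifP.
have pos : 0 < leb n.+1 (rbox I).
  rewrite leb_rbox//; elim/big_ind: _ => // [x y|i _]; first exact: mule_gt0.
  rewrite /I; case: ifP => _; rewrite lebesgue_measure_itv /= lte_fin.
    by rewrite ifT -?EFinB ?lte_fin; lra.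
  by rewrite ifT -?EFinB ?lte_fin; lra.
have sub x : rbox I x -> ring_weight (enorm x)^-1 = 1%R.
  move=> hx; have h1 := hx ord0; rewrite /I eqxx /= in_itv /= in h1.
  have h2 i : i != ord0 -> (x ord0 i ^+ 2 <= e ^+ 2)%R.
    move=> i0; have := hx i; rewrite /I (negbTE i0) /= in_itv /= -ler_norml => hi.
    by rewrite -real_normK ?num_real// ler_pXn2r ?nnegrE// ltW.
  have l1 : (2^-1 <= enorm x)%R.
    by apply: le_trans (coord_le_enorm x ord0); apply: le_trans (ler_norm _); case/andP: h1.
  have l2 : (enorm x ^+ 2 <= 1)%R.
    rewrite enorm_sqr big_ord_recl.
    have : (\sum_(i < n) x ord0 (lift ord0 i) ^+ 2 <= \sum_(i < n) e ^+ 2)%R.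
      by apply: ler_sum => i _; apply: h2.
    rewrite sumr_const card_ord -mulr_natl => h3.
    have h4 : (n%:R * e ^+ 2 <= 4^-1)%R.
      have : (0 <= n%:R :> R)%R by [].
      rewrite /e (_ : n.+1%:R = n%:R + 1)%R ?natr1//; set m := n%:R => m0.
      rewrite exprVn exprMn ler_pdivrMr; first by nra.
      by rewrite mulr_gt0 ?exprn_gt0 ?ltr0n// ltr_wpDl.
    have h5 : (x ord0 ord0 ^+ 2 <= (3 / 4) ^+ 2)%R.
      case/andP: h1 => k1 k2; rewrite ler_pXn2r ?nnegrE ?divr_ge0//.
      by apply: le_trans k1; rewrite invr_ge0.
    by apply: le_trans (lerD h5 (le_trans h3 h4)) _; clear; lra.
  have en : (0 < enorm x)%R by apply: lt_le_trans l1; rewrite invr_gt0.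
  rewrite /ring_weight ifT//; apply/andP; split.
    by rewrite invf_ge1// -(@ler_pXn2r _ 2) ?nnegrE ?expr1n// ltW.
  by rewrite -[leRHS]invrK lef_pV2 ?posrE// invr_gt0.
have : leb n.+1 (rbox I) = 0.
  have [A [mA A0 hA]] := h; apply: (subset_measure0 _ mA) => //; first exact: measurable_rbox.
  by move=> x hx; apply: hA => /= h'; have := sub x hx; rewrite h' => /eqP; rewrite eq_sym oner_eq0.
by move=> E; move: pos; rewrite E ltxx.
Qed.

End rays.

Section ray_ae.
Context {R : realType} {n : nat}.
Local Notation E := 'rV[R]_n.+1.
Local Open Scope ereal_scope.

Lemma nneseries_term_cvg0 (u : nat -> \bar R) : (forall k, 0 <= u k) ->
  \sum_(k <oo) u k < +oo -> u @ \oo --> 0.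
Proof.
move=> u0 su; apply: (@cvge0_squeeze _ _ (fun N => \sum_(N <= k <oo) u k)) => //.
  move=> N; apply: (@le_trans _ _ (\sum_(N <= k < N.+1) u k)).
    by rewrite big_nat1.
  by apply: nneseries_lim_ge => k _ _.
exact: nneseries_tail_cvg.
Qed.

(** Integrating the series of ray integrals over the ring gives a finite value by [ray_int_fubini];
    so the series converges for almost every [y] and its terms tend to 0. Summability is what
    upgrades convergence in mean to convergence along almost every ray. *)
Lemma ray_int_ae (F : nat -> E -> R) : (forall k, measurable_fun [set: E] (F k)) ->
  (forall k x, 0 <= F k x)%R -> \sum_(k <oo) \int[leb n.+1]_x (F k x)%:E < +oo ->
  {ae leb n.+1, forall y : E, annulus 1 2 y -> (fun k => ray_int (F k) y) @ \oo --> 0}.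
Proof.
move=> mF F0 sF.
pose w (y : E) := (ring_weight (enorm y))%:E.
have w0 y : 0 <= w y by rewrite lee_fin ring_weight_ge0.
have mw : measurable_fun [set: E] w.
  by apply/measurable_EFinP; apply: (measurableT_comp measurable_ring_weight); exact: measurable_enorm.
pose u k y := w y * ray_int (F k) y.
have u0 k y : 0 <= u k y by rewrite mule_ge0// ray_int_ge0.
have mu k : measurable_fun [set: E] (u k) by apply: emeasurable_funM => //; exact: measurable_ray_int.
pose G y := \sum_(k <oo) u k y.
have G0 y : 0 <= G y by apply: nneseries_ge0 => k _ _.
have mG : measurable_fun [set: E] G by apply: ge0_emeasurable_sum => // k x _ _.
have iG : (leb n.+1).-integrable [set: E] G.
  apply/integrableP; split => //.
  under eq_integral do rewrite gee0_abs//.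
  rewrite integral_nneseries//.
  under eq_eseriesr => k _ do rewrite ray_int_fubini//.
  have rf : @ray_const R n \is a fin_num by rewrite ge0_fin_numE ?ray_const_ge0// ray_const_lty.
  rewrite -(fineK rf) nneseriesZl; last by move=> k _; apply: integral_ge0 => x _; rewrite lee_fin.
  by rewrite lte_mul_pinfty// lee_fin fine_ge0// ray_const_ge0.
have := integrable_ae measurableT iG; apply: filterS => y /(_ I) Gy /andP[y1 y2].
apply: nneseries_term_cvg0 => [k|]; first exact: ray_int_ge0.
have -> : \sum_(k <oo) ray_int (F k) y = G y.
  apply: eq_eseriesr => k _; rewrite /u /w /ring_weight ifT ?mul1e//.
  by rewrite y1 y2.
by rewrite -ge0_fin_numE.
Qed.

Lemma ray_int_ae_lty (f : E -> R) : measurable_fun [set: E] f -> (forall x, 0 <= f x)%R ->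
  \int[leb n.+1]_x (f x)%:E < +oo ->
  {ae leb n.+1, forall y : E, annulus 1 2 y -> ray_int f y < +oo}.
Proof.
move=> mf f0 fi.
have mJ := measurable_ray_int mf f0.
have mw : measurable_fun [set: E] (fun y => (ring_weight (enorm y))%:E).
  by apply/measurable_EFinP; apply: (measurableT_comp measurable_ring_weight); exact: measurable_enorm.
have iG : (leb n.+1).-integrable [set: E] (fun y => (ring_weight (enorm y))%:E * ray_int f y).
  apply/integrableP; split; first exact: emeasurable_funM.
  under eq_integral do rewrite gee0_abs ?mule_ge0 ?lee_fin ?ring_weight_ge0 ?ray_int_ge0//.
  rewrite ray_int_fubini// lte_mul_pinfty// ?ray_const_ge0//.
  by rewrite ge0_fin_numE ?ray_const_ge0// ray_const_lty.
have := integrable_ae measurableT iG; apply: filterS => y /(_ I) Gy /andP[y1 y2].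
move: Gy; rewrite /ring_weight y1 y2 mul1e ge0_fin_numE//; exact: ray_int_ge0.
Qed.

End ray_ae.

(** * Frozen functions belong to the weighted spaces *)

Section ray_spaces.
Context {R : realType} {n : nat}.
Local Notation E := 'rV[R]_n.+1.
Implicit Types (u v f g : E -> R) (G : E -> E) (y : E).

Definition shell (j : nat) : set E := annulus j.+1%:R^-1 j.+1%:R.

(** If [r <= |x| <= s] on [K], then [|x| y] has norm between [r] and [2 s]. Countably many shells
    thus control all compact sets, with a single null set of exceptional [y]. *)
Lemma compact_shell (K : set E) : compact K -> ~ K 0 -> exists J : nat,
  forall j, (J <= j)%N -> forall x y, K x -> annulus 1 2 y -> shell j (enorm x *: y).
Proof.
move=> cK K0; have [r [s [r0 s0 hK]]] := compact_enorm_bounds cK K0.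
exists (Num.trunc (r^-1 + 2 * s)) => j Jj x y Kx /andP[y1 y2].
have /andP[rx xs] := hK x Kx; have x0 : 0 < enorm x by exact: lt_le_trans rx.
have jb : r^-1 + 2 * s <= j.+1%:R.
  by apply: (le_trans (ltW (truncnS_gt _))); rewrite ler_nat ltnS.
have ri : 0 < r^-1 by rewrite invr_gt0.
rewrite /shell /annulus /= enormZ ger0_norm ?enorm_ge0//; apply/andP; split.
  apply: (@le_trans _ _ r); last by rewrite -[leLHS]mulr1 ler_pM// ltW.
  rewrite -[leRHS]invrK lef_pV2 ?posrE//; apply: le_trans jb; rewrite lerDl; lra.
apply: (@le_trans _ _ (s * 2)); first by rewrite ler_pM ?enorm_ge0.
by rewrite mulrC; apply: le_trans jb; rewrite lerDr ltW.
Qed.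

Lemma measurable_shell j : measurable (shell j).
Proof. by apply: measurable_rV_compact; exact: compact_annulus. Qed.

Lemma shell0 j : ~ shell j 0.
Proof. by rewrite /shell /annulus /= enorm0 leNgt invr_gt0 ltr0n. Qed.

Definition shell_abs j f : E -> R := fun x => \1_(shell j) x * `|f x|.

Lemma measurable_shell_abs j f : measurable_fun [set: E] f -> measurable_fun [set: E] (shell_abs j f).
Proof.
move=> mf; apply: measurable_funM; last exact: measurableT_comp.
by apply: measurable_indic; exact: measurable_shell.
Qed.

Lemma shell_abs_ge0 j f x : 0 <= shell_abs j f x.
Proof. by rewrite mulr_ge0. Qed.

Lemma integral_shell_abs j f : measurable_fun [set: E] f ->
  (\int[leb n.+1]_x (shell_abs j f x)%:E = \int[leb n.+1]_(x in shell j) `|f x|%:E)%E.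
Proof.
move=> mf; rewrite [RHS]integral_mkcond; apply: eq_integral => x _.
by rewrite patchE /shell_abs indicE; case: ifP => _; rewrite ?mul1r ?mul0r.
Qed.

Lemma integral_freeze_le (K : set E) j f y : measurable K -> measurable_fun [set: E] f ->
  (forall x, K x -> shell j (enorm x *: y)) ->
  (\int[leb n.+1]_(x in K) `|freeze f y x|%:E <= ray_int (shell_abs j f) y)%E.
Proof.
move=> mK mf hK; rewrite [leLHS]integral_mkcond; apply: ge0_le_integral => //.
- by move=> x _; rewrite patchE; case: ifP.
- apply/(measurable_restrictT _ _).1 => //; apply/measurable_EFinP/measurable_funTS.
  by apply: measurableT_comp => //; exact: measurable_freeze.
- by apply/measurable_EFinP; exact: (measurable_freeze y (measurable_shell_abs j mf)).
- move=> x _; rewrite patchE; case: ifPn => [|_]; last by rewrite lee_fin shell_abs_ge0.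
  by rewrite inE => Kx; rewrite lee_fin /shell_abs indicE mem_set ?mul1r//; exact: hK.
Qed.

Lemma loc_integrable_freeze f y : annulus 1 2 y -> measurable_fun [set: E] f ->
  (forall j, ray_int (shell_abs j f) y < +oo)%E -> loc_integrable (freeze f y).
Proof.
move=> ay mf hj; split; first exact: measurable_freeze.
move=> K cK K0; have [J hJ] := compact_shell cK K0.
apply: le_lt_trans (hj J); apply: integral_freeze_le => //.
  exact: measurable_rV_compact.
by move=> x Kx; exact: hJ.
Qed.

Lemma loc_integrable_le f g : measurable_fun [set: E] f -> loc_integrable g ->
  (forall x, `|f x| <= `|g x|) -> loc_integrable f.
Proof.
move=> mf [mg hg] fg; split=> // K cK K0; apply: le_lt_trans (hg K cK K0).
have mK := measurable_rV_compact cK; apply: ge0_le_integral => //.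
- by apply/measurable_EFinP/measurable_funTS; exact: measurableT_comp.
- by apply/measurable_EFinP/measurable_funTS; exact: measurableT_comp.
- by move=> x _; rewrite lee_fin.
Qed.

Lemma loc_integrable_sum (I : Type) (s : seq I) (F : I -> E -> R) :
  (forall i, loc_integrable (F i)) -> loc_integrable (fun x => \sum_(i <- s) F i x).
Proof.
move=> hF; elim: s => [|i s IH].
  rewrite (_ : (fun _ => _) = fun=> 0); last by apply/funext => x; rewrite big_nil.
  exact: loc_integrable_cst.
rewrite (_ : (fun _ => _) = fun x => F i x + \sum_(j <- s) F j x); first exact: loc_integrableD.
by apply/funext => x; rewrite big_cons.
Qed.

(* The weak gradient of [freeze v y] when [G] is the one of [v]. *)
Definition ray_grad G y : E -> E := fun x => (dotp y (G (enorm x *: y)) / enorm x) *: x.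

Lemma enorm_radial (c : R) (x : E) : x != 0 -> enorm ((c / enorm x) *: x) = `|c|.
Proof.
move=> x0; rewrite enormZ normrM normfV (ger0_norm (enorm_ge0 x)) divfK//.
by rewrite enorm_eq0.
Qed.

Lemma loc_integrable_ray_grad G y i : annulus 1 2 y -> measurable_fun [set: E] G ->
  (forall k j, ray_int (shell_abs j (fun x => G x ord0 k)) y < +oo)%E ->
  loc_integrable (fun x => ray_grad G y x ord0 i).
Proof.
move=> ay mG hj.
have mGk k : measurable_fun [set: E] (fun x => G x ord0 k).
  by move/measurable_fun_rVP: mG; apply.
have ld : loc_integrable (fun x : E => dotp y (G (enorm x *: y))).
  have h k : loc_integrable (fun x : E => y ord0 k * G (enorm x *: y) ord0 k).
    have lk := loc_integrable_freeze ay (mGk k) (hj k).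
    by apply: (loc_integrableM lk); exact: cst_continuous.
  exact: (loc_integrable_sum (index_enum 'I_n.+1) h).
apply: (loc_integrable_le _ ld).
  under eq_fun do rewrite mxE.
  apply: measurable_funM; last exact: measurable_coord.
  by apply: measurable_funM; [have [] := ld|exact: measurable_invenorm].
move=> x; have [->|x0] := eqVneq x 0; first by rewrite !mxE mulr0 normr0.
by apply: le_trans (coord_le_enorm _ i) _; rewrite enorm_radial.
Qed.

Lemma ray_int_wdens (p s : R) u y : y != 0 -> measurable_fun [set: E] u ->
  (ray_int (fun z => enorm z `^ (- (p * s)) * `|u z| `^ p)%R y =
   (enorm y `^ (- (p * s)))%:E * wint p s (freeze u y))%E.
Proof.
move=> y0 mu; rewrite /wint -ge0_integralZl//.
- apply: eq_integral => x _; rewrite -EFinM; congr EFin.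
  by rewrite enormZ ger0_norm ?enorm_ge0// powRM ?enorm_ge0// mulrA [X in X * _]mulrC.
- by apply: measurable_wintE; exact: measurable_freeze.
- by move=> x _; rewrite lee_fin mulr_ge0 ?powR_ge0.
- by rewrite lee_fin powR_ge0.
Qed.

Lemma wint_freeze (p s : R) u y : y != 0 -> measurable_fun [set: E] u ->
  (wint p s (freeze u y) = ray_int (fun z => enorm z `^ (- (p * s)) * `|u z| `^ p)%R y * (enorm y `^ (p * s))%:E)%E.
Proof.
move=> y0 mu; rewrite ray_int_wdens// muleAC -EFinM -powRD ?enorm_eq0 ?y0 ?implybT//.
by rewrite addNr powRr0 mul1e.
Qed.

Lemma wintZ (p s c : R) u : 0 < p -> measurable_fun [set: E] u ->
  (wint p s (fun x => c * u x)%R = (`|c| `^ p)%:E * wint p s u)%E.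
Proof.
move=> p0 mu; rewrite /wint -ge0_integralZl//.
- apply: eq_integral => x _; rewrite -EFinM; congr EFin.
  by rewrite normrM powRM// mulrCA.
- exact: measurable_wintE.
- by move=> x _; rewrite lee_fin mulr_ge0 ?powR_ge0.
Qed.

Lemma ray_grad_dist phi G y x : test_fun phi -> x != 0 ->
  enorm (ray_grad G y x - grad (freeze phi y) x) <=
  enorm y * enorm (G (enorm x *: y) - grad phi (enorm x *: y)).
Proof.
move=> tphi x0; rewrite grad_freeze// /ray_grad -scalerBl -mulrBl enorm_radial//.
rewrite (_ : _ - _ = dotp y (G (enorm x *: y) - grad phi (enorm x *: y))).
  exact: dotp_le.
by rewrite /dotp -sumrB; apply: eq_bigr => i _; rewrite sub_rVE mulrBr.
Qed.

Local Open Scope ereal_scope.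

Lemma ray_limit (p a b : R) v G (phi psi : nat -> E -> R) y : (1 < p)%R -> annulus 1 2 y ->
  measurable_fun [set: E] v -> measurable_fun [set: E] G ->
  (forall j, test_fun (phi j)) -> (forall j, test_fun (psi j)) ->
  (forall j, ray_int (shell_abs j v) y < +oo) ->
  (forall k j, ray_int (shell_abs j (fun x => G x ord0 k)) y < +oo) ->
  (fun j => ray_int (shell_abs j (fun x => v x - phi j x)%R) y) @ \oo --> 0 ->
  (fun j => ray_int (fun z => enorm z `^ (- (p * b)) * `|enorm (G z - grad (phi j) z)| `^ p)%R y) @ \oo --> 0 ->
  (fun j => ray_int (fun z => enorm z `^ (- (p * a)) * `|v z - psi j z| `^ p)%R y) @ \oo --> 0 ->
  [/\ wHspace p b (freeze v y), wLspace p a (freeze v y) & is_wgrad (freeze v y) (ray_grad G y)].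
Proof.
move=> p1 ay mv mG tphi tpsi jv jG c1 c2 c3.
have p0 : (0 < p)%R by apply: lt_trans p1.
have y0 : y != 0%R.
  by rewrite -enorm_gt0; case/andP: ay => + _; exact: lt_le_trans.
pose q := (p / (p - 1))%R.
have q0 : (0 < q)%R by rewrite divr_gt0// subr_gt0.
have pq : (p^-1 + q^-1 = 1)%R.
  by rewrite /q; field; rewrite subr_eq0 !gt_eqF.
have tpy j : test_fun (freeze (phi j) y) by exact: test_fun_freeze.
have tsy j : test_fun (freeze (psi j) y) by exact: test_fun_freeze.
have lv := loc_integrable_freeze ay mv jv.
have lG i := loc_integrable_ray_grad i ay mG jG.
have lphi j : loc_integrable (freeze (phi j) y).
  by apply: loc_integrable_continuous; exact: test_fun_continuous.
have mphi j := test_fun_measurable (tphi j).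
have mpsi j := test_fun_measurable (tpsi j).
have cK (K : set E) : compact K -> ~ K 0%R ->
    \int[leb n.+1]_(x in K) `|freeze v y x - freeze (phi k) y x|%:E @[k --> \oo] --> 0.
  move=> cK K0; have [J hJ] := compact_shell cK K0.
  have mK := measurable_rV_compact cK.
  have i0 k : 0 <= \int[leb n.+1]_(x in K) `|freeze v y x - freeze (phi k) y x|%:E by exact: integral_ge0.
  apply/(cvge0_leP i0) => e e0.
  (* The hypothesis is diagonal: the same index serves for the shell and for the approximation. From
     [J] on the shell contains the image of [K], so the diagonal suffices. *)
  have /cvge0_leP /(_ e e0) h := c1.
  near=> k; apply: (@le_trans _ _ (ray_int (shell_abs k (fun x => v x - phi k x)%R) y)).
    apply: (@integral_freeze_le K k (fun x => v x - phi k x)%R) => //; first exact: measurable_funB.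
    by move=> x Kx; apply: hJ => //; near: k; exists J.
  by near: k; apply: h => j; apply: ray_int_ge0 => x; exact: shell_abs_ge0.
have mgphi j : measurable_fun [set: E] (grad (phi j)) := measurable_wgradG (is_wgrad_test (tphi j)).
have mU j : measurable_fun [set: E] (fun z => enorm (G z - grad (phi j) z)).
  apply: (measurableT_comp (@measurable_enorm R n.+1)); apply/measurable_fun_rVP => i.
  under eq_fun do rewrite sub_rVE.
  by apply: measurable_funB; [move/measurable_fun_rVP: mG|move/measurable_fun_rVP: (mgphi j)]; apply.
have mrg : measurable_fun [set: E] (ray_grad G y) by exact: measurable_loc_row lG.
have mW j : measurable_fun [set: E] (fun x => enorm (ray_grad G y x - grad (freeze (phi j) y) x)).
  apply: (measurableT_comp (@measurable_enorm R n.+1)); apply/measurable_fun_rVP => i.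
  under eq_fun do rewrite sub_rVE.
  apply: measurable_funB; first by move/measurable_fun_rVP: mrg; apply.
  by move/measurable_fun_rVP: (measurable_wgradG (is_wgrad_test (tpy j))); apply.
have cW : (fun j => wint p b (fun x => enorm (ray_grad G y x - grad (freeze (phi j) y) x))) @ \oo --> 0.
  pose C := (`|enorm y| `^ p)%:E * (enorm y `^ (p * b))%:E.
  apply: (@cvge0_squeeze _ _ (fun j => ray_int (fun z => enorm z `^ (- (p * b)) * `|enorm (G z - grad (phi j) z)| `^ p)%R y * C)).
  - by move=> j; exact: wint_ge0.
  - move=> j; have mf := measurable_freeze y (mU j).
    have mm : measurable_fun [set: E] (fun x => enorm y * freeze (fun z => enorm (G z - grad (phi j) z)) y x)%R.
      exact: measurable_funM.
    rewrite /C muleCA -(wint_freeze p b y0 (mU j)) -(wintZ b _ p0 mf).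
    apply: (wint_le b (mW j) mm p0).
    apply: ae_origin => x x0; rewrite !ger0_norm ?mulr_ge0 ?enorm_ge0//.
    exact: ray_grad_dist.
  - by apply: (cvge0_Ml _ _ c2); [rewrite mule_ge0 ?lee_fin ?powR_ge0|rewrite /C -EFinM ltry].
have cWn : (fun j => wLnorm p b (fun x => enorm (ray_grad G y x - grad (freeze (phi j) y) x))) @ \oo --> 0.
  by apply: (cvge0_poweR _ _ cW); [rewrite invr_gt0|move=> j; exact: wint_ge0].
have wg : is_wgrad (freeze v y) (ray_grad G y).
  apply: (is_wgrad_limit p0 q0 pq lv lG lphi (fun j => is_wgrad_test (tpy j)) cK cWn).
have eH : (fun j => wHnorm p b (freeze v y \- freeze (phi j) y)%R) =
    (fun j => wLnorm p b (fun x => enorm (ray_grad G y x - grad (freeze (phi j) y) x))).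
  by apply/funext => j; apply: wHnormE => //; apply: is_wgradB => //; exact: is_wgrad_test.
have eL : (fun j => wint p a (freeze v y \- freeze (psi j) y)%R) =
    (fun j => ray_int (fun z => enorm z `^ (- (p * a)) * `|v z - psi j z| `^ p)%R y * (enorm y `^ (p * a))%:E).
  apply/funext => j; have mvj : measurable_fun [set: E] (fun z => v z - psi j z)%R by exact: measurable_funB.
  exact: (wint_freeze p a y0 mvj).
have cL : (fun j => wint p a (freeze v y \- freeze (psi j) y)%R) @ \oo --> 0.
  by rewrite eL; apply: (cvge0_Ml _ _ c3); [rewrite lee_fin powR_ge0|rewrite ltry].
split; last exact: wg.
- split; first by split; [exact: lv|exists (ray_grad G y); exact: wg].
  by exists (fun j => freeze (phi j) y); split; [exact: tpy|exact: cK|rewrite eH; exact: cWn].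
- split; first exact: measurable_freeze.
  exists (fun j => freeze (psi j) y); split; first exact: tsy.
  by apply: (cvge0_poweR _ _ cL); [rewrite invr_gt0|move=> j; exact: wint_ge0].
Unshelve. all: by end_near. Qed.

End ray_spaces.

Section ray_spaces_ae.
Context {R : realType} {n : nat}.
Local Notation E := 'rV[R]_n.+1.
Implicit Types (u v f g : E -> R) (G : E -> E) (y : E).
Local Open Scope ereal_scope.

(** For each [j] pick an index at which the error is at most [2^-(j+1)]. *)
Lemma summable_choice (u : nat -> nat -> \bar R) : (forall j k, 0 <= u j k) ->
  (forall j, u j @ \oo --> 0) ->
  exists k : nat -> nat, \sum_(j <oo) u j (k j) < +oo.
Proof.
move=> u0 cu.
have e0 j : (0 < 1 / (2 ^ j.+1)%:R :> R)%R by rewrite divr_gt0// ltr0n expn_gt0.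
have /choice[k hk] j : exists k, u j k <= (1 / (2 ^ j.+1)%:R)%:E.
  have /(cvge0_leP (u0 j)) /(_ _ (e0 j)) [K _ hK] := cu j.
  by exists K; apply: hK => /=.
exists k; apply: (@le_lt_trans _ _ 1%:E); last by rewrite ltry.
apply: (le_trans _ (epsilon_trick0 xpredT ler01)).
by apply: lee_nneseries => j _.
Qed.

Lemma wHspace_grad_cvg (p b : R) v (phi : nat -> E -> R) : (0 < p)%R -> loc_integrable v ->
  is_wgrad v (wgrad v) -> (forall k, test_fun (phi k)) ->
  wHnorm p b (v \- phi k)%R @[k --> \oo] --> 0 ->
  (fun k => wint p b (fun x => enorm (wgrad v x - grad (phi k) x))) @ \oo --> 0.
Proof.
move=> p0 lv wg tphi c.
have e k : wHnorm p b (v \- phi k)%R = wLnorm p b (fun x => enorm (wgrad v x - grad (phi k) x)).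
  apply: wHnormE => //; apply: is_wgradB => //; last exact: is_wgrad_test.
  by apply: loc_integrable_continuous; exact: test_fun_continuous.
have -> : (fun k => wint p b (fun x => enorm (wgrad v x - grad (phi k) x))) =
    (fun k => wHnorm p b (v \- phi k)%R `^ p).
  by apply/funext => k; rewrite e wLnorm_pow.
by apply: (cvge0_poweR p0 _ c) => k; exact: wLnorm_ge0.
Qed.

Lemma wLspace_cvg (p a : R) v (phi : nat -> E -> R) : (0 < p)%R ->
  wLnorm p a (v \- phi k)%R @[k --> \oo] --> 0 ->
  (fun k => wint p a (v \- phi k)%R) @ \oo --> 0.
Proof.
move=> p0 c.
have -> : (fun k => wint p a (v \- phi k)%R) = (fun k => wLnorm p a (v \- phi k)%R `^ p).
  by apply/funext => k; rewrite wLnorm_pow.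
by apply: (cvge0_poweR p0 _ c) => k; exact: wLnorm_ge0.
Qed.

Lemma shell_abs_lty j f : loc_integrable f -> \int[leb n.+1]_x (shell_abs j f x)%:E < +oo.
Proof.
move=> [mf hf]; rewrite integral_shell_abs//; apply: hf; last exact: shell0.
exact: compact_annulus.
Qed.

(** The approximating sequences of [v] are thinned until their errors are summable; [ray_int_ae]
    then gives convergence along almost every ray, and [ray_limit] concludes there. *)
Lemma ray_spaces (p a b : R) v : (1 < p)%R -> wHspace p b v -> wLspace p a v ->
  {ae leb n.+1, forall y : E, annulus 1 2 y ->
    [/\ wHspace p b (freeze v y), wLspace p a (freeze v y) &
        is_wgrad (freeze v y) (ray_grad (wgrad v) y)]}.
Proof.
move=> p1 [[lv [G0 /wgradP wg]] [phi [tphi cK cH]]] [mv [psi [tpsi cL]]].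
have p0 : (0 < p)%R by apply: lt_trans p1.
have mG := measurable_wgradG wg; have [lG _] := wg.
have cH' := wHspace_grad_cvg p0 lv wg tphi cH.
have cL' := wLspace_cvg p0 cL.
have mphi k := test_fun_measurable (tphi k).
have mpsi k := test_fun_measurable (tpsi k).
have mvphi k : measurable_fun [set: E] (fun x => v x - phi k x)%R by exact: measurable_funB.
have mvpsi k : measurable_fun [set: E] (fun x => v x - psi k x)%R by exact: measurable_funB.
have mU k : measurable_fun [set: E] (fun z => enorm (wgrad v z - grad (phi k) z)).
  apply: (measurableT_comp (@measurable_enorm R n.+1)); apply/measurable_fun_rVP => i.
  under eq_fun do rewrite sub_rVE.
  apply: measurable_funB; first by move/measurable_fun_rVP: mG; apply.
  by move/measurable_fun_rVP: (measurable_wgradG (is_wgrad_test (tphi k))); apply.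
pose s1 j k := \int[leb n.+1]_x (shell_abs j (fun x => v x - phi k x)%R x)%:E.
pose s2 k := wint p b (fun x => enorm (wgrad v x - grad (phi k) x)).
have s10 j k : 0 <= s1 j k by apply: integral_ge0 => x _; rewrite lee_fin shell_abs_ge0.
have s20 k : 0 <= s2 k by exact: wint_ge0.
(* The local L^1 error on the [j]-th shell and the gradient error belong to the same approximations,
   so one choice of indices has to make both summable. *)
have [k hk] : exists k : nat -> nat, \sum_(j <oo) (s1 j (k j) + s2 (k j)) < +oo.
  apply: (@summable_choice (fun j k => s1 j k + s2 k)) => [j k|j]; first exact: adde_ge0.
  have e1 : s1 j = fun k => \int[leb n.+1]_(x in shell j) `|v x - phi k x|%:E.
    by apply/funext => k; exact: integral_shell_abs.
  have c1 : s1 j @ \oo --> 0 by rewrite e1; apply: cK; [exact: compact_annulus|exact: shell0].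
  have d0 : (0 : \bar R) +? 0 by [].
  by have := cvgeD d0 c1 cH'; rewrite (adde0 0); exact.
(* Membership in [wLspace] comes with its own approximations, hence with a separate choice. *)
have [l hl] : exists l : nat -> nat, \sum_(j <oo) wint p a (v \- psi (l j))%R < +oo.
  apply: (@summable_choice (fun _ i => wint p a (v \- psi i)%R)) => [_ i|_]; first exact: wint_ge0.
  exact: cL'.
have f1 : {ae leb n.+1, forall y : E, annulus 1 2 y ->
    (fun j => ray_int (shell_abs j (fun x => v x - phi (k j) x)%R) y) @ \oo --> 0}.
  apply: ray_int_ae => [j|j x|]; [exact: measurable_shell_abs|exact: shell_abs_ge0|].
  by apply: le_lt_trans hk; apply: lee_nneseries => [j _ _|j _]; [exact: s10|exact: leeDl].
have f2 : {ae leb n.+1, forall y : E, annulus 1 2 y ->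
    (fun j => ray_int (fun z => enorm z `^ (- (p * b)) * `|enorm (wgrad v z - grad (phi (k j)) z)| `^ p)%R y) @ \oo --> 0}.
  apply: ray_int_ae => [j|j x|]; [exact: measurable_wint|by rewrite mulr_ge0 ?powR_ge0|].
  by apply: le_lt_trans hk; apply: lee_nneseries => [j _ _|j _]; [exact: wint_ge0|exact: leeDr].
have f3 : {ae leb n.+1, forall y : E, annulus 1 2 y ->
    (fun j => ray_int (fun z => enorm z `^ (- (p * a)) * `|v z - psi (l j) z| `^ p)%R y) @ \oo --> 0}.
  by apply: ray_int_ae => [j|j x|]; [exact: measurable_wint|rewrite mulr_ge0 ?powR_ge0|exact: hl].
have f4 : {ae leb n.+1, forall y : E, forall j, annulus 1 2 y -> ray_int (shell_abs j v) y < +oo}.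
  apply/ae_foralln => j; apply: ray_int_ae_lty; [exact: measurable_shell_abs|exact: shell_abs_ge0|].
  exact: shell_abs_lty.
have f5 : {ae leb n.+1, forall y : E, forall i j, annulus 1 2 y ->
    ray_int (shell_abs j (fun x => wgrad v x ord0 i)) y < +oo}.
  apply: filter_forall => i; apply/ae_foralln => j.
  apply: ray_int_ae_lty; [|exact: shell_abs_ge0|exact: shell_abs_lty].
  by apply: measurable_shell_abs; have [] := lG i.
have f45 : {ae leb n.+1, forall y : E, annulus 1 2 y ->
    (forall j, ray_int (shell_abs j v) y < +oo) /\
    (forall i j, ray_int (shell_abs j (fun x => wgrad v x ord0 i)) y < +oo)}.
  by apply: (filterS2 _ _ f4 f5) => y h4 h5 ay; split=> [j|i j]; [exact: h4|exact: h5].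
have f12 : {ae leb n.+1, forall y : E, annulus 1 2 y ->
    (fun j => ray_int (shell_abs j (fun x => v x - phi (k j) x)%R) y) @ \oo --> 0 /\
    (fun j => ray_int (fun z => enorm z `^ (- (p * b)) * `|enorm (wgrad v z - grad (phi (k j)) z)| `^ p)%R y) @ \oo --> 0}.
  by apply: (filterS2 _ _ f1 f2) => y h1 h2 ay; split; [exact: h1|exact: h2].
apply: (filterS3 _ _ f12 f45 f3) => y h12 h45 h3 ay.
have [[h1 h2] [h4 h5]] := (h12 ay, h45 ay).
exact: (ray_limit p1 ay mv mG (fun j => tphi (k j)) (fun j => tpsi (l j)) h4 h5 h1 h2 (h3 ay)).
Qed.

End ray_spaces_ae.

(** * Gradients of minimizers are radial *)

Section ckn_best_theory.
Context {R : realType} {n : nat}.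
Local Notation E := 'rV[R]_n.+1.
Implicit Types (u v f g : E -> R) (G : E -> E) (y : E) (p a b s : R).

Lemma leb_open_gt0 (U : set E) x : open U -> U x -> (0 < leb n.+1 U)%E.
Proof.
move=> oU Ux; have := Ux; rewrite {1}(open_bigcup_obox oU) => -[[q r] /= qrU].
set c := map_mx _ q; set d := map_mx _ r; rewrite -/c -/d in qrU => xcd.
apply: (@lt_le_trans _ _ (leb n.+1 (obox c d))); last first.
  apply: le_measure; rewrite ?inE//; [exact: measurable_obox|exact: measurable_rV_open].
rewrite (_ : obox c d = rbox (fun i => `]c ord0 i, d ord0 i[%classic)); last first.
  by apply/seteqP; split=> z hz i; have := hz i; rewrite /= in_itv.
rewrite leb_rbox//; elim/big_ind: _ => //; first by move=> s t; exact: mule_gt0.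
move=> i _; have /andP[ci di] := xcd i; rewrite lebesgue_measure_itv/= lte_fin.
by rewrite (lt_trans ci di) -EFinB lte_fin subr_gt0 (lt_trans ci di).
Qed.

Lemma continuous_ae_zero u : continuous u -> ae_zero u -> forall x, u x = 0.
Proof.
move=> cu [N [mN N0 hN]] x; apply: contrapT => /eqP ux.
have oU : open [set z | u z != 0].
  apply: (@open_comp _ _ u [set r | r != 0]); first by move=> z _; exact: cu.
  exact: open_neq.
have := leb_open_gt0 oU ux.
rewrite ltNge => /negP; apply; rewrite -N0; apply: le_measure; rewrite ?inE//.
  exact: measurable_rV_open.
by move=> z /= uz; apply: hN => /= /eqP; apply/negP.
Qed.

Local Open Scope ereal_scope.

Lemma wLspace_test p a u : (0 < p)%R -> test_fun u -> wLspace p a u.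
Proof.
move=> p0 tu; split; first exact: test_fun_measurable.
exists (fun=> u); split=> //.
have -> : (fun _ : nat => wLnorm p a (u \- u)%R) = cst 0; last exact: cvg_cst.
apply/funext => k; rewrite /wLnorm (_ : \int[_]_x _ = 0) ?poweR0r ?invr_eq0 ?gt_eqF//.
by apply: integral0_eq => x _; rewrite /= subrr normr0 powR0 ?gt_eqF// mulr0.
Qed.

Lemma wHspace_test p b u : (0 < p)%R -> test_fun u -> wHspace p b u.
Proof.
move=> p0 tu; have lu : loc_integrable u.
  by apply: loc_integrable_continuous; exact: test_fun_continuous.
have gu := is_wgrad_test tu.
split; first by split=> //; exists (grad u).
exists (fun=> u); split=> [//|K _ _|].
  have -> : (fun _ : nat => \int[leb n.+1]_(x in K) `|u x - u x|%:E) = cst 0; last exact: cvg_cst.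
  by apply/funext => k; apply: integral0_eq => x _; rewrite subrr normr0.
have -> : (fun _ : nat => wHnorm p b (u \- u)%R) = cst 0; last exact: cvg_cst.
apply/funext => k; rewrite (wHnormE b p0 (is_wgradB lu lu gu gu)).
rewrite /wLnorm (_ : \int[_]_x _ = 0) ?poweR0r ?invr_eq0 ?gt_eqF//.
by apply: integral0_eq => x _; rewrite subrr enorm0 normr0 powR0 ?gt_eqF// mulr0.
Qed.

Lemma wint_lty_near p s u v : (0 < p)%R -> measurable_fun [set: E] u -> measurable_fun [set: E] v ->
  wint p s (u \- v)%R < +oo -> wint p s v < +oo -> wint p s u < +oo.
Proof.
move=> p0 mu mv h1 h2.
have e : wint p s u = wint p s (fun x => (u \- v) x + v x)%R.
  by congr (wint p s); apply/funext => x /=; rewrite subrK.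
have md : measurable_fun [set: E] (u \- v)%R by exact: measurable_funB.
rewrite e; apply: le_lt_trans (wintD_le s md mv p0) _.
apply: lte_mul_pinfty; [by rewrite lee_fin powR_ge0|by []|exact: (lte_add_pinfty h1 h2)].
Qed.

Lemma wLspace_lty p a u : (0 < p)%R -> wLspace p a u -> wint p a u < +oo.
Proof.
move=> p0 [mu [phi [tphi c]]].
have [K _ hK] := (cvge0_leP (fun k => wint_ge0 p a (u \- phi k)%R)).1 (wLspace_cvg p0 c) 1%R ltr01.
apply: (@wint_lty_near _ _ _ (phi K)) => //; first exact: test_fun_measurable.
  by apply: le_lt_trans (hK K _) _ => //=; rewrite ltry.
exact: wint_test_lty.
Qed.

Lemma wHspace_lty p b u : (0 < p)%R -> wHspace p b u ->
  wint p b (fun x => enorm (wgrad u x)) < +oo.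
Proof.
move=> p0 [[lu [G0 /wgradP wg]] [phi [tphi _ c]]].
have c' := wHspace_grad_cvg p0 lu wg tphi c.
have [K _ hK] := (cvge0_leP (fun k => wint_ge0 p b (fun x => enorm (wgrad u x - grad (phi k) x)))).1 c' 1%R ltr01.
have mG := measurable_enormG wg; have mP := measurable_enormG (is_wgrad_test (tphi K)).
have lphi : loc_integrable (phi K) by apply: loc_integrable_continuous; exact: test_fun_continuous.
have mD := measurable_enormG (is_wgradB lu lphi wg (is_wgrad_test (tphi K))).
have mS : measurable_fun [set: E] (fun x => enorm (wgrad u x - grad (phi K) x) + enorm (grad (phi K) x))%R.
  exact: measurable_funD.
apply: (@le_lt_trans _ _ (wint p b (fun x => enorm (wgrad u x - grad (phi K) x) + enorm (grad (phi K) x))%R)).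
  apply: wint_le => //; apply: aeW => x; rewrite !ger0_norm ?addr_ge0 ?enorm_ge0//.
  by apply: le_trans (enormD _ _); rewrite subrK.
apply: le_lt_trans (wintD_le b mD mP p0) _.
rewrite lte_mul_pinfty ?lee_fin ?powR_ge0// lte_add_pinfty//.
  by apply: le_lt_trans (hK K _) _ => //=; rewrite ltry.
have [_ cK K0] := tphi K; have [B hB] : exists B, forall x, (`|enorm (grad (phi K) x)| <= B)%R.
  have cg : continuous (fun x => enorm (grad (phi K) x)).
    move=> x; apply: (@continuous_comp _ _ _ (grad (phi K)) (@enorm R n.+1)); last exact: continuous_enorm.
    apply: continuous_rV => i; under eq_fun do rewrite gradE.
    by apply: test_fun_continuous; exact: test_fun_partiald.
  have [B [B0 hB]] := continuous_compact_bounded cg cK; exists B => x.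
  have [|hx] := pselect (tsupport (phi K) x); first exact: hB.
  rewrite (_ : grad (phi K) x = 0%R) ?enorm0 ?normr0//.
  by apply/rowP => i; rewrite gradE partiald_out// mxE.
apply: (wint_bounded_lty b p0 mP hB cK K0) => x hx.
rewrite (_ : grad (phi K) x = 0%R) ?enorm0//.
by apply/rowP => i; rewrite gradE partiald_out// mxE.
Qed.

End ckn_best_theory.

(** * The best constant and its inequality *)

Section ckn_best_inequality.
Context {R : realType} {n : nat}.
Local Notation E := 'rV[R]_n.+1.
Implicit Types (u v : E -> R) (p a b : R).
Local Open Scope ereal_scope.

Let ckn_set p a b := [set S : R | forall u : E -> R, wHspace p b u -> wLspace p a u ->
                     S%:E * ckn_rhs p a b u <= ckn_lhs p a b u].

Lemma ckn_rhsE p a b u : (0 < p)%R -> ckn_rhs p a b u = wint p (ckn_c p a b) u.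
Proof. by move=> p0; rewrite /ckn_rhs wLnorm_pow. Qed.

Lemma ckn_rhs_ge0 p a b u : 0 <= ckn_rhs p a b u.
Proof. exact: poweR_ge0. Qed.

Lemma ckn_lhs_ge0 p a b u : 0 <= ckn_lhs p a b u.
Proof. by rewrite mule_ge0 ?poweR_ge0// wLnorm_ge0. Qed.

Lemma ckn_lhs_lty p a b u : (0 < p)%R -> wHspace p b u -> wLspace p a u -> ckn_lhs p a b u < +oo.
Proof.
move=> p0 hu lu; apply: lte_mul_pinfty; first exact: wLnorm_ge0.
  rewrite ge0_fin_numE ?wLnorm_ge0//; apply: wLnorm_lty; exact: wHspace_lty.
by rewrite poweR_lty// wLnorm_lty// wLspace_lty.
Qed.

Lemma ckn_rhs_gt0 p a b u : (0 < p)%R -> measurable_fun [set: E] u -> ~ ae_zero u ->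
  0 < ckn_rhs p a b u.
Proof.
move=> p0 mu nu; rewrite lt0e ckn_rhs_ge0 andbT ckn_rhsE//; apply/eqP => h; apply: nu.
exact: wint_eq0_ae h.
Qed.

(** A bump on the unit cube centred at the first basis vector, away from the origin. It bounds the
    admissible constants from above and is the seed of the unstable family. *)
Definition e0_bump : E -> R :=
  bump 0 (\row_i ((i == ord0)%:R - 2^-1))%R (\row_i ((i == ord0)%:R + 2^-1))%R.

Lemma e0_bump_gt0 : (0 < e0_bump (delta_mx ord0 ord0))%R.
Proof.
apply: bump_gt0 => i; rewrite !mxE eqxx /= eq_sym; case: (i == ord0); rewrite /=; lra.
Qed.

Lemma test_fun_e0_bump : test_fun e0_bump.
Proof.
by apply: test_fun_bump => /(_ ord0); rewrite !mxE eqxx /=; lra.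
Qed.

Lemma e0_bump_not_ae_zero : ~ ae_zero e0_bump.
Proof.
move=> h; have := e0_bump_gt0.
by rewrite (continuous_ae_zero (test_fun_continuous test_fun_e0_bump) h) ltxx.
Qed.

Lemma ckn_set0 p a b : ckn_set p a b 0%R.
Proof. by move=> u _ _; rewrite mul0e ckn_lhs_ge0. Qed.

(** One nonzero test function bounds all admissible constants, so that [ckn_best] is a true supremum
    and not a default value. *)
Lemma ckn_set_has_sup p a b : (0 < p)%R -> has_sup (ckn_set p a b).
Proof.
move=> p0; split; first by exists 0%R; exact: ckn_set0.
have tu := test_fun_e0_bump.
have [hu lu] := (wHspace_test b p0 tu, wLspace_test a p0 tu).
have l0 := ckn_lhs_ge0 p a b e0_bump; have ly := ckn_lhs_lty p0 hu lu.
have r0 := ckn_rhs_gt0 a b p0 (test_fun_measurable tu) e0_bump_not_ae_zero.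
have ry : ckn_rhs p a b e0_bump < +oo by rewrite ckn_rhsE// wint_test_lty.
exists (fine (ckn_lhs p a b e0_bump) / fine (ckn_rhs p a b e0_bump))%R => S /(_ _ hu lu).
have fr : ckn_rhs p a b e0_bump \is a fin_num by rewrite ge0_fin_numE// ltW.
have fl : ckn_lhs p a b e0_bump \is a fin_num by rewrite ge0_fin_numE.
move=> h; rewrite ler_pdivlMr ?fine_gt0 ?r0//.
by rewrite -lee_fin EFinM !fineK.
Qed.

Lemma ckn_best_ge0 p a b : (0 < p)%R -> (0 <= ckn_best (n := n.+1) p a b)%R.
Proof.
by move=> p0; apply: (sup_upper_bound (ckn_set_has_sup a b p0)); exact: ckn_set0.
Qed.

Lemma ckn_best_le p a b u : (0 < p)%R -> wHspace p b u -> wLspace p a u ->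
  (ckn_best (n := n.+1) p a b)%:E * ckn_rhs p a b u <= ckn_lhs p a b u.
Proof.
move=> p0 hu lu; have h0 : ckn_set p a b 0%R by exact: ckn_set0.
have ly := ckn_lhs_lty p0 hu lu; have l0 := ckn_lhs_ge0 p a b u.
have fl : ckn_lhs p a b u \is a fin_num by rewrite ge0_fin_numE.
have ub (S : R) : ckn_set p a b S -> S%:E * ckn_rhs p a b u <= ckn_lhs p a b u by apply.
have r0 := ckn_rhs_ge0 p a b u; move: (ckn_rhs p a b u) r0 ub => [t| |] //; last first.
  move=> _ ub; rewrite [ckn_best _ _ _](_ : _ = 0%R) ?mul0e//.
  apply/eqP; rewrite eq_le ckn_best_ge0// andbT.
  apply: ge_sup; first by exists 0%R.
  move=> S /ub; case: (ltP 0%R S) => // S0; rewrite gt0_muley ?lte_fin// leye_eq => /eqP e.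
  by move: ly; rewrite e ltxx.
rewrite lee_fin => t0 ub; rewrite -(fineK fl) -EFinM lee_fin.
have [->|tn] := eqVneq t 0%R; first by rewrite mulr0 fine_ge0.
have tp : (0 < t)%R by rewrite lt_neqAle eq_sym tn.
rewrite -ler_pdivlMr//; apply: ge_sup; first by exists 0%R.
by move=> S /ub; rewrite -(fineK fl) -EFinM lee_fin ler_pdivlMr.
Qed.

End ckn_best_inequality.

Section minimizers_radial.
Context {R : realType} {n : nat}.
Local Notation E := 'rV[R]_n.+1.
Implicit Types (u v f g : E -> R) (G : E -> E) (y : E) (p a b s : R).

(** Young's inequality with exponents [p] and [p / (p - 1)], after multiplying one factor and
    dividing the other by [k = r^((p-1)/p)]. Equality holds at [y = r^p x]. *)
Lemma young_ratio p (r x y : R) : 1 < p -> 0 < r -> 0 <= x -> 0 <= y ->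
  x `^ p^-1 * y `^ (p^-1 * (p - 1)) <= r `^ (p - 1) / p * x + (p - 1) / p / r * y.
Proof.
move=> p1 r0 x0 y0; have p0 : 0 < p by apply: lt_trans p1.
have pn0 : p != 0 by rewrite gt_eqF.
have p10 : 0 < p - 1 by rewrite subr_gt0.
have p1n : p - 1 != 0 by rewrite gt_eqF.
pose q := p / (p - 1); have q0 : 0 < q by rewrite divr_gt0.
have pq : p^-1 + q^-1 = 1 by rewrite /q; field; rewrite ?pn0 ?p1n.
pose k := r `^ (p^-1 * (p - 1)); have k0 : 0 < k by exact: powR_gt0.
have := @conjugate_powR _ (x `^ p^-1 * k) (y `^ (p^-1 * (p - 1)) / k) p q
  (mulr_ge0 (powR_ge0 _ _) (ltW k0)) (divr_ge0 (powR_ge0 _ _) (ltW k0)) p0 q0 pq.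
rewrite (_ : x `^ p^-1 * k * (y `^ (p^-1 * (p - 1)) / k) = x `^ p^-1 * y `^ (p^-1 * (p - 1))); last first.
  by field; rewrite gt_eqF.
move=> h; apply: le_trans h _; rewrite le_eqVlt; apply/orP; left; apply/eqP; congr (_ + _).
  rewrite powRM ?powR_ge0// -powRrM mulVf// powRr1// /k -powRrM.
  by rewrite (_ : p^-1 * (p - 1) * p = p - 1); field.
rewrite powRM ?powR_ge0 ?invr_ge0 ?powR_ge0// -powRrM.
have -> : p^-1 * (p - 1) * q = 1 by rewrite /q; field; rewrite ?pn0 ?p1n.
rewrite powRr1// /k -powR_inv1 ?powR_ge0// -!powRrM.
have -> : p^-1 * (p - 1) * (-1 * q) = -1 by rewrite /q; field; rewrite ?pn0 ?p1n.
by rewrite powR_inv1 ?ltW// /q; field; rewrite ?pn0 ?p1n ?(gt_eqF r0).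
Qed.

Lemma measurable_dotp (F G : E -> E) : measurable_fun [set: E] F -> measurable_fun [set: E] G ->
  measurable_fun [set: E] (fun x => dotp (F x) (G x)).
Proof.
move=> /measurable_fun_rVP mF /measurable_fun_rVP mG.
by apply: measurable_sum => i; apply: measurable_funM; [exact: mF|exact: mG].
Qed.

Local Open Scope ereal_scope.

Lemma young_ratio_ereal p (r : R) (x y : \bar R) : (1 < p)%R -> (0 < r)%R -> 0 <= x -> 0 <= y ->
  x `^ p^-1 * y `^ (p^-1 * (p - 1)) <=
  (r `^ (p - 1) / p)%:E * x + ((p - 1) / p / r)%:E * y.
Proof.
move=> p1 r0 x0 y0; have p0 : (0 < p)%R by apply: lt_trans p1.
have c1 : (0 < r `^ (p - 1) / p)%R by rewrite divr_gt0// powR_gt0.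
have c2 : (0 < (p - 1) / p / r)%R by rewrite !divr_gt0// subr_gt0.
case: x x0 => [x| |]// x0; last first.
  rewrite gt0_muley ?lte_fin// addye ?leey// gt_eqF//.
  by apply: lt_le_trans (mule_ge0 _ y0); rewrite ?ltNyr// lee_fin ltW.
case: y y0 => [y| |]// y0; last by rewrite gt0_muley ?lte_fin// addey ?leey// -EFinM.
rewrite !poweR_EFin -!EFinM -EFinD lee_fin; exact: young_ratio.
Qed.

Lemma integral_lin (r s : R) f g : (0 <= r)%R -> (0 <= s)%R ->
  measurable_fun [set: E] f -> measurable_fun [set: E] g ->
  (forall x, 0 <= f x)%R -> (forall x, 0 <= g x)%R ->
  \int[leb n.+1]_x (r * f x + s * g x)%:E =
  r%:E * \int[leb n.+1]_x (f x)%:E + s%:E * \int[leb n.+1]_x (g x)%:E.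
Proof.
move=> r0 s0 mf mg f0 g0.
have mF (t : R) (h : E -> R) : measurable_fun [set: E] h -> measurable_fun [set: E] (fun x => t%:E * (h x)%:E).
  by move=> mh; apply: measurable_funeM; exact/measurable_EFinP.
under eq_integral do rewrite EFinD !EFinM.
rewrite ge0_integralD//; [|by move=> x _; rewrite mule_ge0 ?lee_fin|exact: mF|by move=> x _; rewrite mule_ge0 ?lee_fin|exact: mF].
by rewrite !ge0_integralZl//; [exact/measurable_EFinP|move=> x _; rewrite lee_fin|exact/measurable_EFinP|move=> x _; rewrite lee_fin].
Qed.

Lemma integral_le_eq_ae f g : measurable_fun [set: E] f -> measurable_fun [set: E] g ->
  (forall x, 0 <= f x <= g x)%R -> \int[leb n.+1]_x (g x)%:E < +oo ->
  \int[leb n.+1]_x (g x)%:E <= \int[leb n.+1]_x (f x)%:E ->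
  {ae leb n.+1, forall x, f x = g x}.
Proof.
move=> mf mg fg gi gf.
have f0 x : (0 <= f x)%R by case/andP: (fg x).
have d0 x : (0 <= g x - f x)%R by rewrite subr_ge0; case/andP: (fg x).
have md : measurable_fun [set: E] (fun x => g x - f x)%R by exact: measurable_funB.
have h := integral_lin ler01 ler01 mf md f0 d0.
move: h; under eq_integral do rewrite !mul1r addrC subrK.
rewrite !mul1e => h.
have F0 : 0 <= \int[leb n.+1]_x (f x)%:E by apply: integral_ge0 => x _; rewrite lee_fin.
have D0 : 0 <= \int[leb n.+1]_x (g x - f x)%:E by apply: integral_ge0 => x _; rewrite lee_fin.
have fF : \int[leb n.+1]_x (f x)%:E \is a fin_num.
  by rewrite ge0_fin_numE//; apply: le_lt_trans gi; rewrite h leeDl.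
have z : \int[leb n.+1]_x (g x - f x)%:E = 0.
  by apply/eqP; rewrite eq_le D0 andbT -(leeD2lE _ _ fF) adde0 -h.
have : \int[leb n.+1]_x `|(g x - f x)%:E| = 0.
  by rewrite -[RHS]z; apply: eq_integral => x _; rewrite gee0_abs// lee_fin.
have mdE : measurable_fun [set: E] (fun x => (g x - f x)%:E) by exact/measurable_EFinP.
move/(ae_eq_integral_abs _ measurableT mdE); apply: filterS => x /(_ I) /eqP.
by rewrite eqe subr_eq0 => /eqP ->.
Qed.

(** The inequality for [freeze v y], rewritten in ray integrals of [v]. The powers of [|y|] produced
    by the three weights cancel because [p c = (b + 1) + (p - 1) a]. *)
Lemma ray_ckn p a b v y : (1 < p)%R -> annulus 1 2 y ->
  measurable_fun [set: E] v -> measurable_fun [set: E] (wgrad v) ->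
  wHspace p b (freeze v y) -> wLspace p a (freeze v y) ->
  is_wgrad (freeze v y) (ray_grad (wgrad v) y) ->
  (ckn_best (n := n.+1) p a b)%:E *
     ray_int (fun z => enorm z `^ (- (p * ckn_c p a b)) * `|v z| `^ p)%R y <=
  ray_int (fun z => enorm z `^ (- (p * (b + 1))) * `|dotp z (wgrad v z)| `^ p)%R y `^ p^-1 *
  ray_int (fun z => enorm z `^ (- (p * a)) * `|v z| `^ p)%R y `^ (p^-1 * (p - 1)).
Proof.
move=> p1 /andP[ay _] mv mG hs ls wg; have p0 : (0 < p)%R by apply: lt_trans p1.
have pn0 : (p != 0)%R by rewrite gt_eqF.
have ey : (0 < enorm y)%R by exact: lt_le_trans ay.
have y0 : y != 0%R by rewrite -enorm_gt0.
have md : measurable_fun [set: E] (fun z => dotp z (wgrad v z)) by apply: measurable_dotp.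
have := ckn_best_le p0 hs ls.
rewrite ckn_rhsE// /ckn_lhs (wHnormE b p0 wg).
rewrite (_ : wLnorm p a (freeze v y) `^ (p - 1) = wint p a (freeze v y) `^ (p^-1 * (p - 1))); last first.
  by rewrite poweRrM.
(* At [z = |x| y] one has [z . grad v (z) = |x| (y . grad v (z))]; the extra factor [|x|] moves the
   weight from [b] to [b + 1]. *)
have eA : wint p b (fun x => enorm (ray_grad (wgrad v) y x)) =
    wint p (b + 1) (freeze (fun z => dotp z (wgrad v z)) y).
  apply: ae_eq_integral; [exact: measurableT|..].
  - by apply: measurable_wintE; exact: (measurable_enormG wg).
  - by apply: measurable_wintE; exact: measurable_freeze.
  apply: ae_origin => x x0 _; congr EFin.
  have ex : (0 < enorm x)%R by rewrite enorm_gt0.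
  rewrite /freeze /ray_grad enorm_radial// normr_id.
  have -> : dotp (enorm x *: y) (wgrad v (enorm x *: y)) = (enorm x * dotp y (wgrad v (enorm x *: y)))%R.
    by rewrite /dotp mulr_sumr; apply: eq_bigr => i _; rewrite mxE mulrA.
  rewrite normrM powRM// (ger0_norm (ltW ex)) mulrA -powRD; last by rewrite (gt_eqF ex) implybT.
  by congr (_ `^ _ * _)%R; ring.
rewrite (_ : wLnorm p b _ = wint p (b + 1) (freeze (fun z => dotp z (wgrad v z)) y) `^ p^-1); last first.
  by rewrite -eA.
rewrite !wint_freeze//.
set JC := ray_int _ _; set JA := ray_int _ _; set JB := ray_int _ _.
have JA0 : 0 <= JA by apply: ray_int_ge0 => x; rewrite mulr_ge0 ?powR_ge0.
have JB0 : 0 <= JB by apply: ray_int_ge0 => x; rewrite mulr_ge0 ?powR_ge0.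
have w0 t : 0 <= (enorm y `^ t)%:E by rewrite lee_fin powR_ge0.
rewrite (poweRM _ JA0 (w0 _)) (poweRM _ JB0 (w0 _)).
rewrite !poweR_EFin -!powRrM muleACA -EFinM -powRD; last by rewrite (gt_eqF ey) implybT.
rewrite (_ : p * (b + 1) / p + p * a * (p^-1 * (p - 1)) = p * ckn_c p a b)%R; last first.
  by rewrite /ckn_c; field.
by rewrite muleA lee_pmul2r// lte_fin powR_gt0.
Qed.

End minimizers_radial.

Section minimizers_gradient.
Context {R : realType} {n : nat}.
Local Notation E := 'rV[R]_n.+1.
Implicit Types (u v f g : E -> R) (G : E -> E) (y : E) (p a b s : R).

(** The equality case of [young_ratio] at [x = h^p], [y = l^p], [r = l / h]. *)
Lemma ratio_balance p (h l : R) : 1 < p -> 0 < h -> 0 < l ->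
  (l / h) `^ (p - 1) / p * h `^ p + (p - 1) / p / (l / h) * l `^ p = h * l `^ (p - 1).
Proof.
move=> p1 h0 l0; have p0 : 0 < p by apply: lt_trans p1.
have e t : 0 < t -> t `^ p = t `^ (p - 1) * t.
  move=> t0; rewrite -[in RHS](powRr1 (ltW t0)) -[X in _ * X `^ 1](powRr1 (ltW t0)) powRr1 ?ltW//.
  by rewrite -powRD ?subrK// (gt_eqF t0) implybT.
have hn : (h `^ (p - 1))^-1 * h `^ (p - 1) = 1 by rewrite mulVf// gt_eqF// powR_gt0.
rewrite powRM ?invr_ge0 ?ltW// -[h^-1 `^ _](_ : (h `^ (p - 1))^-1 = _); last first.
  by rewrite -(powR_inv1 (ltW h0)) -powRrM mulN1r powRN.
rewrite (e h)// (e l)//.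
rewrite (_ : _ / p * _ = (h `^ (p - 1))^-1 * h `^ (p - 1) * (l `^ (p - 1) / p * h)); last by ring.
by rewrite hn; field; rewrite !gt_eqF.
Qed.

Lemma wgrad_ae0 u : measurable_fun [set: E] u -> ae_zero u -> {ae leb n.+1, forall x, wgrad u x = 0}.
Proof.
move=> mu u0; apply: (@wgrad_ae _ _ _ (fun=> 0)); split=> [i|phi i tphi].
  under eq_fun do rewrite mxE; exact: loc_integrable_cst.
rewrite [RHS](_ : _ = 0%E); last first.
  by rewrite integral0_eq ?oppe0// => x _; rewrite mxE mul0r.
rewrite (ae_eq_integral (cst 0%E))//; first by rewrite integral0_eq.
  apply/measurable_EFinP; apply: measurable_funM => //.
  by apply: test_fun_measurable; exact: test_fun_partiald.
by apply: filterS u0 => x /= ux _; rewrite ux mul0r.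
Qed.

Local Open Scope ereal_scope.

Lemma ring_weight_le y (s t : \bar R) : (annulus 1 2 y -> s <= t) ->
  (ring_weight (enorm y))%:E * s <= (ring_weight (enorm y))%:E * t.
Proof.
rewrite /ring_weight /annulus /=; case: ifP => _ h; last by rewrite !mul0e.
by rewrite !mul1e h.
Qed.

(** Averaging the linearised ray inequalities bounds [S] times the integral for [c] by [al] times
    the radial energy plus [be l^p]. For a minimizer the former is [h l^(p-1) = al h^p + be l^p],
    and [be l^p] cancels. Cauchy-Schwarz gives the opposite inequality, so the two energies
    agree. *)
Lemma radial_energy_eq p a b v (h l : R) : (1 < p)%R -> minimizers p a b v ->
  (0 < h)%R -> (0 < l)%R -> wHnorm p b v = h%:E -> wLnorm p a v = l%:E ->
  (h `^ p)%:E <= wint p (b + 1) (fun z => dotp z (wgrad v z)).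
Proof.
move=> p1 [hs ls eqv] h0 l0 hE lE; have p0 : (0 < p)%R by apply: lt_trans p1.
have [[lv [G0 /wgradP wg]] _] := hs; have [mv _] := lv.
have mG := measurable_wgradG wg.
have md : measurable_fun [set: E] (fun z => dotp z (wgrad v z)) by apply: measurable_dotp.
(* The ratio at which Young's inequality is an equality for the norms of [v]. *)
set r := (l / h)%R; have r0 : (0 < r)%R by rewrite divr_gt0.
set S := ckn_best (n := n.+1) p a b; have S0 : (0 <= S)%R by exact: ckn_best_ge0.
pose fA z := (enorm z `^ (- (p * (b + 1))) * `|dotp z (wgrad v z)| `^ p)%R.
pose fB z := (enorm z `^ (- (p * a)) * `|v z| `^ p)%R.
pose fC z := (enorm z `^ (- (p * ckn_c p a b)) * `|v z| `^ p)%R.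
have mA : measurable_fun [set: E] fA by exact: measurable_wint.
have mB : measurable_fun [set: E] fB by exact: measurable_wint.
have mC : measurable_fun [set: E] fC by exact: measurable_wint.
have A0 x : (0 <= fA x)%R by rewrite mulr_ge0 ?powR_ge0.
have B0 x : (0 <= fB x)%R by rewrite mulr_ge0 ?powR_ge0.
have C0 x : (0 <= fC x)%R by rewrite mulr_ge0 ?powR_ge0.
set al := (r `^ (p - 1) / p)%R; set be := ((p - 1) / p / r)%R.
have al0 : (0 < al)%R by rewrite divr_gt0// powR_gt0.
have be0 : (0 < be)%R by rewrite !divr_gt0// subr_gt0.
(* The zero summand only puts [fL] into the shape of [integral_lin]. *)
pose fL x := (S * fC x + 0 * fC x)%R; pose fR x := (al * fA x + be * fB x)%R.
have mL : measurable_fun [set: E] fL by apply: measurable_funD; exact: measurable_funM.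
have mR : measurable_fun [set: E] fR by apply: measurable_funD; exact: measurable_funM.
have L0 x : (0 <= fL x)%R by apply: addr_ge0; apply: mulr_ge0.
have R0 x : (0 <= fR x)%R by apply: addr_ge0; apply: mulr_ge0 => //; exact: ltW.
have jL y : ray_int fL y = S%:E * ray_int fC y.
  rewrite -[RHS]adde0 -(mul0e (ray_int fC y)).
  exact: (integral_lin S0 (lexx 0%R) (measurable_freeze y mC) (measurable_freeze y mC)
    (fun x => C0 _) (fun x => C0 _)).
have jR y : ray_int fR y = al%:E * ray_int fA y + be%:E * ray_int fB y.
  exact: (integral_lin (ltW al0) (ltW be0) (measurable_freeze y mA) (measurable_freeze y mB)
    (fun x => A0 _) (fun x => B0 _)).
have key : {ae leb n.+1, forall y : E, annulus 1 2 y -> ray_int fL y <= ray_int fR y}.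
  apply: filterS (ray_spaces p1 hs ls) => y hy ay; have [hsy lsy wgy] := hy ay.
  rewrite jL jR; apply: (le_trans (ray_ckn p1 ay mv mG hsy lsy wgy)).
  by apply: young_ratio_ereal => //; exact: ray_int_ge0.
have mw : measurable_fun [set: E] (fun y => (ring_weight (enorm y))%:E).
  by apply/measurable_EFinP; apply: (measurableT_comp measurable_ring_weight); exact: measurable_enorm.
have : \int[leb n.+1]_x (fL x)%:E <= \int[leb n.+1]_x (fR x)%:E.
  have K0 := @ray_const_gt0 R n; have Ky := @ray_const_lty R n.
  have Kf : @ray_const R n \is a fin_num by rewrite ge0_fin_numE ?ray_const_ge0.
  rewrite -(lee_pmul2l Kf K0) -(ray_int_fubini mL L0) -(ray_int_fubini mR R0).
  apply: ae_ge0_le_integral => //.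
  - by move=> y _; rewrite mule_ge0 ?ray_int_ge0// lee_fin ring_weight_ge0.
  - by apply: emeasurable_funM => //; exact: measurable_ray_int.
  - by move=> y _; rewrite mule_ge0 ?ray_int_ge0// lee_fin ring_weight_ge0.
  - by apply: emeasurable_funM => //; exact: measurable_ray_int.
  by apply: filterS key => y hy _; exact: ring_weight_le.
rewrite /fL (integral_lin S0 (lexx 0%R) mC mC C0 C0) mul0e adde0.
rewrite /fR (integral_lin (ltW al0) (ltW be0) mA mB A0 B0).
rewrite -/(wint p (ckn_c p a b) v) -/(wint p a v) -/(wint p (b + 1) (fun z => dotp z (wgrad v z))).
rewrite -ckn_rhsE// -eqv /ckn_lhs hE lE poweR_EFin -(wLnorm_pow a v p0) lE poweR_EFin.
have := wint_ge0 p (b + 1) (fun z => dotp z (wgrad v z)).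
case: (wint _ _ _) => [I| |] //; last by move=> *; rewrite leey.
move=> _; rewrite -!EFinM -EFinD !lee_fin -(ratio_balance p1 h0 l0) -/r -/al -/be.
by rewrite lerD2r ler_pM2l.
Qed.

Lemma minimizer_radial p a b v : (1 < p)%R -> minimizers p a b v ->
  {ae leb n.+1, forall x : E, forall i j,
     (x ord0 i * wgrad v x ord0 j = x ord0 j * wgrad v x ord0 i)%R}.
Proof.
move=> p1 minv; have [hs ls _] := minv; have p0 : (0 < p)%R by apply: lt_trans p1.
have [[lv [G0 /wgradP wg]] _] := hs; have [mv _] := lv.
have mG := measurable_wgradG wg; have mN := measurable_enormG wg.
have md : measurable_fun [set: E] (fun z => dotp z (wgrad v z)) by apply: measurable_dotp.
have zero_case : {ae leb n.+1, forall x, wgrad v x = 0%R} -> {ae leb n.+1, forall x : E, forall i j,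
     (x ord0 i * wgrad v x ord0 j = x ord0 j * wgrad v x ord0 i)%R}.
  by apply: filterS => x ->; move=> i j; rewrite !mxE !mulr0.
have hf : wHnorm p b v \is a fin_num by rewrite ge0_fin_numE ?wLnorm_ge0// wLnorm_lty// wHspace_lty.
have lf : wLnorm p a v \is a fin_num by rewrite ge0_fin_numE ?wLnorm_ge0// wLnorm_lty// wLspace_lty.
(* The ratio [l / h] needs two positive norms; if one of them vanishes, the gradient is zero almost
   everywhere. *)
have [h0|h0] := eqVneq (wHnorm p b v) 0.
  apply: zero_case; have := wint_eq0_ae p0 mN (wint_eq0 h0).
  by apply: filterS => x /eqP; rewrite enorm_eq0 => /eqP.
have [l0|l0] := eqVneq (wLnorm p a v) 0.
  by apply: zero_case; apply: wgrad_ae0 => //; exact: (wint_eq0_ae p0 mv (wint_eq0 l0)).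
have hp : (0 < fine (wHnorm p b v))%R.
  by apply: fine_gt0; rewrite lt0e h0 ltey_eq hf /= andbT; exact: wLnorm_ge0.
have lp : (0 < fine (wLnorm p a v))%R.
  by apply: fine_gt0; rewrite lt0e l0 ltey_eq lf /= andbT; exact: wLnorm_ge0.
have := radial_energy_eq p1 minv hp lp (esym (fineK hf)) (esym (fineK lf)).
rewrite -poweR_EFin (fineK hf) (wLnorm_pow b (fun x => enorm (wgrad v x)) p0) => hle.
have fg (x : E) : (0 <= enorm x `^ (- (p * (b + 1))) * `|dotp x (wgrad v x)| `^ p <=
    enorm x `^ (- (p * b)) * `|enorm (wgrad v x)| `^ p)%R.
  rewrite mulr_ge0 ?powR_ge0//=.
  have [->|x0] := eqVneq x 0%R.
    rewrite /dotp big1 ?normr0 ?powR0 ?gt_eqF ?mulr0 ?mulr_ge0 ?powR_ge0// => i _.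
    by rewrite mxE mul0r.
  have ex : (0 < enorm x)%R by rewrite enorm_gt0.
  apply: (@le_trans _ _ (enorm x `^ (- (p * (b + 1))) * (enorm x * enorm (wgrad v x)) `^ p)%R).
    rewrite ler_wpM2l ?powR_ge0// ge0_ler_powR ?nnegrE ?mulr_ge0 ?enorm_ge0 ?(ltW p0)//.
    exact: dotp_le.
  rewrite powRM ?enorm_ge0// mulrA -powRD; last by rewrite (gt_eqF ex) implybT.
  rewrite (ger0_norm (enorm_ge0 _)) (_ : - (p * (b + 1)) + p = - (p * b))%R//; ring.
(* The integrands are ordered pointwise by Cauchy-Schwarz and the larger integral does not exceed
   the smaller. So equality holds almost everywhere, and its equality case makes the gradient
   parallel to [x]. *)
have := integral_le_eq_ae (measurable_wint p (b + 1) md) (measurable_wint p b mN) fg (wHspace_lty p0 hs) hle.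
move=> heq; apply: (filterS2 _ _ heq (@ae_neq_origin R n)) => x ex x0 i j.
have xp : (0 < enorm x)%R by rewrite enorm_gt0.
have e : (`|dotp x (wgrad v x)| = enorm x * enorm (wgrad v x))%R.
  have : (`|dotp x (wgrad v x)| `^ p = (enorm x * enorm (wgrad v x)) `^ p)%R.
    apply: (mulfI (lt0r_neq0 (powR_gt0 (- (p * (b + 1))) xp))); rewrite ex.
    rewrite powRM ?enorm_ge0// [RHS]mulrA -powRD; last by rewrite (gt_eqF xp) implybT.
    rewrite (ger0_norm (enorm_ge0 _)) (_ : - (p * (b + 1)) + p = - (p * b))%R//; ring.
  by move/(congr1 (fun t => t `^ p^-1)%R); rewrite -!powRrM mulfV ?gt_eqF// !powRr1// mulr_ge0 ?enorm_ge0.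
have c : (enorm x ^+ 2 *: wgrad v x = dotp x (wgrad v x) *: x)%R.
  by apply: cauchy_eq; rewrite -exprMn -e real_normK ?num_real.
have ck k : (enorm x ^+ 2 * wgrad v x ord0 k = dotp x (wgrad v x) * x ord0 k)%R.
  by have := congr1 (fun w : E => w ord0 k) c; rewrite !mxE.
have x2 : (enorm x ^+ 2 != 0)%R by rewrite sqrf_eq0 gt_eqF.
by apply: (mulfI x2); rewrite mulrCA ck [RHS]mulrCA ck; ring.
Qed.

End minimizers_gradient.

(** * Angular derivatives and instability *)

Section rotations.
Context {R : realType} {n : nat}.
Local Notation E := 'rV[R]_n.+1.
Implicit Types (u v w f g h phi : E -> R) (G : E -> E) (i j : 'I_n.+1) (p q a b s l : R).

(** The angular derivative in the plane of the coordinates [i] and [j], the generator of rotations;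
    it annihilates radial functions. *)
Definition rot i j phi : E -> R :=
  fun x => x ord0 i * partiald j phi x - x ord0 j * partiald i phi x.

Lemma smooth_coord i : smooth (fun x : E => x ord0 i).
Proof. by move=> k; exact: class_C_coord. Qed.

Lemma test_fun_coordM i phi : test_fun phi -> test_fun (fun x => x ord0 i * phi x).
Proof. by move=> tphi; apply: test_funM => //; exact: smooth_coord. Qed.

Lemma partiald_coordM i j phi x : i != j -> test_fun phi ->
  partiald j (fun x => x ord0 i * phi x) x = x ord0 i * partiald j phi x.
Proof.
move=> ij tphi; rewrite [LHS]/partiald.
have [_ ->] := is_deriveMf (is_derive_coord j i x) (test_fun_is_derive j x tphi).
by rewrite (negbTE ij) mul0r add0r.
Qed.

Lemma rotE i j phi x : i != j -> test_fun phi ->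
  rot i j phi x = partiald j (fun x => x ord0 i * phi x) x - partiald i (fun x => x ord0 j * phi x) x.
Proof. by move=> ij tphi; rewrite /rot !partiald_coordM// eq_sym. Qed.

Lemma test_fun_rot i j phi : test_fun phi -> test_fun (rot i j phi).
Proof.
move=> tphi.
rewrite (_ : rot i j phi = fun x => x ord0 i * partiald j phi x + (-1 * x ord0 j) * partiald i phi x).
  apply: test_funD; first by apply: test_fun_coordM; exact: test_fun_partiald.
  apply: test_funM; first exact: test_fun_partiald.
  by move=> k; apply: class_CZ; exact: class_C_coord.
by apply/funext => x; rewrite /rot mulN1r mulNr.
Qed.

Lemma test_fun_scale l phi : 0 < l -> test_fun phi -> test_fun (fun x => phi (l *: x)).
Proof.
move=> l0 [sphi c c0]; have ln0 : l != 0 by rewrite gt_eqF.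
apply: (@test_funI _ _ _ ((fun x : E => l^-1 *: x) @` tsupport phi)).
- by move=> k; apply: class_C_scale.
- by apply: continuous_compact => //; apply: continuous_subspaceT; exact: scaler_continuous.
- by move=> [x hx /eqP]; rewrite scaler_eq0 invr_eq0 (negbTE ln0) => /eqP x0; rewrite x0 in hx.
- move=> x hx; apply: tsupport_out => h; apply: hx; exists (l *: x); first exact: h.
  by rewrite scalerA (mulVf ln0) scale1r.
Qed.

Lemma rot_scale i j l phi x : test_fun phi -> rot i j (fun x => phi (l *: x)) x = rot i j phi (l *: x).
Proof.
move=> tphi; have h := test_fun_class 1 tphi.
by rewrite /rot !partiald_scale// !mxE; ring.
Qed.

(** Since [i != j], each coordinate factor passes under the partial derivative, and the definition
    of the weak gradient can be applied to both terms. *)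
Lemma integral_rot i j phi w : i != j -> test_fun phi -> loc_integrable w ->
  (\int[leb n.+1]_x (w x * rot i j phi x)%:E =
   \int[leb n.+1]_x (w x * partiald j (fun x => x ord0 i * phi x) x)%:E -
   \int[leb n.+1]_x (w x * partiald i (fun x => x ord0 j * phi x) x)%:E)%E.
Proof.
move=> ij tphi lw; rewrite -integralB_EFin//.
- by apply: eq_integral => x _; rewrite rotE// mulrBr EFinB.
- by apply: integrable_loc_test => //; apply: test_fun_partiald; exact: test_fun_coordM.
- by apply: integrable_loc_test => //; apply: test_fun_partiald; exact: test_fun_coordM.
Qed.

(** Integration by parts turns the pairing into the integral of [(x_j G_i - x_i G_j) phi]. *)
Lemma integral_rot_radial i j phi v G : i != j -> test_fun phi -> loc_integrable v ->
  is_wgrad v G ->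
  {ae leb n.+1, forall x : E, x ord0 i * G x ord0 j = x ord0 j * G x ord0 i} ->
  (\int[leb n.+1]_x (v x * rot i j phi x)%:E = 0)%E.
Proof.
move=> ij tphi lv [lG wg] hG; rewrite integral_rot// !wg; try exact: test_fun_coordM.
have ig k (k' : 'I_n.+1) : (leb n.+1).-integrable [set: E] (fun x => (G x ord0 k * (x ord0 k' * phi x))%:E).
  by apply: integrable_loc_test => //; exact: test_fun_coordM.
rewrite (_ : \int[leb n.+1]_x (G x ord0 j * (x ord0 i * phi x))%:E =
             \int[leb n.+1]_x (G x ord0 i * (x ord0 j * phi x))%:E)%E.
  rewrite subee// fin_numN; exact: integrable_fin_num.
apply: ae_eq_integral => //; [exact: measurable_int (ig j i)|exact: measurable_int (ig i j)|].
by apply: filterS hG => x hx _; rewrite !mulrA ![_ * x ord0 _]mulrC hx.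
Qed.

Local Open Scope ereal_scope.

Lemma pairing_le p q s f g h : measurable_fun [set: E] f -> measurable_fun [set: E] g ->
  measurable_fun [set: E] h -> (0 < p)%R -> (0 < q)%R -> (p^-1 + q^-1 = 1)%R ->
  (forall x, `|h x| <= `|f x|)%R ->
  `|\int[leb n.+1]_x (h x * g x)%:E| <= wLnorm p s f * wLnorm q (- s) g.
Proof.
move=> mf mg mh p0 q0 pq hf.
apply: (@le_trans _ _ (\int[leb n.+1]_x `|(h x * g x)%:E|)).
  by apply: le_abse_integral => //; apply/measurable_EFinP; exact: measurable_funM.
apply: le_trans (weighted_hoelder s mf mg p0 q0 pq).
apply: ge0_le_integral => //.
- by apply: measurableT_comp => //; apply/measurable_EFinP; exact: measurable_funM.
- by apply/measurable_EFinP; apply: measurableT_comp => //; exact: measurable_funM.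
- by move=> x _; rewrite lee_fin !normrM ler_wpM2r.
Qed.

(** [wint 2 0] is the unweighted integral of the square; subtracting the orthogonal [v] from one
    factor changes nothing. *)
Lemma rot_energy i j phi v : i != j -> test_fun phi -> loc_integrable v ->
  \int[leb n.+1]_x (v x * rot i j phi x)%:E = 0 ->
  \int[leb n.+1]_x ((rot i j phi \- v) x * rot i j phi x)%:E = wint 2 0 (rot i j phi).
Proof.
move=> ij tphi lv hv; have tr := test_fun_rot i j tphi.
have lr : loc_integrable (rot i j phi).
  by apply: loc_integrable_continuous; exact: test_fun_continuous.
rewrite -[RHS]sube0 -hv.
rewrite (_ : wint 2 0 (rot i j phi) = \int[leb n.+1]_x (rot i j phi x * rot i j phi x)%:E).
  rewrite -integralB_EFin//; try exact: integrable_loc_test.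
  by apply: eq_integral => x _; rewrite -EFinB -mulrBl.
apply: eq_integral => x _; rewrite mulr0 oppr0 powRr0 mul1r powR_mulrn//.
by rewrite real_normK ?num_real// expr2.
Qed.

Lemma rot_dist_L p q a i j phi v : i != j -> (0 < p)%R -> (0 < q)%R -> (p^-1 + q^-1 = 1)%R ->
  test_fun phi -> loc_integrable v ->
  \int[leb n.+1]_x (v x * rot i j phi x)%:E = 0 ->
  wint 2 0 (rot i j phi) <= wLnorm p a (rot i j phi \- v)%R * wLnorm q (- a) (rot i j phi).
Proof.
move=> ij p0 q0 pq tphi lv hv; have tr := test_fun_rot i j tphi.
have mr := test_fun_measurable tr; have [mv _] := lv.
have md : measurable_fun [set: E] (rot i j phi \- v)%R by exact: measurable_funB.
rewrite -(rot_energy ij tphi lv hv); apply: (le_trans (lee_abs _)).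
exact: pairing_le.
Qed.

(** The distance controls only the gradient of the difference, so the angular derivative is moved
    from [phi] to the difference; the coordinates are left on [phi] and enter the dual norms. *)
Lemma rot_dist_H p q b i j phi v : i != j -> (0 < p)%R -> (0 < q)%R -> (p^-1 + q^-1 = 1)%R ->
  test_fun phi -> wdifferentiable v ->
  \int[leb n.+1]_x (v x * rot i j phi x)%:E = 0 ->
  wint 2 0 (rot i j phi) <= wHnorm p b (rot i j phi \- v)%R *
    (wLnorm q (- b) (fun x => x ord0 i * phi x)%R + wLnorm q (- b) (fun x => x ord0 j * phi x)%R).
Proof.
move=> ij p0 q0 pq tphi [lv [G wv]] hv; have tr := test_fun_rot i j tphi.
have lr : loc_integrable (rot i j phi).
  by apply: loc_integrable_continuous; exact: test_fun_continuous.
have ld : loc_integrable (rot i j phi \- v)%R.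
  by apply: (loc_integrableD lr); exact: loc_integrableN.
have [lW ww] := wgradP (is_wgradB lr lv (is_wgrad_test tr) wv).
set W := wgrad _ in lW ww.
rewrite -(rot_energy ij tphi lv hv); apply: (le_trans (lee_abs _)).
have ti := test_fun_coordM i tphi; have tj := test_fun_coordM j tphi.
rewrite (integral_rot ij tphi ld) !ww//.
apply: (le_trans (lee_abs_sub _ _)); rewrite !abseN ge0_muleDr ?wLnorm_ge0//.
have mN : measurable_fun [set: E] (fun x => enorm (W x)).
  by apply: (measurableT_comp (@measurable_enorm R n.+1)); exact: measurable_loc_row.
apply: leeD; apply: pairing_le => //; try exact: test_fun_measurable.
- by have [] := lW j.
- by move=> x; rewrite (ger0_norm (enorm_ge0 _)); exact: coord_le_enorm.
- by have [] := lW i.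
- by move=> x; rewrite (ger0_norm (enorm_ge0 _)); exact: coord_le_enorm.
Qed.

End rotations.

(** * Dilations and the scaling contradiction *)

Section dilations.
Context {R : realType} {n : nat}.
Local Notation E := 'rV[R]_n.+1.
Local Notation N := (n.+1%:R : R).
Implicit Types (u v w f g phi : E -> R) (i j : 'I_n.+1) (p q a b s l t : R).

(** Take [phi = x_j e0_bump]: at the first basis vector [x_j] vanishes and [x_0 = 1], so the angular
    derivative there equals [e0_bump], which is positive. *)
Lemma exists_rot_neq0 j : j != ord0 ->
  exists phi : E -> R, test_fun phi /\ ~ ae_zero (rot ord0 j phi).
Proof.
move=> j0; pose phi := fun x : E => x ord0 j * e0_bump x; exists phi.
have tphi : test_fun phi by apply: test_fun_coordM; exact: test_fun_e0_bump.
split=> // h; have := continuous_ae_zero (test_fun_continuous (test_fun_rot ord0 j tphi)) h (delta_mx ord0 ord0).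
rewrite /rot [partiald j _]/partiald.
have [_ ->] := is_deriveMf (is_derive_coord j j (delta_mx ord0 ord0))
  (test_fun_is_derive j (delta_mx ord0 ord0) (@test_fun_e0_bump R n)).
rewrite !mxE !eqxx (negbTE j0) /= !mul0r !mul1r subr0 addr0 => e.
by have := @e0_bump_gt0 R n; rewrite e ltxx.
Qed.

Local Open Scope ereal_scope.

Lemma wLnormZ p s (c : R) u : (0 < p)%R -> measurable_fun [set: E] u ->
  wLnorm p s (fun x => c * u x)%R = `|c|%:E * wLnorm p s u.
Proof.
move=> p0 mu; rewrite /wLnorm -/(wint p s (fun x => c * u x)%R) wintZ//.
rewrite poweRM ?lee_fin ?powR_ge0 ?wint_ge0// poweR_EFin -powRrM mulfV ?gt_eqF//.
by rewrite powRr1.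
Qed.

Lemma wHnorm_scale p b l u : (0 < p)%R -> (0 < l)%R -> test_fun u ->
  wHnorm p b (fun x => u (l *: x)%R) = (l `^ (b + 1 - N / p))%:E * wHnorm p b u.
Proof.
move=> p0 l0 tu; have mN := measurable_enormG (is_wgrad_test tu).
rewrite !wHnorm_test//; last exact: test_fun_scale.
have -> : (fun x => enorm (grad (fun y => u (l *: y)%R) x)) = (fun x => l * enorm (grad u (l *: x)))%R.
  apply/funext => x; rewrite (_ : grad _ x = l *: grad u (l *: x)) ?enormZ ?gtr0_norm//.
  by apply/rowP => i; rewrite [RHS]mxE !gradE partiald_scale//; exact: test_fun_class.
rewrite (wLnormZ b l p0); last by apply: (measurableT_comp mN); exact: measurable_scale_rV.
rewrite (wLnorm_scale b p0 l0 mN) muleA -EFinM gtr0_norm//; congr ((_)%:E * _).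
rewrite -[X in (X * _)%R](powRr1 (ltW l0)) -powRD; last by rewrite (gt_eqF l0) implybT.
by congr (_ `^ _)%R; ring.
Qed.

Lemma ckn_rhs_scale p a b l u : (0 < p)%R -> (0 < l)%R -> measurable_fun [set: E] u ->
  ckn_rhs p a b (fun x => u (l *: x)%R) = (l `^ (p * ckn_c p a b - N))%:E * ckn_rhs p a b u.
Proof. by move=> p0 l0 mu; rewrite !ckn_rhsE// wint_scale. Qed.

(** The exponents [b + 1 - N/p] and [(p - 1) (a - N/p)] add up to the one in [ckn_rhs_scale]; this
    is the relation that fixes [c] and makes the deficit invariant. *)
Lemma ckn_lhs_scale p a b l u : (0 < p)%R -> (0 < l)%R -> test_fun u ->
  ckn_lhs p a b (fun x => u (l *: x)%R) = (l `^ (p * ckn_c p a b - N))%:E * ckn_lhs p a b u.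
Proof.
move=> p0 l0 tu; have mu := test_fun_measurable tu.
rewrite /ckn_lhs wHnorm_scale// wLnorm_scale//.
rewrite poweRM ?lee_fin ?powR_ge0 ?wLnorm_ge0// poweR_EFin -powRrM.
rewrite muleACA -EFinM -powRD; last by rewrite (gt_eqF l0) implybT.
congr ((_ `^ _)%:E * _); rewrite /ckn_c; field; rewrite gt_eqF//.
Qed.

Lemma deficit_scale p a b u : (1 < p)%R -> test_fun u -> ~ ae_zero u ->
  exists D : R, forall l, (0 < l)%R -> deficit p a b (fun x => u (l *: x)%R) = D%:E.
Proof.
move=> p1 tu nu; have p0 : (0 < p)%R by apply: lt_trans p1.
have mu := test_fun_measurable tu.
have [hu lu] := (wHspace_test b p0 tu, wLspace_test a p0 tu).
have r0 := ckn_rhs_gt0 a b p0 mu nu.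
have ry : ckn_rhs p a b u < +oo by rewrite ckn_rhsE// wint_test_lty.
have ly := ckn_lhs_lty p0 hu lu; have l0 := ckn_lhs_ge0 p a b u.
have fr : ckn_rhs p a b u \is a fin_num by rewrite ge0_fin_numE// ltW.
have fl : ckn_lhs p a b u \is a fin_num by rewrite ge0_fin_numE.
have r1 : (0 < fine (ckn_rhs p a b u))%R by rewrite fine_gt0// r0 ry.
exists (fine (ckn_lhs p a b u) / fine (ckn_rhs p a b u) - ckn_best (n := n.+1) p a b)%R => l lp.
rewrite /deficit ckn_lhs_scale// ckn_rhs_scale//.
have kp : (0 < l `^ (p * ckn_c p a b - N))%R by exact: powR_gt0.
rewrite -[X in _ * X / _](fineK fl) -[X in _ / (_ * X)](fineK fr) -!EFinM inver.
rewrite gt_eqF ?mulr_gt0// -EFinM -EFinB; congr ((_ - _)%:E).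
by field; rewrite !gt_eqF.
Qed.

(** Solve [(k l^e)^al = |M| + 1] for [l]; the solution is large or small according to the sign of
    [e]. *)
Lemma unbounded_power (k e al M : R) : (0 < k)%R -> e != 0%R -> (0 < al)%R ->
  exists2 l, (0 < l)%R & (M < (k * l `^ e) `^ al)%R.
Proof.
move=> k0 e0 al0; set T := (`|M| + 1)%R.
have T0 : (0 < T)%R by rewrite ltr_wpDl.
exists ((T `^ al^-1 / k) `^ e^-1)%R; first by rewrite powR_gt0// divr_gt0// powR_gt0.
have h0 : (0 <= T `^ al^-1 / k)%R by rewrite divr_ge0 ?powR_ge0// ltW.
rewrite -powRrM mulVf// powRr1// mulrC divfK ?gt_eqF// -powRrM mulVf ?gt_eqF// powRr1 ?ltW//.
by rewrite /T (le_lt_trans (ler_norm M))// ltrDl.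
Qed.

(** Treats both distances at once, [t] being the scaling exponent of [d]. Along the dilates of [u]
    the quotient is at least a constant times [l^(t - c)], while the right-hand side stays equal to
    [C D]. *)
Lemma unstable p a b (d : (E -> R) -> (E -> R) -> \bar R) u t (k : R) :
  (1 < p)%R -> test_fun u -> ~ ae_zero u -> (0 < k)%R -> t != ckn_c p a b ->
  (forall l, (0 < l)%R -> forall v, minimizers p a b v ->
     (k * l `^ (t - N / p))%:E <= d (fun x => u (l *: x)%R) v) ->
  ~ exists C alpha : R, [/\ (0 < C)%R, (0 < alpha)%R &
      forall u : E -> R, wHspace p b u -> wLspace p a u -> ~ ae_zero u ->
        (ereal_inf [set d u v | v in minimizers p a b] / wLnorm p (ckn_c p a b) u) `^ alpha
         <= C%:E * deficit p a b u].
Proof.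
move=> p1 tu nu k0 tc hd [C [al [C0 al0 H]]].
have p0 : (0 < p)%R by apply: lt_trans p1.
have mu := test_fun_measurable tu.
have [D hD] := deficit_scale a b p1 tu nu.
set c := ckn_c p a b in tc H *.
have ny : wLnorm p c u < +oo by rewrite wLnorm_lty// wint_test_lty.
have n0 : 0 < wLnorm p c u.
  rewrite lt0e wLnorm_ge0 andbT; apply/eqP => /wint_eq0 h; apply: nu.
  exact: wint_eq0_ae h.
have nf : wLnorm p c u \is a fin_num by rewrite ge0_fin_numE// ltW.
set L := fine (wLnorm p c u); have L0 : (0 < L)%R by rewrite fine_gt0// n0 ny.
have tc0 : (t - c != 0)%R by rewrite subr_eq0.
have [l l0 hl] := unbounded_power (C * D) (divr_gt0 k0 L0) tc0 al0.
have tul := test_fun_scale l0 tu.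
have nul : ~ ae_zero (fun x => u (l *: x)%R).
  move=> h; apply: nu; apply: aeW => x.
  have := continuous_ae_zero (test_fun_continuous tul) h (l^-1 *: x)%R.
  by rewrite scalerA mulfV ?gt_eqF// scale1r.
have := H _ (wHspace_test b p0 tul) (wLspace_test a p0 tul) nul.
rewrite hD// -EFinM leNgt => /negP; apply.
have kl0 : (0 <= k / L * l `^ (t - c))%R by rewrite mulr_ge0 ?powR_ge0// divr_ge0// ltW.
apply: (@lt_le_trans _ _ ((k / L * l `^ (t - c)) `^ al)%:E); first by rewrite lte_fin.
rewrite -poweR_EFin.
have lk : (k / L * l `^ (t - c))%:E <=
    ereal_inf [set d (fun x => u (l *: x)%R) v | v in minimizers p a b] /
    wLnorm p c (fun x => u (l *: x)%R).
  rewrite wLnorm_scale// -(fineK nf) -/L -EFinM inver gt_eqF ?mulr_gt0 ?powR_gt0//.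
  rewrite (_ : (k / L * l `^ (t - c))%:E = (k * l `^ (t - N / p))%:E * ((l `^ (c - N / p) * L)^-1)%:E); last first.
    rewrite -EFinM; congr EFin.
    rewrite (_ : t - N / p = t - c + (c - N / p))%R; last by ring.
    rewrite [X in (k * X / _)%R]powRD; last by rewrite (gt_eqF l0) implybT.
    by field; rewrite !gt_eqF ?powR_gt0.
  apply: lee_wpmul2r; first by rewrite lee_fin invr_ge0 mulr_ge0 ?powR_ge0// ltW.
  (* With no minimizers the infimum is [+oo] and the bound still holds. *)
  by apply: le_ereal_inf_tmp => _ [v mv <-]; exact: hd.
have kE : 0 <= (k / L * l `^ (t - c))%:E by rewrite lee_fin.
apply: gt0_ler_poweR => //; [exact: ltW|rewrite in_itv /= kE leey//|].
by rewrite in_itv /= leey andbT; exact: le_trans lk.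
Qed.

End dilations.

Section rotational_witness.
Context {R : realType} {n : nat}.
Local Notation E := 'rV[R]_n.+1.
Local Notation N := (n.+1%:R : R).
Implicit Types (v phi : E -> R) (i j : 'I_n.+1) (p q a b l t : R).
Local Open Scope ereal_scope.

Lemma minimizer_rot0 p a b i j phi v : (1 < p)%R -> i != j -> test_fun phi ->
  minimizers p a b v -> \int[leb n.+1]_x (v x * rot i j phi x)%:E = 0.
Proof.
move=> p1 ij tphi mv; have [[[lv [G /wgradP wg]] _] _ _] := mv.
apply: (integral_rot_radial ij tphi lv wg).
by apply: filterS (minimizer_radial p1 mv) => x.
Qed.

Lemma rot_comp_scale i j l phi : test_fun phi ->
  rot i j (fun x => phi (l *: x)%R) = (fun x => rot i j phi (l *: x)%R).
Proof. by move=> tphi; apply/funext => x; rewrite rot_scale. Qed.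

(** Division by a positive real bound [B] of the dual norm [Q] avoids dividing by an extended
    real. *)
Lemma ereal_div_bound (I B k1 k2 : R) (X Q : \bar R) : (0 < B)%R -> (0 < k2)%R ->
  0 <= X -> Q <= B%:E -> (k1 * I)%:E <= X * (k2%:E * Q) -> (I / B * (k1 / k2))%:E <= X.
Proof.
move=> B0 k20 X0 QB h.
have {}h : (k1 * I)%:E <= X * (k2 * B)%:E.
  by apply: le_trans h _; rewrite lee_wpmul2l// EFinM lee_wpmul2l// lee_fin ltW.
case: X X0 h => [x| |] // _; last by rewrite leey.
rewrite -EFinM !lee_fin => h.
rewrite (_ : I / B * (k1 / k2) = k1 * I / (k2 * B))%R; last by field; rewrite !gt_eqF.
by rewrite ler_pdivrMr// mulr_gt0.
Qed.

Lemma wint2_scale l phi : (0 < l)%R -> measurable_fun [set: E] phi ->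
  wint 2 0 (fun x => phi (l *: x)%R) = (l `^ (- N))%:E * wint 2 0 phi.
Proof. by move=> l0 mphi; rewrite wint_scale// mulr0 add0r. Qed.

Section lower_bounds.
Variables (p a b : R) (i j : 'I_n.+1) (phi : E -> R).
Hypotheses (p1 : (1 < p)%R) (ij : i != j) (tphi : test_fun phi)
  (nphi : ~ ae_zero (rot i j phi)).

Let psi := rot i j phi.
Let q : R := p / (p - 1).

Let p0 : (0 < p)%R. Proof. exact: lt_trans p1. Qed.
Let q0 : (0 < q)%R. Proof. by rewrite divr_gt0// subr_gt0. Qed.
Let pq : (p^-1 + q^-1 = 1)%R.
Proof. by rewrite /q; field; rewrite subr_eq0 !gt_eqF. Qed.

Let tpsi : test_fun psi. Proof. exact: test_fun_rot. Qed.

Let I0 : (0 < fine (wint 2 0 psi))%R.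
Proof.
rewrite fine_gt0// wint_test_lty// lt0e wint_ge0 !andbT; apply/eqP => h; apply: nphi.
exact: (wint_eq0_ae _ (test_fun_measurable tpsi) h).
Qed.

Let IE : (fine (wint 2 0 psi))%:E = wint 2 0 psi.
Proof. by rewrite fineK// ge0_fin_numE ?wint_ge0// wint_test_lty. Qed.

(** The square integral scales like [l^(-N)] and the dual norm like [l^(t - N/q)]; this is the
    exponent of their quotient, to be used at [t = -a] and [t = -(b + 1)]. *)
Let exponent t : (- N - (t - N / q) = - t - N / p)%R.
Proof. have -> : (- N = - N * (p^-1 + q^-1))%R by rewrite pq mulr1.
by ring. Qed.

Lemma wLnorm_dist_minimizers : exists2 k : R, (0 < k)%R &
  forall l, (0 < l)%R -> forall v, minimizers p a b v ->
    (k * l `^ (a - N / p))%:E <= wLnorm p a ((fun x => psi (l *: x)) \- v)%R.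
Proof.
pose Q := wLnorm q (- a) psi; have Qy : Q < +oo by rewrite wLnorm_lty// wint_test_lty.
have Q0 : 0 <= Q by exact: wLnorm_ge0.
pose B := (fine Q + 1)%R; have B0 : (0 < B)%R by rewrite ltr_wpDl// fine_ge0.
have QB : Q <= B%:E by rewrite -(@fineK _ Q) ?ge0_fin_numE// lee_fin lerDl.
exists (fine (wint 2 0 psi) / B)%R; first by rewrite divr_gt0.
move=> l l0 v mv; have [[lv _] _] := (let: And3 h _ _ := mv in h).
have tl := test_fun_scale l0 tphi.
have := rot_dist_L a ij p0 q0 pq tl lv (minimizer_rot0 p1 ij tl mv).
rewrite rot_comp_scale// -/psi wint2_scale; [|exact: l0|exact: test_fun_measurable].
rewrite -IE -EFinM (wLnorm_scale _ q0 l0 (test_fun_measurable tpsi)) -/Q => h.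
have := ereal_div_bound B0 (powR_gt0 (- a - N / q) l0) (wLnorm_ge0 _ _ _) QB h.
rewrite -powRN -powRD; last by rewrite (gt_eqF l0) implybT.
by rewrite exponent opprK.
Qed.

Lemma wHnorm_dist_minimizers : exists2 k : R, (0 < k)%R &
  forall l, (0 < l)%R -> forall v, minimizers p a b v ->
    (k * l `^ (b + 1 - N / p))%:E <= wHnorm p b ((fun x => psi (l *: x)) \- v)%R.
Proof.
have tc k := test_fun_coordM k tphi.
pose Qk k := wLnorm q (- b) (fun x => x ord0 k * phi x)%R.
pose Q := Qk i + Qk j.
have Qy : Q < +oo by rewrite lte_add_pinfty// wLnorm_lty// wint_test_lty.
have Q0 : 0 <= Q by rewrite adde_ge0// wLnorm_ge0.
pose B := (fine Q + 1)%R; have B0 : (0 < B)%R by rewrite ltr_wpDl// fine_ge0.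
have QB : Q <= B%:E by rewrite -(@fineK _ Q) ?ge0_fin_numE// lee_fin lerDl.
exists (fine (wint 2 0 psi) / B)%R; first by rewrite divr_gt0.
move=> l l0 v mv; have [wv _] := (let: And3 h _ _ := mv in h).
have tl := test_fun_scale l0 tphi.
have := rot_dist_H b ij p0 q0 pq tl wv (minimizer_rot0 p1 ij tl mv).
rewrite rot_comp_scale// -/psi wint2_scale; [|exact: l0|exact: test_fun_measurable].
have eQ k : wLnorm q (- b) (fun x => x ord0 k * phi (l *: x))%R =
    (l `^ (- (b + 1) - N / q))%:E * Qk k.
  (* The coordinate is not dilated along with [phi]; compensating it costs a factor [1/l], which
     turns the exponent [-b] into [-(b + 1)]. *)
  have -> : (fun x : E => x ord0 k * phi (l *: x))%R =
      (fun x => l^-1 * ((l *: x) ord0 k * phi (l *: x)))%R.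
    by apply/funext => x; rewrite mxE !mulrA mulVf ?gt_eqF// mul1r.
  have mk := test_fun_measurable (tc k).
  rewrite (wLnormZ (- b) l^-1 q0 (u := fun x => ((l *: x) ord0 k * phi (l *: x))%R)); last first.
    by apply: (measurableT_comp mk); exact: measurable_scale_rV.
  rewrite (wLnorm_scale (- b) q0 l0 mk) muleA -EFinM; congr (_%:E * _).
  rewrite gtr0_norm ?invr_gt0// -(powR_inv1 (ltW l0)) -powRD; last by rewrite (gt_eqF l0) implybT.
  by congr (_ `^ _)%R; ring.
rewrite !eQ -ge0_muleDr ?wLnorm_ge0// -/Q -IE -EFinM => h.
have := ereal_div_bound B0 (powR_gt0 _ l0) (wLnorm_ge0 _ _ _) QB h.
rewrite -powRN -powRD; last by rewrite (gt_eqF l0) implybT.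
by rewrite exponent opprK.
Qed.

End lower_bounds.

End rotational_witness.

Theorem proposition1p7 (R : realType) (N : nat) (p a b : R)
    (hN : (1 <= N)%N) (hp1 : 1 < p) (hpN : p < N%:R) (hab : b + 1 != a) :
  (~ exists C alpha : R, [/\ 0 < C, 0 < alpha &
      forall u : 'rV[R]_N -> R,
        wHspace p b u -> wLspace p a u -> ~ ae_zero u ->
        ((ereal_inf [set wHnorm p b (u \- v)%R | v in minimizers p a b]
           / wLnorm p (ckn_c p a b) u) `^ alpha
         <= C%:E * deficit p a b u)%E]) /\
  (~ exists C alpha : R, [/\ 0 < C, 0 < alpha &
      forall u : 'rV[R]_N -> R,
        wHspace p b u -> wLspace p a u -> ~ ae_zero u ->
        ((ereal_inf [set wLnorm p a (u \- v)%R | v in minimizers p a b]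
           / wLnorm p (ckn_c p a b) u) `^ alpha
         <= C%:E * deficit p a b u)%E]).
Proof.
(* From [1 < p < N] there are at least two coordinates, hence a plane to rotate in. *)
case: N hN hpN => [//|[|m]] _ hpN; first by have := lt_trans hp1 hpN; rewrite ltxx.
have p0 : 0 < p by exact: lt_trans hp1.
pose j : 'I_m.+2 := lift ord0 ord0.
have [phi [tphi nphi]] := @exists_rot_neq0 R m.+1 j isT.
have ij : ord0 != j by [].
have tpsi := test_fun_rot ord0 j tphi.
split.
- have [k k0 hk] := @wHnorm_dist_minimizers _ _ p a b _ _ _ hp1 ij tphi nphi.
  apply: (unstable (d := fun u v => wHnorm p b (u \- v)) hp1 tpsi nphi k0 _ hk).
  (* This is [b + 1 - c], nonzero because [p != 1] and [b + 1 != a]. *)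
  rewrite -subr_eq0 /ckn_c (_ : _ - _ = (p - 1) * (b + 1 - a) / p); last by field; rewrite gt_eqF.
  by rewrite !mulf_eq0 invr_eq0 !subr_eq0 (negbTE hab) (gt_eqF hp1) (gt_eqF p0).
- have [k k0 hk] := @wLnorm_dist_minimizers _ _ p a b _ _ _ hp1 ij tphi nphi.
  apply: (unstable (d := fun u v => wLnorm p a (u \- v)) hp1 tpsi nphi k0 _ hk).
  (* This is [a - c], of sign opposite to that of [b + 1 - c], since [c] is a weighted mean of [a]
     and [b + 1]. *)
  rewrite -subr_eq0 /ckn_c (_ : _ - _ = - (b + 1 - a) / p); last by field; rewrite gt_eqF.
  by rewrite mulf_eq0 invr_eq0 oppr_eq0 subr_eq0 (negbTE hab) (gt_eqF p0).
Qed.
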